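(* The map $c_X^4:H_{\mathrm{mb}}^4(G\curvearrowright X;\mathbb R)\to H_{\mathrm m}^4(G\curvearrowright X;\mathbb R)$ is injective.
   Context: $V=\mathbb C^4$ carries a nondegenerate alternating $\mathbb C$-bilinear form $\omega$, $G=\mathrm{Sp}(V,\omega)\cong\mathrm{Sp}(4,\mathbb C)$, and $X=\mathbb P(V)$ is the space of complex lines with its smooth measure class (product class on $X^n$). $H_{\mathrm{m}}^q(G\curvearrowright X;\mathbb R)$, resp. $H_{\mathrm{mb}}^q(G\curvearrowright X;\mathbb R)$, is the $q$-th unreduced cohomology $\ker d/\operatorname{im}d$ of the complex $L^0(X^{q+1})^G$, resp. $L^\infty(X^{q+1})^G$, of diagonally $G$-invariant classes (modulo a.e. equality) of real a.e. finite measurable, resp. essentially bounded, functions, with $(dc)(x_0,\dots,x_{q+1})=\sum_{i=0}^{q+1}(-1)^ic(x_0,\dots,\widehat{x_i},\dots,x_{q+1})$. The map $c_X^q$ (action comparison map) is induced by the inclusion $L^\infty\subset L^0$. *)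

(* Defs.v *)
From HB Require Import structures.
From mathcomp Require Import all_boot all_order all_algebra.
From mathcomp Require Import sesquilinear ring_quotient.
From mathcomp Require Import complex.
From mathcomp Require Import all_classical all_reals all_analysis.
From mathcomp Require Import measurable_realfun.

Set Implicit Arguments.
Unset Strict Implicit.
Unset Printing Implicit Defensive.

Import Order.TTheory GRing.Theory Num.Theory.
Import numFieldNormedType.Exports.

Local Open Scope classical_set_scope.
Local Open Scope ring_scope.
Local Open Scope quotient_scope.

Section PowerMeasure.
Context d (T : measurableType d) (R : realType).

Definition tcons n (x : T * n.-tuple T) : n.+1.-tuple T := [tuple of x.1 :: x.2].

Lemma measurable_tcons n : measurable_fun setT (@tcons n).
Proof. exact: measurable_cons. Qed.

HB.instance Definition _ n :=
  isMeasurableFun.Build _ _ _ _ (@tcons n) (@measurable_tcons n).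

Definition tuncons n (x : n.+1.-tuple T) : T * n.-tuple T :=
  (thead x, [tuple of behead x]).

Lemma measurable_tuncons n : measurable_fun setT (@tuncons n).
Proof.
apply/measurable_fun_pair; last exact: measurable_behead.
exact: measurable_tnth.
Qed.

Lemma tconsK n : cancel (@tcons n) (@tuncons n).
Proof. by case=> x t; congr pair; apply: val_inj. Qed.

Lemma tunconsK n : cancel (@tuncons n) (@tcons n).
Proof. by move=> t; rewrite [RHS]tuple_eta. Qed.

Section cons_measure.
Variables (m : {sigma_finite_measure set T -> \bar R}).
Variables (n : nat) (mn : {sigma_finite_measure set (n.-tuple T) -> \bar R}).

Definition cons_measure : set (n.+1.-tuple T) -> \bar R :=
  pushforward (m \x mn)%E (@tcons n).

Let cons_measure0 : cons_measure set0 = 0%E.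
Proof. by rewrite /cons_measure /pushforward preimage_set0 measure0. Qed.

Let cons_measure_ge0 A : (0 <= cons_measure A)%E.
Proof. exact: measure_ge0. Qed.

Let cons_measure_sigma_additive : semi_sigma_additive cons_measure.
Proof.
move=> F mF tF mUF; rewrite /cons_measure /pushforward preimage_bigcup.
apply: measure_semi_sigma_additive.
- by move=> k; rewrite -[_ @^-1` _]setTI; exact: measurable_tcons.
- apply/trivIsetP => i j _ _ ij; rewrite -preimage_setI.
  by move/trivIsetP : tF => /(_ _ _ _ _ ij) ->//; rewrite preimage_set0.
- by rewrite -preimage_bigcup -[_ @^-1` _]setTI; exact: measurable_tcons.
Qed.

HB.instance Definition _ := isMeasure.Build _ _ _ cons_measure
  cons_measure0 cons_measure_ge0 cons_measure_sigma_additive.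

Let cons_measure_sigma_finite : sigma_finite setT cons_measure.
Proof.
have /sigma_finiteP[F [FT ndF Foo]] := sigma_finiteT m.
have /sigma_finiteP[G [GT ndG Goo]] := sigma_finiteT mn.
exists (fun k => @tuncons n @^-1` (F k `*` G k)).
  rewrite -preimage_bigcup -[LHS](preimage_setT (@tuncons n)); congr (_ @^-1` _).
  rewrite -setXTT FT GT predeqE => -[x y]; split.
    move=> [/= [i _ Fix] [j _ Gjy]]; exists (maxn i j) => //; split.
    - by move: x Fix; exact/subsetPset/ndF/leq_maxl.
    - by move: y Gjy; exact/subsetPset/ndG/leq_maxr.
  by move=> [i _ []/= ? ?]; split; exists i.
move=> k; have [mF Fk] := Foo k; have [mG Gk] := Goo k; split.
  rewrite -[_ @^-1` _]setTI; apply: measurable_tuncons => //.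
  exact: measurableX.
rewrite /cons_measure /pushforward (_ : _ @^-1` _ = F k `*` G k).
  by rewrite product_measure1E// lte_mul_pinfty// ge0_fin_numE.
by rewrite -comp_preimage (_ : _ \o _ = id)//; apply/funext/tconsK.
Qed.

HB.instance Definition _ := Measure_isSigmaFinite.Build _ _ _ cons_measure
  cons_measure_sigma_finite.

End cons_measure.

Fixpoint power_measure (m : {sigma_finite_measure set T -> \bar R}) n :
    {sigma_finite_measure set (n.-tuple T) -> \bar R} :=
  if n is k.+1 then cons_measure m (power_measure m k)
  else dirac ([tuple] : 0.-tuple T).

End PowerMeasure.

Notation vecC4 R := 'rV[R[i]]_4.

Section ProjectiveSpace.
Variable R : realType.

Record projSpace : Type := ProjPoint {
  proj_line :> {vspace vecC4 R};
  dim_proj_line : \dim proj_line == 1%N }.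

HB.instance Definition _ := [isSub for proj_line].
HB.instance Definition _ := [Choice of projSpace by <:].

Lemma dim_line (v : vecC4 R) : v != 0 -> \dim <[v]>%VS == 1%N.
Proof. by move=> v0; rewrite dim_vline v0. Qed.

(* C^3 as R^6: real and imaginary parts of the coordinates alternate *)
Local Notation realC3 := (6.-tuple (measurableTypeR R)).

Definition realC3_coord (z : realC3) (j : 'I_3) : R[i] :=
  Complex z`_j.*2 z`_j.*2.+1.

Definition lebesgueC3 : {sigma_finite_measure set realC3 -> \bar R} :=
  power_measure (@lebesgue_measure R) 6.

(* the vector with i-th coordinate 1 and z as its remaining coordinates *)
Definition affine_vec (i : 'I_4) (z : realC3) : vecC4 R :=
  \row_k (if unlift i k is Some j then realC3_coord z j else 1).

Lemma affine_vec_neq0 i z : affine_vec i z != 0.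
Proof.
apply/eqP => /rowP /(_ i) /eqP.
by rewrite !mxE unlift_none oner_eq0.
Qed.

(* inverse of the i-th affine chart of P(V) *)
Definition affine_pt (i : 'I_4) (z : realC3) : projSpace :=
  ProjPoint (dim_line (affine_vec_neq0 i z)).

HB.instance Definition _ := isPointed.Build projSpace (affine_pt ord0 point).

(* Borel sigma-algebra of the manifold P(V): A is Borel iff it is Borel in
   each affine chart *)
Definition proj_measurable : set (set projSpace) :=
  [set A | forall i, measurable (affine_pt i @^-1` A)].

Let proj_measurable0 : proj_measurable set0.
Proof. by move=> i; rewrite preimage_set0; exact: measurable0. Qed.

Let proj_measurableC A : proj_measurable A -> proj_measurable (~` A).
Proof. by move=> mA i; rewrite preimage_setC; apply: measurableC; exact: mA. Qed.

Let proj_measurable_bigcup (F : (set projSpace)^nat) :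
  (forall n, proj_measurable (F n)) -> proj_measurable (\bigcup_n F n).
Proof.
move=> mF i; rewrite preimage_bigcup.
by apply: bigcupT_measurable => n; exact: mF.
Qed.

HB.instance Definition _ := @isMeasurable.Build default_measure_display
  projSpace proj_measurable proj_measurable0 proj_measurableC
  proj_measurable_bigcup.

Lemma measurable_affine_pt i : measurable_fun setT (affine_pt i).
Proof. by move=> _ A mA; rewrite setTI; exact: mA. Qed.

HB.instance Definition _ i := isMeasurableFun.Build _ _ _ _
  (affine_pt i) (@measurable_affine_pt i).

(* mu represents the smooth measure class: its null sets are the sets which
   are Lebesgue-null in every affine chart *)
Definition smooth_class (mu : probability projSpace R) : Prop :=
  forall A, measurable A ->
    mu A = 0%E <-> forall i, lebesgueC3 (affine_pt i @^-1` A) = 0%E.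

End ProjectiveSpace.

Section SymplecticGroup.
Variables (R : realType) (w : {biscalar vecC4 R}).

Definition alternating_form : Prop := forall u, w u u = 0.

Definition nondegenerate_form : Prop :=
  forall u, (forall v, w u v = 0) -> u = 0.

Record Sp : Type := MkSp {
  Sp_fun :> 'End(vecC4 R);
  Sp_inj : lker Sp_fun == 0%VS;
  Sp_form : forall u v, w (Sp_fun u) (Sp_fun v) = w u v }.

Lemma dim_Sp_img (g : Sp) (x : projSpace R) : \dim (g @: x)%VS == 1%N.
Proof.
rewrite limg_dim_eq ?(eqP (dim_proj_line x))//.
by rewrite (eqP (Sp_inj g)) capv0.
Qed.

Definition Sp_act (g : Sp) (x : projSpace R) : projSpace R :=
  ProjPoint (dim_Sp_img g x).

End SymplecticGroup.

Section ActionCohomology.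
Context d (X : measurableType d) (R : realType) (P : probability X R).
Variables (G : Type) (act : G -> X -> X).

Definition act_tuple n (g : G) (x : n.-tuple X) : n.-tuple X :=
  [tuple of map (act g) x].

Definition face n (i : 'I_n.+1) (x : n.+1.-tuple X) : n.-tuple X :=
  [tuple tnth x (lift i j) | j < n].

(* c lives on X^n, that is, in degree n - 1 *)
Definition codiff n (c : n.-tuple X -> R) (x : n.+1.-tuple X) : R :=
  \sum_(i < n.+1) (-1) ^+ i * c (face i x).

Definition invariant n (c : n.-tuple X -> R) : Prop :=
  forall g, c \o @act_tuple n g = c %[ae power_measure P n].

Variant coeff := L0 | Linf.

Definition coeff_space (b : coeff) n : {pred n.-tuple X -> R} :=
  if b is Linf then Lfun (power_measure P n) +oo else mfun.
Arguments coeff_space b n : clear implicits.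

Lemma coeff_space_zmod b n : zmod_closed (coeff_space b n).
Proof.
case: b; first by split=> [|f g fm gm]; [exact: rpred0|exact: rpredB].
have /= [S0 SZ] := @Lfun_submod_closed _ _ R (power_measure P n) +oo%E (leey _).
split=> [//|f g fL gL].
by rewrite addrC -scaleN1r; exact: SZ.
Qed.

Definition cochain b n (c : n.-tuple X -> R) : Prop :=
  c \in coeff_space b n /\ invariant c.

Lemma codiffB n (f g : n.-tuple X -> R) : codiff (f - g) = codiff f - codiff g.
Proof.
apply/funext => x; transitivity (codiff f x - codiff g x) => //.
by rewrite /codiff -sumrB; apply: eq_bigr => i _; rewrite -mulrBr.
Qed.

Lemma invariantB n (f g : n.-tuple X -> R) :
  invariant f -> invariant g -> invariant (f - g).
Proof.
move=> fi gi a; apply: filterS2 (fi a) (gi a) => x fx gx _.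
by rewrite -[RHS]/(f x - g x) -fx// -gx.
Qed.

(* ker d in degree q *)
Definition cocycle_pred b q : {pred q.+1.-tuple X -> R} :=
  [pred c | `[< cochain b c /\ codiff c = 0 %[ae power_measure P q.+2] >]].

Arguments cocycle_pred b q : clear implicits.

(* im d in degree q; there are no cochains in degree -1 *)
Definition coboundary b q : (q.+1.-tuple X -> R) -> Prop :=
  match q return (q.+1.-tuple X -> R) -> Prop with
  | 0 => fun c => c = 0 %[ae power_measure P 1]
  | p.+1 => fun c => exists2 a : p.+1.-tuple X -> R,
      cochain b a & c = codiff a %[ae power_measure P p.+2]
  end.

Lemma cochain0 b n : cochain b (0 : n.-tuple X -> R).
Proof. by split; [have [] := @coeff_space_zmod b n | move=> g; apply: aeW]. Qed.

Lemma cochainB b n (f g : n.-tuple X -> R) :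
  cochain b f -> cochain b g -> cochain b (f - g).
Proof.
move=> [bf nf] [bg ng]; split; last exact: invariantB.
by have [_] := @coeff_space_zmod b n; apply.
Qed.

Lemma codiff0 n : codiff (0 : n.-tuple X -> R) = 0.
Proof. by rewrite -(subrr 0) codiffB subrr. Qed.

Lemma cocycle_zmod b q : zmod_closed (cocycle_pred b q).
Proof.
split=> [|f g /asboolP[bf df] /asboolP[bg dg]]; apply/asboolP; split.
- exact: cochain0.
- by apply: aeW => x _; rewrite codiff0.
- exact: cochainB.
- apply: filterS2 df dg => x dfx dgx _.
  by rewrite codiffB [LHS]/= !fctE dfx// dgx// subrr.
Qed.

HB.instance Definition _ b q :=
  GRing.isZmodClosed.Build _ (cocycle_pred b q) (@cocycle_zmod b q).

Record cocycle b q : Type := Cocycle {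
  cocycle_fun :> q.+1.-tuple X -> R;
  cocycleP : cocycle_fun \in cocycle_pred b q }.

HB.instance Definition _ b q := [isSub for @cocycle_fun b q].
HB.instance Definition _ b q := [Choice of cocycle b q by <:].
HB.instance Definition _ b q := [SubChoice_isSubZmodule of cocycle b q by <:].

Definition coboundary_pred b q : {pred cocycle b q} :=
  [pred c : cocycle b q | `[< coboundary b c >]].

Arguments coboundary_pred b q : clear implicits.

Lemma coboundary_zmod b q : zmod_closed (coboundary_pred b q).
Proof.
case: q => [|p]; split.
- by apply/asboolP; apply: aeW.
- move=> f g /asboolP cf /asboolP cg; apply/asboolP.
  apply: filterS2 cf cg => x fx gx _.
  by rewrite [LHS](_ : _ = f x - g x)// fx// gx// subrr.
- apply/asboolP; exists 0; first exact: cochain0.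
  by rewrite codiff0; apply: aeW.
- move=> f g /asboolP[h ch fh] /asboolP[k ck gk]; apply/asboolP.
  exists (h - k); first exact: cochainB.
  apply: filterS2 fh gk => x fx gx _.
  by rewrite codiffB [LHS](_ : _ = f x - g x)// fx// gx.
Qed.

HB.instance Definition _ b q :=
  GRing.isZmodClosed.Build _ (coboundary_pred b q) (@coboundary_zmod b q).

(* ker d / im d: equality almost everywhere is absorbed by the quotient *)
Definition cohomology b q : Type := {ideal_quot coboundary_pred b q}.
HB.instance Definition _ b q := GRing.Zmodule.on (cohomology b q).
HB.instance Definition _ b q := Quotient.on (cohomology b q).

Lemma Linf_sub_L0 q : {subset cocycle_pred Linf q <= cocycle_pred L0 q}.
Proof.
move=> c /asboolP[[bc ic] dc]; apply/asboolP; split => //; split => //.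
exact: sub_Lfun_mfun bc.
Qed.

Definition cocycle_incl q (c : cocycle Linf q) : cocycle L0 q :=
  Cocycle (Linf_sub_L0 (cocycleP c)).

Lemma cocycle_inclB q : {morph @cocycle_incl q : f g / f - g}.
Proof. by move=> f g; apply: val_inj. Qed.

Lemma coboundary_incl q (c : cocycle Linf q) :
  c \in coboundary_pred Linf q -> cocycle_incl c \in coboundary_pred L0 q.
Proof.
case: q c => [|p] c /asboolP //= cb; apply/asboolP => //.
case: cb => a [ba ia] ca; exists a => //; split => //.
exact: sub_Lfun_mfun ba.
Qed.

Definition comparison q (h : cohomology Linf q) : cohomology L0 q :=
  \pi_(cohomology L0 q) (cocycle_incl (repr h)).

Lemma comparison_pi q (c : cocycle Linf q) :
  comparison (\pi_(cohomology Linf q) c) =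
  \pi_(cohomology L0 q) (cocycle_incl c).
Proof.
apply/eqP; rewrite -[_ == _]Quotient.idealrBE -cocycle_inclB.
by apply: coboundary_incl; rewrite Quotient.idealrBE reprK.
Qed.

Lemma comparisonB q : {morph @comparison q : x y / x - y}.
Proof.
have piB b (f g : cocycle b q) : \pi_(cohomology b q) (f - g) =
    \pi_(cohomology b q) f - \pi_(cohomology b q) g by exact: raddfB.
move=> x y; rewrite -[x]reprK -[y]reprK -piB !comparison_pi cocycle_inclB.
exact: piB.
Qed.

HB.instance Definition _ q := GRing.isZmodMorphism.Build
  (cohomology Linf q) (cohomology L0 q) (@comparison q) (@comparisonB q).

End ActionCohomology.
Arguments cohomology {d X R} P {G} act b q.
Arguments comparison {d X R} P {G} act q h.

Section SmoothClassExists.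
Variable R : realType.
Local Open Scope ereal_scope.

Let same_null d (T : measurableType d) (m n : {measure set T -> \bar R}) :=
  forall A, measurable A -> m A = 0 <-> n A = 0.

Let same_null_prod d1 d2 (T1 : measurableType d1) (T2 : measurableType d2)
    (m1 n1 : {measure set T1 -> \bar R})
    (m2 n2 : {sigma_finite_measure set T2 -> \bar R}) :
  same_null m1 n1 -> same_null m2 n2 -> same_null (m1 \x m2) (n1 \x n2).
Proof.
move=> h1 h2 A mA.
have prod0 (a : {measure set T1 -> \bar R})
    (b : {sigma_finite_measure set T2 -> \bar R}) :
    (a \x b) A = 0 <-> \forall x \ae a, b (xsection A x) = 0.
  have mf : measurable_fun setT (b \o xsection A).
    exact: measurable_fun_xsection.
  have e : (a \x b) A = \int[a]_x `|(b \o xsection A) x|.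
    by rewrite /product_measure1; apply: eq_integral => x _; rewrite gee0_abs.
  rewrite e; apply: (iff_trans (ae_eq_integral_abs a measurableT mf)).
  by split; apply: filterS => x /=; [exact|move=> + _].
rewrite !prod0; split; move=> [B [mB B0 sB]].
- exists B; split; [by []|exact/h1|move=> x nx; apply: sB => nx'; apply: nx].
  exact/h2/nx'/measurable_xsection.
- exists B; split; [by []|exact/h1|move=> x nx; apply: sB => nx'; apply: nx].
  exact/h2/nx'/measurable_xsection.
Qed.

Let normal_same_null :
  same_null (@normal_prob R 0 1) (@lebesgue_measure R).
Proof.
move=> A mA; split; last first.
  have /null_content_dominatesP D := @normal_prob_dominates R 0 1.
  exact: D.
rewrite /normal_prob => h.
have mf : measurable_fun A (fun x => (normal_pdf 0 1 x)%:E : \bar R).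
  apply/measurable_EFinP/measurable_funTS; exact: measurable_normal_pdf.
have [+ _] := ae_eq_integral_abs (@lebesgue_measure R) mA mf.
have -> : \int[lebesgue_measure]_(x in A) `|(normal_pdf 0 1 x)%:E| = 0 :> \bar R.
  rewrite -[RHS]h; apply: eq_integral => x _.
  by rewrite gee0_abs// lee_fin normal_pdf_ge0.
move=> /(_ erefl) [B [mB B0 sB]].
apply/eqP; rewrite -measure_le0 -B0 le_measure ?inE// => x Ax.
apply: sB => /(_ Ax) []; apply/eqP.
rewrite gt_eqF// /normal_pdf oner_eq0.
by rewrite mulr_gt0 ?expR_gt0 ?normal_peak_gt0 ?oner_eq0.
Qed.

Let probability_of d (T : measurableType d) (m : {measure set T -> \bar R}) :
  m setT = 1 -> exists p : probability T R, forall A, p A = m A.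
Proof.
have q0 : (0 <= 1 :> R)%R by [].
pose mu := mscale (NngNum q0) m.
have muE A : mu A = m A by rewrite /mu /mscale/= mul1e.
move=> mT.
pose P : probability T R := HB.pack mu (Measure.on mu)
  (Measure_isProbability.Build _ _ _ mu (etrans (muE _) mT)).
by exists P.
Qed.

Let mixture d d' (T : measurableType d) (T' : measurableType d')
    (g : probability T R) (f : 'I_4 -> {mfun T >-> T'}) :
  exists mu : probability T' R, forall A, measurable A ->
    mu A = 0 <-> forall i, g (f i @^-1` A) = 0.
Proof.
have q0 : (0 <= 4%:R^-1 :> R)%R by rewrite invr_ge0.
pose m k : {measure set T' -> \bar R} := distribution g (f (inord k)).
pose mu := mscale (NngNum q0) (msum m 4).
have muE A : mu A = (4%:R^-1)%:E * \sum_(k < 4) m k A by [].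
have muT : mu setT = 1.
  rewrite muE (eq_bigr (fun=> 1%:E)) => [|k _]; last exact: probability_setT.
  by rewrite sumEFin sumr_const card_ord -EFinM mulVf.
pose P : probability T' R := HB.pack mu (Measure.on mu)
  (Measure_isProbability.Build _ _ _ mu muT).
exists P => A mA; rewrite (muE A : P A = _).
have me (i : 'I_4) : m i A = g (f i @^-1` A) by rewrite /m inord_val.
split=> [/eqP|m0]; last by rewrite big1 ?mule0// => k _; rewrite me.
rewrite mule_eq0 eqe invr_eq0 pnatr_eq0/= seq_psume_eq0// => /allP h i.
by rewrite -me; apply/eqP/h; rewrite mem_index_enum.
Qed.

Let same_null_power d (T : measurableType d)
    (m1 m2 : {sigma_finite_measure set T -> \bar R}) n :
  same_null m1 m2 -> same_null (power_measure m1 n) (power_measure m2 n).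
Proof.
move=> h; elim: n => [|n ih] A mA //=.
apply: (same_null_prod h ih).
by rewrite -[X in measurable X]setTI; exact: measurable_tcons.
Qed.

Lemma smooth_class_exists : exists mu : probability (projSpace R) R,
  smooth_class mu.
Proof.
pose N : probability _ R := @normal_prob R 0 1.
have NT n : power_measure N n setT = 1.
  elim: n => [|n ih] /=; first by rewrite diracT.
  rewrite /cons_measure /pushforward preimage_setT -setXTT product_measure1E//.
  by rewrite ih mule1; exact: probability_setT.
have lN := @same_null_power _ _ N lebesgue_measure 6%N normal_same_null.
have [p pE] := probability_of (NT 6%N).
have [mu muP] := mixture p (@affine_pt R).
exists mu => A mA; rewrite muP//.
by split=> h i; [apply/(lN _ (mA i)) | rewrite pE; apply/(lN _ (mA i))]; rewrite -?pE; exact: h.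
Qed.
End SmoothClassExists.

(* Main.v *)
Require Import Defs.
From HB Require Import structures.
From mathcomp Require Import all_boot all_order all_algebra.
From mathcomp Require Import sesquilinear complex.
From mathcomp Require Import ring lra.
From mathcomp Require Import all_classical all_reals all_analysis.
From mathcomp Require Import measurable_realfun ess_sup_inf.

(** We show more: if [a] is a measurable invariant function on [X^4] and [da] is
    essentially bounded, then [a] is essentially bounded. Write [w_ij] for the
    symplectic pairing of representatives of the [i]-th and [j]-th point.

    - [Sp(4)] acts simply transitively on Darboux bases, so [a] is almost
      everywhere a function [F] of the ratio
      [w01 w23 : w02 w13 : w03 w12]; the pairings of five generic vectors are
      arbitrary, so [F] satisfies a five-term relation up to a bounded error for
      almost all values of the [w_ij].
    - Coning off with a generic new point replaces [F] by a function defined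
      for _all_ nonzero [w_ij], with a five-term relation up to a bounded error,
      and at bounded distance from [F]. In logarithmic coordinates, specializing
      the relation shows that it is [B(x,y) + B(y,z) + B(z,x)] up to a bounded
      error, where [B] is biadditive and alternating.
    - [B] is close to a measurable function, hence linear in the modulus and
      trivial in the argument of each variable; being alternating, it is zero.

    Almost everywhere statements are moved between spaces by the uniqueness of
    quasi-invariant measure classes, so no change of variables is needed. *)

Set Implicit Arguments.
Unset Strict Implicit.
Unset Printing Implicit Defensive.
Import Order.TTheory GRing.Theory Num.Theory.
Import numFieldNormedType.Exports.
Local Open Scope classical_set_scope.
Local Open Scope ring_scope.

(** * Approximately additive functions *)

(** A bounded cocycle that is [da] with [a] merely measurable is thus [da] with the same [a]
    bounded: no new primitive has to be built. The obstacle throughout is that invariance and the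
    five-term relation hold only almost everywhere, while the argument wants to specialize. A normal
    form of four points lies in a null set of configurations; this is met by moving it with a random
    symplectic matrix. The pairings w_ij = 1 form a null set too; this is met by the cone, whose
    value at fixed pairings is determined up to a bounded error by almost every new point. The price
    is that the resulting function is chosen pointwise and need not be measurable, so linearity of
    [B] has to be obtained from the measurable cone again.

    Five vectors of a 4-dimensional space impose no relation on their pairings because an
    alternating matrix of size five is degenerate anyway. Square roots of complex numbers are what
    allows pairings to be normalized by rescaling representatives. In the end [B] is a multiple of
    log|a| log|b|, which is symmetric, and an alternating form of this shape is zero. *)

Lemma eq0_halving (R : realType) (x D : R) :
  (forall n, `|x| <= D / 2 ^+ n) -> x = 0.
Proof.
move=> h; apply/eqP; rewrite -normr_eq0; apply/negPn/negP => x0.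
have xp : 0 < `|x| by rewrite lt_def x0 normr_ge0.
have D0 : 0 <= D by have := h 0; rewrite expr0 divr1; apply: le_trans.
have := h (Num.bound (D / `|x|)).
set n := Num.bound _.
have : D / `|x| < n%:R by rewrite /n; apply: archi_boundP; rewrite divr_ge0.
rewrite ltr_pdivrMr// => Dn.
rewrite ler_pdivlMr ?exprn_gt0// => h2.
have n2 : n%:R <= 2 ^+ n :> R.
  by rewrite -natrX ler_nat ltnW// ltn_expl.
have := ler_wpM2l (ltW xp) n2; lra.
Qed.

Lemma additive_natmul (R : realType) (A : zmodType) (h : A -> R) :
  {morph h : a b / a + b} -> forall a n, h (a *+ n) = n%:R * h a.
Proof.
move=> hD a n; have h0 : h 0 = 0 by have := hD 0 0; rewrite addr0; lra.
elim: n => [|n ih]; first by rewrite mulr0n mul0r.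
by rewrite mulrS hD ih -[n.+1%:R]natr1; ring.
Qed.

Lemma additive_bounded_eq0 (R : realType) (A : zmodType) (h : A -> R) (M : R) :
  {morph h : a b / a + b} -> (forall a, `|h a| <= M) -> forall a, h a = 0.
Proof.
move=> hD hM a; apply: (@eq0_halving _ _ M) => n.
have -> : h a = h (a *+ 2 ^ n) / 2 ^+ n.
  rewrite (additive_natmul hD) natrX.
  by rewrite mulrAC divff ?mul1r// expf_neq0// pnatr_eq0.
rewrite normrM [X in _ * X]ger0_norm ?invr_ge0 ?exprn_ge0//.
by rewrite ler_wpM2r// invr_ge0 exprn_ge0.
Qed.

(** Hyers' stability theorem: the additive map is the limit of g(2^n a)/2^n, with error D/2^n at
    stage n. Taking it as the supremum of the lower bounds [u a n - D / 2 ^+ n] yields this rate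
    without a separate convergence argument. The conclusion is a sigma type so that it applies to a
    family of functions without choice. *)
Lemma hyers (R : realType) (A : zmodType) (g : A -> R) (D : R) :
  (forall a b, `|g (a + b) - g a - g b| <= D) ->
  {h : A -> R | {morph h : a b / a + b} & forall a, `|h a - g a| <= D}.
Proof.
move=> gD.
have D0 : 0 <= D by apply: le_trans (gD 0 0).
pose u a n := g (a *+ 2 ^ n) / 2 ^+ n.
have p2 n : 0 < 2 ^+ n :> R by rewrite exprn_gt0.
have step a n : `|u a n.+1 - u a n| <= D / 2 ^+ n - D / 2 ^+ n.+1.
  have -> : u a n.+1 - u a n = (g (a *+ 2 ^ n + a *+ 2 ^ n) - g (a *+ 2 ^ n) -
      g (a *+ 2 ^ n)) / 2 ^+ n.+1.
    rewrite /u expnS mulnC mulrnA mulr2n exprS; field.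
    by rewrite gt_eqF.
  have -> : D / 2 ^+ n - D / 2 ^+ n.+1 = D / 2 ^+ n.+1.
    by rewrite exprS; field; rewrite gt_eqF.
  rewrite normrM [X in _ * X]ger0_norm ?invr_ge0 ?exprn_ge0//.
  by rewrite ler_wpM2r// invr_ge0 exprn_ge0.
have far a n k : `|u a (n + k)%N - u a n| <= D / 2 ^+ n - D / 2 ^+ (n + k).
  elim: k => [|k ih]; first by rewrite addn0 !subrr normr0.
  rewrite addnS; have := step a (n + k)%N; move: ih.
  by rewrite !ler_norml => /andP[? ?] /andP[? ?]; apply/andP; split; lra.
have low a n m : u a n - D / 2 ^+ n <= u a m + D / 2 ^+ m.
  have q k : 0 <= D / 2 ^+ k by rewrite divr_ge0// ltW.
  case: (leqP n m) => [nm|/ltnW nm].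
    have := far a n (m - n)%N; rewrite subnKC// ler_norml => /andP[? ?].
    by have := q m; lra.
  have := far a m (n - m)%N; rewrite subnKC// ler_norml => /andP[? ?].
  by have := q n; lra.
pose S a : set R := [set u a n - D / 2 ^+ n | n in setT]%classic.
have hsS a : has_sup (S a).
  split; first by exists (u a 0 - D / 2 ^+ 0); exists 0%N.
  by exists (u a 0 + D / 2 ^+ 0) => _ [n _ <-].
pose h a := sup (S a).
have hu a n : `|h a - u a n| <= D / 2 ^+ n.
  have h1 : u a n - D / 2 ^+ n <= h a.
    by apply: ub_le_sup; [exact: (hsS a).2|exists n].
  have h2 : h a <= u a n + D / 2 ^+ n.
    apply: ge_sup; first exact: (hsS a).1.
    by move=> _ [m _ <-].
  by rewrite ler_norml; apply/andP; split; lra.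
exists h; last by move=> a; have := hu a 0; rewrite /u !expr0 !divr1 mulr1n.
move=> a b; apply/eqP; rewrite -subr_eq0; apply/eqP.
apply: (@eq0_halving _ _ (4 * D)) => n.
have h3 : `|u (a + b) n - u a n - u b n| <= D / 2 ^+ n.
  have -> : u (a + b) n - u a n - u b n =
     (g (a *+ 2 ^ n + b *+ 2 ^ n) - g (a *+ 2 ^ n) - g (b *+ 2 ^ n)) / 2 ^+ n.
    by rewrite /u mulrnDl; ring.
  rewrite normrM [X in _ * X]ger0_norm ?invr_ge0 ?exprn_ge0//.
  by rewrite ler_wpM2r// invr_ge0 exprn_ge0.
have := hu (a + b) n; have := hu a n; have := hu b n; move: h3.
rewrite -!mulrA !ler_norml => /andP[? ?] /andP[? ?] /andP[? ?] /andP[? ?].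
by apply/andP; split; lra.
Qed.

(** Hyers' theorem is applied in the first variable only. The defects of additivity in the second
    variable and of antisymmetry are then exactly additive and bounded, so they vanish. *)
Lemma near_biadditive (R : realType) (A : zmodType) (G : A -> A -> R) (D : R) :
  (forall a b c, `|G (a + b) c - G a c - G b c| <= D) ->
  (forall a b, `|G a b + G b a| <= D) ->
  exists B : A -> A -> R, [/\ (forall c, {morph B^~ c : a b / a + b}),
    (forall a b, B a b = - B b a) & forall a b, `|B a b - G a b| <= D].
Proof.
move=> Gadd Ganti.
have h c := hyers (g := G^~ c) (fun a b => Gadd a b c).
pose B a c := s2val (h c) a.
have Badd c : {morph B^~ c : a b / a + b} by move=> a b; exact: (s2valP (h c)).
have BG a c : `|B a c - G a c| <= D by exact: (s2valP' (h c)).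
have Badd2 a b c : B a (b + c) = B a b + B a c.
  apply/eqP; rewrite -subr_eq0; apply/eqP.
  have := @additive_bounded_eq0 R A (fun x => B x (b + c) - (B x b + B x c))
    (7 * D); apply => [x y|x]; first by rewrite !Badd; ring.
  have := Gadd b c x; have := Ganti x (b + c); have := Ganti x b.
  have := Ganti x c; have := BG x (b + c); have := BG x b; have := BG x c.
  rewrite !ler_norml.
  by do 7! case/andP => ? ?; apply/andP; split; lra.
exists B; split => // a b.
apply/eqP; rewrite -subr_eq0; apply/eqP.
have := @additive_bounded_eq0 R A (fun x => B x b - - B b x) (3 * D).
apply => [x y|x]; first by rewrite Badd Badd2; ring.
have := Ganti x b; have := BG x b; have := BG b x.
by rewrite !ler_norml; do 3! case/andP => ? ?; apply/andP; split; lra.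
Qed.

(* With [G a b = F a b 0]: the 5-term relation at a star of edges gives
   [F a b c ~ G a b - G a c + G b c], and at two opposite edges together with a
   third one it gives the additivity of [G]. *)
Lemma near_cross_ratio_cocycle (R : realType) (A : zmodType) (F : A -> A -> A -> R)
    (D : R) :
  (forall u01 u02 u03 u12 u13 u23,
    `|F (u01 + u23) (u02 + u13) (u03 + u12) - F u01 u02 u12 + F u01 u03 u13
      - F u02 u03 u23 + F u12 u13 u23| <= D) ->
  (forall t a b c, `|F (a + t) (b + t) (c + t) - F a b c| <= D) ->
  exists (B : A -> A -> R) (K : R), [/\ (forall c, {morph B^~ c : a b / a + b}),
    (forall a b, B a b = - B b a),
    (forall a b, `|F a b 0 - B a b| <= K) &
    (forall a b c, `|F a b c - (B a b - B a c + B b c)| <= K)].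
Proof.
move=> FE FI.
have F0 : `|F 0 0 0| <= D.
  by have := FE 0 0 0 0 0 0; rewrite !addr0 ?add0r; congr (`| _ | <= _); ring.
have Fa a : `|F a 0 0| <= D.
  by have := FE a 0 0 0 0 0; rewrite !addr0 ?add0r; congr (`| _ | <= _); ring.
have Fc c : `|F 0 0 c| <= D.
  by have := FE 0 0 c 0 0 0; rewrite !addr0 ?add0r; congr (`| _ | <= _); ring.
(* With only the edge 13 nonzero the relation reads 2F(0,b,0) + F(0,0,b) - 2F(0,0,0). *)
have Fb b : `|F 0 b 0| <= 3 * D.
  have := FE 0 0 0 0 b 0; rewrite !addr0 ?add0r; have := Fc b; move: F0.
  by rewrite !ler_norml; do 3! case/andP => ? ?; apply/andP; split; lra.
pose G a b := F a b 0.
have star a b c : `|F a b c - (G a b - G a c + G b c)| <= 2 * D.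
  have := FE a b c 0 0 0; rewrite !addr0; move: F0; rewrite /G.
  by rewrite !ler_norml; do 2! case/andP => ? ?; apply/andP; split; lra.
have Gd a : `|G a a| <= 2 * D.
  have := FI (- a) a a 0; have := Fc (- a); rewrite /G subrr add0r.
  by rewrite !ler_norml; do 2! case/andP => ? ?; apply/andP; split; lra.
(* Translation by -a compares F(a,b,a) with F(0,b-a,0), and [star] expands the former as G(a,b) -
   G(a,a) + G(b,a). *)
have Ganti a b : `|G a b + G b a| <= 30 * D.
  have := FI (- a) a b a; rewrite subrr; have := Fb (b - a); have := star a b a.
  have := Gd a.
  by rewrite !ler_norml; do 4! case/andP => ? ?; apply/andP; split; lra.
have Gadd a b c : `|G (a + b) c - G a c - G b c| <= 30 * D.
  have := FE a c 0 0 0 b; rewrite !addr0.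
  have := Fa a; have := Fc b; have := star c 0 b; have := Fa c; have := Fb b.
  have := Ganti b c.
  (* The other errors add up to 9D, so the weaker bound 30D of [Ganti] would exceed the 30D to be
     proved here. *)
  have a1 : `|G c b + G b c| <= 10 * D.
    have := FI (- b) b c b; rewrite subrr; have := Fb (c - b).
    have := star b c b; have := Gd b.
    by rewrite !ler_norml; do 4! case/andP => ? ?; apply/andP; split; lra.
  move: a1; rewrite /G.
  by rewrite !ler_norml; do 8! case/andP => ? ?; apply/andP; split; lra.
have [B [Badd Banti BG]] := near_biadditive Gadd Ganti.
(* Three comparisons of [B] with [G] at 30D each, and one use of [star] at 2D. *)
exists B, (92 * D); split => // [a b|a b c].
  have := BG a b; rewrite /G.
  by rewrite !ler_norml; do 1! case/andP => ? ?; apply/andP; split; lra.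
have := BG a b; have := BG a c; have := BG b c; have := star a b c.
by rewrite !ler_norml; do 4! case/andP => ? ?; apply/andP; split; lra.
Qed.

(** * Almost everywhere quantifiers *)

Section AlmostEverywhere.
Context d1 d2 (T1 : measurableType d1) (T2 : measurableType d2) (R : realType).
Variables (m1 : {sigma_finite_measure set T1 -> \bar R})
  (m2 : {sigma_finite_measure set T2 -> \bar R}).

Lemma ae_measurableP (P : T1 -> Prop) : measurable [set x | P x] ->
  (\forall x \ae m1, P x) <-> m1 [set x | ~ P x] = 0%E.
Proof. by move=> mP; apply: negligibleP; exact: measurableC. Qed.

Lemma measurable_comp_set (P : T2 -> Prop) (f : T1 -> T2) :
  measurable_fun setT f -> measurable [set y | P y] ->
  measurable [set x | P (f x)].
Proof. by move=> mf mP; rewrite -[X in measurable X]setTI; exact: mf. Qed.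

Lemma measurable_ae (P : T1 * T2 -> Prop) : measurable [set p | P p] ->
  measurable [set x | \forall y \ae m2, P (x, y)].
Proof.
move=> mP.
have mN : measurable (~` [set p | P p]) by exact: measurableC.
have E x : ~` [set y | P (x, y)] = xsection (~` [set p | P p]) x.
  by rewrite xsectionE.
have -> : [set x | \forall y \ae m2, P (x, y)] =
    (m2 \o xsection (~` [set p | P p])) @^-1` [set 0%E].
  have mE x : measurable (~` [set y | P (x, y)]).
    by rewrite E; exact: measurable_xsection.
  apply/seteqP; split=> x /=; rewrite -E => h.
    exact/(negligibleP _ (mE x)).
  exact/(negligibleP _ (mE x)).
rewrite -[X in measurable X]setTI; apply: measurable_fun_xsection => //.
Qed.

Lemma ae_prodP (P : T1 * T2 -> Prop) : measurable [set p | P p] ->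
  (\forall p \ae (m1 \x m2)%E, P p) <->
  (\forall x \ae m1, \forall y \ae m2, P (x, y)).
Proof.
move=> mP.
have mN : measurable (~` [set p | P p]) by exact: measurableC.
pose A := ~` [set p | P p].
have mf : measurable_fun setT (m2 \o xsection A) by exact: measurable_fun_xsection.
have e : ((m1 \x m2) A = \int[m1]_x `|(m2 \o xsection A) x|)%E.
  by rewrite /product_measure1; apply: eq_integral => x _; rewrite gee0_abs.
have -> : (\forall p \ae (m1 \x m2)%E, P p) <-> (m1 \x m2)%E A = 0%E.
  exact: negligibleP.
rewrite e; apply: (iff_trans (ae_eq_integral_abs m1 measurableT mf)).
have xs x : m2 (xsection A x) = 0%E <-> \forall y \ae m2, P (x, y).
  rewrite /prop_near1 /almost_everywhere/=.
  rewrite (_ : (fun y => P (x, y)) = ~` xsection A x); last first.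
    by rewrite xsectionE /A -preimage_setC setCK.
  rewrite [X in _ <-> X](_ : _ = m2.-negligible (xsection A x)); last first.
    by rewrite /prop_near1 /nbhs/= /almost_everywhere/= setCK.
  by apply: iff_sym; apply: negligibleP; exact: measurable_xsection.
split; apply: filterS => x /=; first by move=> h; apply/xs/h.
by move=> h _; exact/xs.
Qed.

End AlmostEverywhere.

Section AlmostEverywhereSwap.
Context d1 d2 (T1 : measurableType d1) (T2 : measurableType d2) (R : realType).
Variables (m1 : {sigma_finite_measure set T1 -> \bar R})
  (m2 : {sigma_finite_measure set T2 -> \bar R}).

(** Both iterated statements say that the complement is null for the product measure, whose two
    constructions agree by uniqueness. *)
Lemma ae_swap (P : T1 -> T2 -> Prop) : measurable [set p | P p.1 p.2] ->
  (\forall x \ae m1, \forall y \ae m2, P x y) ->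
  (\forall y \ae m2, \forall x \ae m1, P x y).
Proof.
move=> mP /(ae_prodP m1 m2 mP) h.
have mN : measurable (~` [set p | P p.1 p.2]) by exact: measurableC.
have mQ : measurable [set p : T2 * T1 | P p.2 p.1].
  have := @measurable_comp_set _ _ _ _ (fun p => P p.1 p.2)
    (fun p : T2 * T1 => (p.2, p.1)).
  by apply => //; exact/measurable_fun_pair.
apply/(ae_prodP m2 m1 mQ); apply/negligibleP; first exact: measurableC.
have {}h : (m1 \x m2)%E (~` [set p | P p.1 p.2]) = 0%E by apply/negligibleP.
rewrite -h [RHS](_ : _ = (m1 \x^ m2)%E (~` [set p | P p.1 p.2])).
  by rewrite /product_measure1 /product_measure2; apply: eq_integral => y _ /=;
    rewrite xsectionE ysectionE.
by apply: product_measure_unique => //= ? ? ? ?; rewrite product_measure2E.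
Qed.

Lemma ae_ex (P : T1 -> Prop) : (0 < m1 setT)%E ->
  (\forall x \ae m1, P x) -> exists x, P x.
Proof.
move=> m0 h; have F := ae_properfilter_algebraOfSetsType m0.
exact: filter_ex h.
Qed.

End AlmostEverywhereSwap.

(* Uniqueness of quasi-invariant measure classes: both sides amount to
   "[P (op (x, y))] for almost every [(x, y)]", read in two orders. *)
Lemma ae_transfer d1 d2 (T1 : measurableType d1) (T2 : measurableType d2)
    (R : realType) (m1 : {sigma_finite_measure set T1 -> \bar R})
    (m2 : {sigma_finite_measure set T2 -> \bar R})
    (op : T1 -> T2 -> T2) (pi : T1 -> T2) (P : T2 -> Prop) :
  (0 < m1 setT)%E -> (0 < m2 setT)%E ->
  measurable [set y | P y] ->
  measurable_fun setT (fun p : T1 * T2 => op p.1 p.2) ->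
  (forall x, (\forall y \ae m2, P (op x y)) <-> (\forall y \ae m2, P y)) ->
  (forall y, (\forall x \ae m1, P (op x y)) <-> (\forall x \ae m1, P (pi x))) ->
  (\forall y \ae m2, P y) <-> (\forall x \ae m1, P (pi x)).
Proof.
move=> m10 m20 mP mop h2 h1.
have mQ : measurable [set p | P (op p.1 p.2)] by exact: measurable_comp_set mop mP.
have mQ' : measurable [set p : T2 * T1 | P (op p.2 p.1)].
  apply: (measurable_comp_set (f := fun p : T2 * T1 => (p.2, p.1)) _ mQ).
  exact/measurable_fun_pair.
split=> [h|h].
- have : \forall x \ae m1, \forall y \ae m2, P (op x y) by apply: aeW => x; exact/h2.
  by move/(ae_swap mQ)/(ae_ex m20) => [y /h1].
- have : \forall y \ae m2, \forall x \ae m1, P (op x y) by apply: aeW => y; exact/h1.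
  by move/(@ae_swap _ _ _ _ _ _ _ (fun y x => P (op x y)) mQ')/(ae_ex m10) => [x /h2].
Qed.

(** * Almost everywhere statements on finite powers *)

Section PowerAE.
Context d (T : measurableType d) (R : realType).
Variable m : {sigma_finite_measure set T -> \bar R}.

Lemma ae_consP n (P : n.+1.-tuple T -> Prop) : measurable [set t | P t] ->
  (\forall t \ae power_measure m n.+1, P t) <->
  (\forall x \ae m, \forall t \ae power_measure m n, P (tcons (x, t))).
Proof.
move=> mP.
have mQ : measurable [set p | P (@tcons _ T n p)].
  exact: measurable_comp_set (@measurable_tcons _ T n) mP.
rewrite -(ae_prodP m (power_measure m n) mQ).
apply: (iff_trans (ae_measurableP _ mP)).
by apply: iff_sym; apply: negligibleP; exact: measurableC.
Qed.

(** One direction of Fubini survives for an arbitrary [P], since a negligible set lies in a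
    measurable null set. *)
Lemma ae_consW n (P : n.+1.-tuple T -> Prop) :
  (\forall t \ae power_measure m n.+1, P t) ->
  (\forall x \ae m, \forall t \ae power_measure m n, P (tcons (x, t))).
Proof.
move=> [N [mN N0 PN]].
have : \forall t \ae power_measure m n.+1, ~ N t.
  by exists N; split => // t /=; exact: contrapT.
have mNC : measurable [set t | ~ N t] by exact: measurableC.
move/(ae_consP mNC); apply: filterS => x; apply: filterS => t Nt.
by apply: contrapT => /PN.
Qed.

Lemma ae_power0P (P : 0.-tuple T -> Prop) : P [tuple] ->
  (\forall t \ae power_measure m 0, P t).
Proof. by move=> h; apply: aeW => t; rewrite tuple0. Qed.

Lemma ae_power0E (P : 0.-tuple T -> Prop) : 
  (\forall t \ae power_measure m 0, P t) -> P [tuple].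
Proof.
move=> [N [mN /= + PN]]; rewrite /dirac /= indicE => N0.
apply: contrapT => nP; move: N0; rewrite mem_set; last exact: PN.
by move/eqP; rewrite eqe oner_eq0.
Qed.

Lemma power_measure_gt0 n : (0 < m setT)%E -> (0 < power_measure m n setT)%E.
Proof.
move=> m0; elim: n => [|n ih] /=; first by rewrite diracT.
rewrite /cons_measure /pushforward preimage_setT -setXTT product_measure1E//.
by rewrite mule_gt0.
Qed.

End PowerAE.

Definition tmap n (T1 T2 : Type) (phi : T1 -> T2) (t : n.-tuple T1) : n.-tuple T2 :=
  [tuple of map phi t].

Section PowerMap.
Context d1 d2 (T1 : measurableType d1) (T2 : measurableType d2) (R : realType).
Variables (m1 : {sigma_finite_measure set T1 -> \bar R})
  (m2 : {sigma_finite_measure set T2 -> \bar R}).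

Lemma map_tcons n (phi : T1 -> T2) (p : T1 * n.-tuple T1) :
  tmap phi (tcons p) = tcons (phi p.1, tmap phi p.2).
Proof. by apply: val_inj. Qed.

Lemma measurable_map_tuple n (phi : T1 -> T2) : measurable_fun setT phi ->
  measurable_fun setT (@tmap n T1 T2 phi).
Proof.
move=> mphi; apply/measurable_fun_tnthP => i.
rewrite (_ : _ \o _ = phi \o (@tnth _ _ ^~ i)).
  by apply: measurableT_comp => //; exact: measurable_tnth.
by apply/funext => t /=; rewrite tnth_map.
Qed.

Lemma ae_power_map (phi : T1 -> T2) : measurable_fun setT phi ->
  (forall Q, measurable [set y | Q y] ->
     (\forall y \ae m2, Q y) <-> (\forall x \ae m1, Q (phi x))) ->
  forall n (P : n.-tuple T2 -> Prop), measurable [set y | P y] ->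
  (\forall y \ae power_measure m2 n, P y) <->
  (\forall x \ae power_measure m1 n, P (tmap phi x)).
Proof.
move=> mphi h; elim=> [|n ih] P mP.
  have e (t : 0.-tuple T1) : (tmap phi t) = [tuple] :> 0.-tuple T2.
    exact: tuple0.
  split=> [/ae_power0E h0|/ae_power0E]; last by rewrite e => ?; exact: ae_power0P.
  by apply: ae_power0P; rewrite e.
have mP' : measurable [set t : n.+1.-tuple T1 | P (tmap phi t)].
  exact: measurable_comp_set (measurable_map_tuple mphi) mP.
have mQ : measurable [set p | P (@tcons _ T2 n p)].
  exact: measurable_comp_set (@measurable_tcons _ T2 n) mP.
rewrite (ae_consP m2 mP) (ae_consP m1 mP').
rewrite (h (fun y => \forall t \ae power_measure m2 n, P (tcons (y, t)))); last first.
  exact: (measurable_ae (power_measure m2 n) (P := fun p => P (tcons p)) mQ).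
have mPx x : measurable [set t | P (@tcons _ T2 n (phi x, t))].
  apply: (measurable_comp_set (f := fun t => (phi x, t)) _ mQ).
  exact/measurable_fun_pair.
split; apply: filterS => x H.
  by apply: filterS ((ih _ (mPx x)).1 H) => t; rewrite map_tcons.
by apply/(ih _ (mPx x)).2; apply: filterS H => t; rewrite map_tcons.
Qed.

End PowerMap.

(** * Lebesgue measure on the complex numbers *)

Definition leb (R : realType) :
  {sigma_finite_measure set (measurableTypeR R) -> \bar R} := @lebesgue_measure R.

Section LebesgueTranslation.
Variable R : realType.
Local Notation leb := (leb R).

Definition rtranslate (t : R) (x : measurableTypeR R) : measurableTypeR R := x + t.

Lemma measurable_rtranslate t : measurable_fun setT (rtranslate t).
Proof. exact: measurable_funD. Qed.

HB.instance Definition _ t :=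
  isMeasurableFun.Build _ _ _ _ (rtranslate t) (@measurable_rtranslate t).

Lemma lebesgue_measure_translate t (A : set (measurableTypeR R)) : measurable A ->
  leb (rtranslate t @^-1` A) = leb A.
Proof.
move=> mA; apply/esym.
apply: (lebesgue_measure_unique (mu := pushforward leb (rtranslate t))) mA.
move=> _ [[a b]] _ <-; rewrite /pushforward.
rewrite [X in _ = leb X](_ : _ = `]a - t, b - t]%classic); last first.
  by apply/seteqP; split=> x; rewrite /rtranslate /= !in_itv/= ltrBlDr lerBrDr.
apply: (etrans (lebesgue_measure_itv `]a, b])).
apply: (etrans _ (esym (lebesgue_measure_itv `]a - t, b - t]))) => /=.
by rewrite !lte_fin ltrD2r -!EFinB; congr (if _ then _%:E else _); ring.
Qed.

Lemma lebesgue_measureT_gt0 : (0 < leb setT)%E.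
Proof.
have h : (lebesgue_measure (`]0%R, 1%R] : set R) <= leb setT)%E.
  by apply: le_measure; rewrite ?inE//; exact: measurable_itv.
apply: lt_le_trans h; rewrite lebesgue_measure_itv/= lte_fin ltr01 -EFinB.
by rewrite lte_fin subr0.
Qed.

Lemma ae_rtranslate t (P : measurableTypeR R -> Prop) : measurable [set x | P x] ->
  (\forall x \ae leb, P (x + t)) <-> (\forall x \ae leb, P x).
Proof.
move=> mP.
have mP' : measurable [set x | P (rtranslate t x)].
  exact: measurable_comp_set (@measurable_rtranslate t) mP.
have mN : measurable [set x | ~ P x] by exact: measurableC.
have e : leb [set x | ~ P (x + t)] = leb [set x | ~ P x].
  exact: lebesgue_measure_translate mN.
have h1 := ae_measurableP leb mP; have h2 := ae_measurableP leb mP'.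
split=> h; first exact: h1.2 (etrans (esym e) (h2.1 h)).
exact: h2.2 (etrans e (h1.1 h)).
Qed.

End LebesgueTranslation.

Section ComplexMeasure.
Variable R : realType.
Local Notation Rm := (measurableTypeR R).
Local Notation leb := (leb R).

Definition mkC (p : Rm * Rm) : R[i] := Complex p.1 p.2.
Definition unC (z : R[i]) : Rm * Rm := (complex.Re z, complex.Im z).

Lemma mkCK : cancel mkC unC. Proof. by case. Qed.

HB.instance Definition _ := isPointed.Build R[i] 0.

Definition complex_measurable : set (set R[i]) := [set A | measurable (mkC @^-1` A)].

Let complex_measurable0 : complex_measurable set0.
Proof. by rewrite /complex_measurable/= preimage_set0; exact: measurable0. Qed.

Let complex_measurableC A : complex_measurable A -> complex_measurable (~` A).
Proof. by rewrite /complex_measurable/= preimage_setC; exact: measurableC. Qed.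

Let complex_measurable_bigcup (F : (set R[i])^nat) :
  (forall n, complex_measurable (F n)) -> complex_measurable (\bigcup_n F n).
Proof.
by move=> mF; rewrite /complex_measurable/= preimage_bigcup; exact: bigcupT_measurable.
Qed.

HB.instance Definition _ := @isMeasurable.Build default_measure_display
  R[i] complex_measurable complex_measurable0 complex_measurableC
  complex_measurable_bigcup.

Lemma measurable_mkC : measurable_fun setT mkC.
Proof. by move=> _ A mA; rewrite setTI; exact: mA. Qed.

HB.instance Definition _ := isMeasurableFun.Build _ _ _ _ mkC measurable_mkC.

Lemma measurable_unC : measurable_fun setT unC.
Proof.
move=> _ A mA; rewrite setTI /measurable/= /complex_measurable/= -comp_preimage.
by rewrite (_ : _ \o _ = id)//; apply/funext/mkCK.
Qed.

Section toC.
Context d (T : measurableType d).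
Implicit Types f g : T -> R[i].

Lemma measurable_Re f : measurable_fun setT f ->
  measurable_fun setT (fun x => complex.Re (f x) : Rm).
Proof.
move=> mf; apply: (measurableT_comp (f := fst) (g := unC \o f)) => //.
exact: measurableT_comp measurable_unC mf.
Qed.

Lemma measurable_Im f : measurable_fun setT f ->
  measurable_fun setT (fun x => complex.Im (f x) : Rm).
Proof.
move=> mf; apply: (measurableT_comp (f := snd) (g := unC \o f)) => //.
exact: measurableT_comp measurable_unC mf.
Qed.

Lemma measurable_complex (f g : T -> Rm) : measurable_fun setT f ->
  measurable_fun setT g -> measurable_fun setT (fun x => Complex (f x) (g x)).
Proof.
move=> mf mg; apply: (measurableT_comp measurable_mkC (g := fun x => (f x, g x))).
exact/measurable_fun_pair.
Qed.

Lemma measurable_complexP f : measurable_fun setT (fun x => complex.Re (f x) : Rm) ->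
  measurable_fun setT (fun x => complex.Im (f x) : Rm) -> measurable_fun setT f.
Proof.
move=> mr mi; rewrite [f](_ : _ = fun x => Complex (complex.Re (f x)) (complex.Im (f x))).
  exact: measurable_complex.
by apply/funext => x; case: (f x).
Qed.

Lemma measurable_complexD f g : measurable_fun setT f -> measurable_fun setT g ->
  measurable_fun setT (fun x => f x + g x).
Proof.
move=> mf mg; apply: measurable_complexP.
  rewrite (_ : (fun _ => _) = fun x => complex.Re (f x) + complex.Re (g x) : Rm).
    by apply: measurable_funD; exact: measurable_Re.
  by apply/funext => x; case: (f x); case: (g x).
rewrite (_ : (fun _ => _) = fun x => complex.Im (f x) + complex.Im (g x) : Rm).
  by apply: measurable_funD; exact: measurable_Im.
by apply/funext => x; case: (f x); case: (g x).
Qed.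

Lemma measurable_complexM f g : measurable_fun setT f -> measurable_fun setT g ->
  measurable_fun setT (fun x => f x * g x).
Proof.
move=> mf mg; have mfr := measurable_Re mf; have mgr := measurable_Re mg.
have mfi := measurable_Im mf; have mgi := measurable_Im mg.
apply: measurable_complexP.
  rewrite (_ : (fun _ => _) = fun x => complex.Re (f x) * complex.Re (g x)
      - complex.Im (f x) * complex.Im (g x) : Rm).
    by apply: measurable_funB; exact: measurable_funM.
  by apply/funext => x; case: (f x); case: (g x).
rewrite (_ : (fun _ => _) = fun x => complex.Re (f x) * complex.Im (g x)
      + complex.Im (f x) * complex.Re (g x) : Rm).
  by apply: measurable_funD; exact: measurable_funM.
by apply/funext => x; case: (f x); case: (g x).
Qed.

Lemma measurable_complexN f : measurable_fun setT f ->
  measurable_fun setT (fun x => - f x).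
Proof.
move=> mf; rewrite (_ : (fun _ => _) = fun x => -1 * f x).
  by apply: measurable_complexM => //; exact: measurable_cst.
by apply/funext => x; rewrite mulN1r.
Qed.

Lemma measurable_complexB f g : measurable_fun setT f -> measurable_fun setT g ->
  measurable_fun setT (fun x => f x - g x).
Proof. by move=> mf mg; apply: measurable_complexD => //; exact: measurable_complexN. Qed.

Lemma measurable_complex_sum (I : Type) (r : seq I) (Q : pred I) (F : I -> T -> R[i]) :
  (forall i, measurable_fun setT (F i)) ->
  measurable_fun setT (fun x => \sum_(i <- r | Q i) F i x).
Proof.
move=> mF; elim: r => [|i r ih].
  rewrite (_ : (fun _ => _) = cst 0); first exact: measurable_cst.
  by apply/funext => x; rewrite big_nil.
case: (boolP (Q i)) => Qi.
  rewrite (_ : (fun _ => _) = fun x => F i x + \sum_(i <- r | Q i) F i x).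
    exact: measurable_complexD.
  by apply/funext => x; rewrite big_cons Qi.
rewrite (_ : (fun _ => _) = fun x => \sum_(i <- r | Q i) F i x) => //.
by apply/funext => x; rewrite big_cons (negbTE Qi).
Qed.

Lemma measurable_rinv (f : T -> Rm) : measurable_fun setT f ->
  measurable_fun setT (fun x => (f x)^-1 : Rm).
Proof.
move=> mf; apply: (measurableT_comp (f := GRing.inv : Rm -> Rm)) => //.
have oU : open [set~ (0 : R)] by rewrite openC; exact: closed_eq.
have mU : measurable ([set~ 0] : set Rm) by exact: measurableC.
rewrite -(setUv [set (0 : R)]).
apply/measurable_funU => //; split; first exact: measurable_fun_set1.
apply: open_continuous_measurable_fun => // x.
by rewrite inE/= => /eqP x0; exact: inv_continuous.
Qed.

Lemma measurable_complexV f : measurable_fun setT f ->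
  measurable_fun setT (fun x => (f x)^-1).
Proof.
move=> mf; have mr := measurable_Re mf; have mi := measurable_Im mf.
pose n x : Rm := (complex.Re (f x) ^+ 2 + complex.Im (f x) ^+ 2)^-1.
have mn : measurable_fun setT n.
  apply: measurable_rinv; apply: measurable_funD; exact: measurable_funX.
apply: measurable_complexP.
  rewrite (_ : (fun _ => _) = fun x => complex.Re (f x) * n x : Rm).
    exact: measurable_funM.
  by apply/funext => x; rewrite /n; case: (f x).
rewrite (_ : (fun _ => _) = fun x => - complex.Im (f x) * n x : Rm).
  by apply: measurable_funM => //; exact: measurableT_comp.
by apply/funext => x; rewrite /n; case: (f x) => a b /=; rewrite mulNr.
Qed.

Lemma measurable_complex_neq0 f : measurable_fun setT f ->
  measurable [set x | f x != 0].
Proof.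
move=> mf; apply: (measurable_comp_set (P := fun z : R[i] => (z != 0) : Prop) mf).
have -> : [set z : R[i] | z != 0] = ~` (unC @^-1` [set (0, 0)]).
  apply/seteqP; split=> -[a b] /=.
    by move=> /eqP + [a0 b0]; apply; rewrite a0 b0.
  by move=> h; apply/eqP => -[a0 b0]; apply: h; rewrite /unC/= a0 b0.
apply: measurableC; rewrite -[X in measurable X]setTI.
apply: measurable_unC => //.
rewrite (_ : [set _] = [set (0 : R)] `*` [set (0 : R)]); first exact: measurableX.
by apply/seteqP; split=> -[a b] /= [-> ->].
Qed.

End toC.


Definition lebesgueC : set R[i] -> \bar R := pushforward (leb \x leb)%E mkC.

Let lebesgueC0 : lebesgueC set0 = 0%E.
Proof. by rewrite /lebesgueC /pushforward preimage_set0 measure0. Qed.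

Let lebesgueC_ge0 A : (0 <= lebesgueC A)%E.
Proof. exact: measure_ge0. Qed.

Let lebesgueC_sigma_additive : semi_sigma_additive lebesgueC.
Proof.
move=> F mF tF mUF; rewrite /lebesgueC /pushforward preimage_bigcup.
apply: measure_semi_sigma_additive.
- exact: mF.
- apply/trivIsetP => i j _ _ ij; rewrite -preimage_setI.
  by move/trivIsetP : tF => /(_ _ _ _ _ ij) ->//; rewrite preimage_set0.
- by rewrite -preimage_bigcup; exact: mUF.
Qed.

HB.instance Definition _ := isMeasure.Build _ _ _ lebesgueC
  lebesgueC0 lebesgueC_ge0 lebesgueC_sigma_additive.

Let lebesgueC_sigma_finite : sigma_finite setT lebesgueC.
Proof.
have /sigma_finiteP[F [FT ndF Foo]] := sigma_finiteT leb.
exists (fun k => unC @^-1` (F k `*` F k)).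
  rewrite -preimage_bigcup -[LHS](preimage_setT unC); congr (_ @^-1` _).
  rewrite -setXTT FT predeqE => -[x y]; split.
    move=> [/= [i _ Fix] [j _ Fjy]]; exists (maxn i j) => //; split.
    - by move: x Fix; exact/subsetPset/ndF/leq_maxl.
    - by move: y Fjy; exact/subsetPset/ndF/leq_maxr.
  by move=> [i _ []/= ? ?]; split; exists i.
move=> k; have [mF Fk] := Foo k; split.
  by rewrite -[_ @^-1` _]setTI; apply: measurable_unC => //; exact: measurableX.
rewrite /lebesgueC /pushforward (_ : _ @^-1` _ = F k `*` F k).
  by rewrite product_measure1E// lte_mul_pinfty// ge0_fin_numE.
by rewrite -comp_preimage (_ : _ \o _ = id)//; apply/funext/mkCK.
Qed.

HB.instance Definition _ := Measure_isSigmaFinite.Build _ _ _ lebesgueC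
  lebesgueC_sigma_finite.

Lemma lebesgueC_gt0 : (0 < lebesgueC setT)%E.
Proof.
rewrite /lebesgueC /pushforward preimage_setT -setXTT product_measure1E//.
by rewrite mule_gt0// lebesgue_measureT_gt0.
Qed.

Lemma ae_complexP (P : R[i] -> Prop) : measurable [set z | P z] ->
  (\forall z \ae lebesgueC, P z) <->
  (\forall x \ae leb, \forall y \ae leb, P (Complex x y)).
Proof.
move=> mP.
have mQ : measurable [set p | P (mkC p)].
  exact: measurable_comp_set measurable_mkC mP.
rewrite -(ae_prodP leb leb mQ).
apply: (iff_trans (ae_measurableP _ mP)).
by apply: iff_sym; apply: negligibleP; exact: measurableC.
Qed.

Lemma ae_complexD t (P : R[i] -> Prop) : measurable [set x | P x] ->
  (\forall x \ae lebesgueC, P (x + t)) <-> (\forall x \ae lebesgueC, P x).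
Proof.
case: t => t1 t2 mP.
have mP' : measurable [set x | P (x + Complex t1 t2)].
  apply: measurable_comp_set mP; apply: measurable_complexD => //.
rewrite (ae_complexP mP) (ae_complexP mP').
have mQ : measurable [set p | P (mkC p)].
  exact: measurable_comp_set measurable_mkC mP.
have mQx x : measurable [set y | P (Complex x y)].
  apply: (measurable_comp_set (f := fun y : Rm => (x, y)) _ mQ).
  exact/measurable_fun_pair.
rewrite -(ae_rtranslate t1 (P := fun x => \forall y \ae leb, P (Complex x y))); last first.
  exact: (measurable_ae leb (P := fun p => P (mkC p)) mQ).
split; apply: (@filterS _ _ (ae_filter_ringOfSetsType leb)) => x h.
  exact: (ae_rtranslate t2 (mQx (x + t1))).1 h.
exact: (ae_rtranslate t2 (mQx (x + t1))).2 h.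
Qed.

End ComplexMeasure.

Definition lamC (R : realType) : {sigma_finite_measure set R[i] -> \bar R} :=
  @lebesgueC R.

(** * Translations and additive surjections of complex coordinate spaces *)

Section ComplexTuple.
Variable R : realType.
Local Notation C := R[i].
Local Notation lamC := (lamC R).

Definition addt n (x y : n.-tuple C) : n.-tuple C :=
  [tuple tnth x i + tnth y i | i < n].

Lemma tnth_addt n (x y : n.-tuple C) i : tnth (addt x y) i = tnth x i + tnth y i.
Proof. exact: tnth_mktuple. Qed.

Lemma addtC n : commutative (@addt n).
Proof. by move=> x y; apply: eq_from_tnth => i; rewrite !tnth_addt addrC. Qed.

Lemma addt_tcons n x y (s t : n.-tuple C) :
  addt (tcons (x, s)) (tcons (y, t)) = tcons (x + y, addt s t).
Proof.
apply: eq_from_tnth => i; rewrite !tnth_addt.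
by case: (unliftP ord0 i) => [j ->|->]; rewrite ?tnthS ?tnth_addt// !tnth0.
Qed.

Lemma measurable_addt d (T : measurableType d) n (f g : T -> n.-tuple C) :
  measurable_fun setT f -> measurable_fun setT g ->
  measurable_fun setT (fun x => addt (f x) (g x)).
Proof.
move=> /measurable_fun_tnthP mf /measurable_fun_tnthP mg.
apply/measurable_fun_tnthP => i; rewrite (_ : _ \o _ =
  fun x => tnth (f x) i + tnth (g x) i); last first.
  by apply/funext => x /=; rewrite tnth_addt.
exact: measurable_complexD (mf i) (mg i).
Qed.

Lemma ae_addt n (t : n.-tuple C) (P : n.-tuple C -> Prop) : measurable [set x | P x] ->
  (\forall x \ae power_measure lamC n, P (addt x t)) <->
  (\forall x \ae power_measure lamC n, P x).
Proof.
elim: n t P => [|n ih] t P mP.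
  split=> /ae_power0E h; apply: ae_power0P; move: h; first by rewrite [addt _ _]tuple0.
  by rewrite [addt _ _]tuple0.
have [t0 [t' ->]] : exists t0 t', t = tcons (t0, t').
  by exists (thead t), [tuple of behead t]; rewrite [LHS]tuple_eta.
have mP' : measurable [set x | P (addt x (tcons (t0, t')))].
  by apply: measurable_comp_set mP; apply: measurable_addt.
rewrite (ae_consP lamC mP) (ae_consP lamC mP').
have mQ : measurable [set p | P (@tcons _ _ n p)].
  exact: measurable_comp_set (@measurable_tcons _ _ n) mP.
have mQx x : measurable [set s | P (@tcons _ _ n (x, s))].
  apply: (measurable_comp_set (f := fun s => (x, s)) _ mQ).
  exact/measurable_fun_pair.
rewrite -(ae_complexD t0
  (P := fun x => \forall s \ae power_measure lamC n, P (tcons (x, s)))); last first.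
  exact: (measurable_ae (power_measure lamC n) (P := fun p => P (tcons p)) mQ).
split; apply: filterS => x h.
  apply: (ih t' _ (mQx (x + t0))).1.
  by apply: filterS h => s; rewrite addt_tcons.
by apply: filterS ((ih t' _ (mQx (x + t0))).2 h) => s; rewrite addt_tcons.
Qed.

(** [ae_transfer] with the operation phi(x) + y: for fixed x it is a translation of the target, and
    for fixed y = phi(x') it equals phi(x + x'), a translation of the source. This replaces every
    linear change of variables below. *)
Lemma ae_additive_surj n k (phi : n.-tuple C -> k.-tuple C) (P : k.-tuple C -> Prop) :
  measurable_fun setT phi -> {morph phi : x y / addt x y} ->
  (forall y, exists x, phi x = y) -> measurable [set y | P y] ->
  (\forall y \ae power_measure lamC k, P y) <->
  (\forall x \ae power_measure lamC n, P (phi x)).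
Proof.
move=> mphi phiD phis mP.
apply: (@ae_transfer _ _ _ _ _ _ _ (fun x y => addt (phi x) y)) => //.
- exact/power_measure_gt0/lebesgueC_gt0.
- exact/power_measure_gt0/lebesgueC_gt0.
- by apply: measurable_addt => //; apply: measurableT_comp.
- move=> x; rewrite -(ae_addt (phi x) mP).
  by split; apply: filterS => y; rewrite addtC.
- move=> y; have [x <-] := phis y.
  have mP' : measurable [set y | P (phi y)] by exact: measurable_comp_set mP.
  rewrite -(ae_addt x mP').
  by split; apply: filterS => z; rewrite phiD.
Qed.

End ComplexTuple.

(** * The measure class of projective space *)

Section RealCoordinates.
Variable R : realType.
Local Notation C := R[i].
Local Notation Rm := (measurableTypeR R).

(** The interleaving is that of [realC3_coord], so that at n = 3 this passes from complex affine
    coordinates to the real ones of the charts. *)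
Fixpoint toR n : n.-tuple C -> n.*2.-tuple Rm :=
  if n is k.+1 then fun t : k.+1.-tuple C =>
    tcons (complex.Re (thead t) : Rm,
      tcons (complex.Im (thead t) : Rm, toR [tuple of behead t]))
  else fun=> [tuple].

Lemma toR_tcons n z (t : n.-tuple C) : toR (tcons (z, t)) =
  tcons (complex.Re z : Rm, tcons (complex.Im z : Rm, toR t)) :> n.+1.*2.-tuple Rm.
Proof.
have e : [tuple of behead (tcons (z, t))] = t by exact: val_inj.
by rewrite [LHS]/= e theadE.
Qed.

Lemma measurable_toR n : measurable_fun setT (@toR n).
Proof.
elim: n => [|n ih]; first exact: measurable_cst.
have mh : measurable_fun setT (fun t : n.+1.-tuple C => thead t).
  exact: (measurable_tnth ord0).
apply: measurable_cons; first exact: measurable_Re.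
apply: measurable_cons; first exact: measurable_Im.
by apply: measurableT_comp ih _; exact: measurable_behead.
Qed.

Lemma ae_toR n (P : n.*2.-tuple Rm -> Prop) : measurable [set s | P s] ->
  (\forall s \ae power_measure (leb R) n.*2, P s) <->
  (\forall t \ae power_measure (lamC R) n, P (toR t)).
Proof.
elim: n P => [|n ih] P mP.
  by split=> /ae_power0E h; apply: ae_power0P.
have mP' : measurable [set t | P (@toR n.+1 t)].
  exact: measurable_comp_set (@measurable_toR n.+1) mP.
have mP1 : measurable [set p | P (@tcons _ _ n.*2.+1 p)].
  exact: measurable_comp_set (@measurable_tcons _ _ n.*2.+1) mP.
have mP1x x : measurable [set s | P (@tcons _ _ n.*2.+1 (x, s))].
  apply: (measurable_comp_set (f := fun s => (x, s)) _ mP1).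
  exact/measurable_fun_pair.
have mP2 : measurable [set p : (Rm * Rm) * n.*2.-tuple Rm |
    P (@tcons _ _ n.*2.+1 (p.1.1, tcons (p.1.2, p.2)))].
  apply: (measurable_comp_set (f := fun p : (Rm * Rm) * n.*2.-tuple Rm =>
    (p.1.1, tcons (p.1.2, p.2))) _ mP1).
  apply/measurable_fun_pair => /=; first exact: measurableT_comp.
  apply: measurable_cons; last exact: measurable_snd.
  exact: (measurableT_comp (f := snd) measurable_snd measurable_fst).
have mP2xy p : measurable [set s | P (@tcons _ _ n.*2.+1 (p.1, tcons (p.2, s)))].
  apply: (measurable_comp_set (f := fun s => (p, s)) _ mP2).
  exact/measurable_fun_pair.
have mQ : measurable [set p : Rm * Rm |
   \forall s \ae power_measure (leb R) n.*2, P (tcons (p.1, tcons (p.2, s)))].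
  exact: (measurable_ae (power_measure (leb R) n.*2) mP2).
have mQ' : measurable [set z : C | \forall s \ae power_measure (leb R) n.*2,
   P (tcons (complex.Re z : Rm, tcons (complex.Im z : Rm, s)))].
  exact: (measurable_comp_set (@measurable_unC R) mQ).
have -> : (\forall s \ae power_measure (leb R) n.+1.*2, P s) <->
  (\forall x \ae leb R, \forall y \ae leb R,
    \forall s \ae power_measure (leb R) n.*2, P (tcons (x, tcons (y, s)))).
  rewrite (ae_consP (leb R) mP).
  split; apply: (@filterS _ _ (ae_filter_ringOfSetsType (leb R))) => x h.
    exact: (ae_consP (leb R) (mP1x x)).1 h.
  exact: (ae_consP (leb R) (mP1x x)).2 h.
rewrite -(ae_complexP (P := fun z => \forall s \ae power_measure (leb R) n.*2,
   P (tcons (complex.Re z : Rm, tcons (complex.Im z : Rm, s)))) mQ').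
rewrite (ae_consP (lamC R) mP').
split; apply: filterS => z h.
  apply: filterS ((ih _ (mP2xy (complex.Re z, complex.Im z))).1 h) => t.
  by rewrite toR_tcons.
apply: (ih _ (mP2xy (complex.Re z, complex.Im z))).2.
by apply: filterS h => t; rewrite toR_tcons.
Qed.

Lemma realC3_coord_toR (z : 3.-tuple C) j : realC3_coord (toR z) j = tnth z j.
Proof.
case: z j => -[|z0 [|z1 [|z2 []]]]// hz j.
rewrite /realC3_coord (tnth_nth 0).
by case: j => -[|[|[|]]] //= hj; case: (z0); case: (z1); case: (z2).
Qed.

Lemma ae_neq0 : \forall z \ae lamC R, z != 0.
Proof.
apply/ae_complexP; first by apply: measurable_complex_neq0.
have : \forall x \ae leb R, x != 0.
  apply/ae_measurableP.
    by rewrite (_ : [set x | _] = [set~ 0]);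
      [exact: measurableC|apply/seteqP; split=> x /eqP].
  rewrite (_ : [set x | _] = [set 0]); first exact: lebesgue_measure_set1.
  apply/seteqP; split=> x /=; first by move/negP; rewrite negbK => /eqP.
  by move=> ->; rewrite eqxx.
apply: (@filterS _ _ (ae_filter_ringOfSetsType (leb R))) => x x0.
by apply: aeW => y; apply/eqP => -[xE]; rewrite xE eqxx in x0.
Qed.

Definition scalet n (c : C) (t : n.-tuple C) : n.-tuple C := tmap ( *%R c) t.

Lemma tnth_scalet n c (t : n.-tuple C) i : tnth (scalet c t) i = c * tnth t i.
Proof. exact: tnth_map. Qed.

Lemma measurable_scalet n c : measurable_fun setT (@scalet n c).
Proof.
by apply: measurable_map_tuple; apply: measurable_complexM.
Qed.

Lemma ae_scalet n c (P : n.-tuple C -> Prop) : c != 0 -> measurable [set t | P t] ->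
  (\forall t \ae power_measure (lamC R) n, P t) <->
  (\forall t \ae power_measure (lamC R) n, P (scalet c t)).
Proof.
move=> c0 mP; apply: ae_additive_surj mP; first exact: measurable_scalet.
  by move=> x y; apply: eq_from_tnth => i; rewrite !(tnth_addt, tnth_scalet) mulrDr.
move=> y; exists (scalet c^-1 y); apply: eq_from_tnth => i.
by rewrite !tnth_scalet mulrA divff// mul1r.
Qed.

End RealCoordinates.

Section ProjectivePoint.
Variable R : realType.
Local Notation C := R[i].
Local Notation V := (4.-tuple R[i]).
Local Notation X := (projSpace R).
Local Notation lamV := (power_measure (lamC R) 4).

Definition vec (v : V) : vecC4 R := \row_j tnth v j.
Definition unvec (u : vecC4 R) : V := [tuple u 0 j | j < 4].

Lemma vecK : cancel vec unvec.
Proof. by move=> v; apply: eq_from_tnth => i; rewrite tnth_mktuple mxE. Qed.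

Lemma unvecK : cancel unvec vec.
Proof. by move=> u; apply/rowP => i; rewrite mxE tnth_mktuple. Qed.

Lemma vecD v v' : vec (addt v v') = vec v + vec v'.
Proof. by apply/rowP => i; rewrite !mxE tnth_addt. Qed.

(** Total on all vectors: the zero vector is sent to an arbitrary point, which affects only a null
    set. *)
Definition pt (u : vecC4 R) : X := insubd (point : X) <[u]>%VS.

Lemma ptE u : u != 0 -> pt u = <[u]>%VS :> {vspace _}.
Proof. by move=> u0; rewrite /pt insubdK// [_ \in _]dim_line. Qed.

Lemma ptZ a u : a != 0 -> pt (a *: u) = pt u.
Proof.
move=> a0; congr insubd; apply/vspaceP => x.
apply/vlineP/vlineP => -[k ->].
  by exists (k * a); rewrite scalerA.
by exists (k / a); rewrite scalerA mulfVK.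
Qed.

Lemma Sp_act_pt (w : {biscalar vecC4 R}) (g : Sp w) u : u != 0 ->
  Sp_act g (pt u) = pt (g u).
Proof.
move=> u0; apply: val_inj; rewrite /= !ptE//; first by rewrite limg_line.
apply: contra_neq u0 => gu; apply/eqP; rewrite -memv0 -(eqP (Sp_inj g)).
by rewrite memv_ker gu.
Qed.

(* [t = (c, z)] as the vector with [i]-th coordinate [c] and other coordinates [z] *)
Definition insert_coord (i : 'I_4) (t : V) : V :=
  [tuple if unlift i k is Some j then tnth t (lift ord0 j) else tnth t ord0 | k < 4].

Definition chart (i : 'I_4) (v : V) : 3.-tuple C :=
  [tuple tnth v (lift i j) / tnth v i | j < 3].

Lemma pt_chart i v : tnth v i != 0 -> pt (vec v) = affine_pt i (toR (chart i v)).
Proof.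
move=> vi0; rewrite -(@ptZ (tnth v i)^-1) ?invr_eq0//.
have e : (tnth v i)^-1 *: vec v = affine_vec i (toR (chart i v)).
  apply/rowP => k; rewrite !mxE; case: unliftP => [j ->|->].
    by rewrite realC3_coord_toR tnth_mktuple mulrC.
  by rewrite mulVf.
by apply: val_inj; rewrite e /= ptE// affine_vec_neq0.
Qed.

Lemma measurable_chart i : measurable_fun setT (chart i).
Proof.
apply/measurable_fun_tnthP => j.
rewrite (_ : _ \o _ = fun v => tnth v (lift i j) / tnth v i); last first.
  by apply/funext => v /=; rewrite tnth_mktuple.
apply: measurable_complexM; first exact: measurable_tnth.
by apply: measurable_complexV; exact: measurable_tnth.
Qed.

Lemma measurable_pt : measurable_fun setT (pt \o vec).
Proof.
have mneq i : measurable_fun setT (fun v : V => tnth v i != 0).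
  apply: (measurable_fun_bool true); rewrite setTI.
  by apply: measurable_complex_neq0; exact: measurable_tnth.
have mchart i : measurable_fun setT (fun v : V => affine_pt i (toR (chart i v))).
  apply: (measurableT_comp (@measurable_affine_pt R i)).
  by apply: (measurableT_comp (@measurable_toR R 3)); exact: measurable_chart.
pose f i (g : V -> X) v := if tnth v i != 0 then affine_pt i (toR (chart i v)) else g v.
have mf i g : measurable_fun setT g -> measurable_fun setT (f i g).
  by move=> mg; exact: measurable_fun_ifT.
(* Use the chart of the first nonzero coordinate, and the constant [pt 0] at the zero vector. *)
pose F := foldr f (cst (pt 0)) (enum 'I_4).
rewrite (_ : pt \o vec = F).
  by rewrite /F; elim: (enum _) => [|i s ih] /=; [exact: measurable_cst|exact: mf].
apply/funext => v; rewrite /F /=.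
have [/existsP[i vi]|] := boolP [exists i, tnth v i != 0].
  have : i \in enum 'I_4 by rewrite mem_enum.
  elim: (enum _) => // j s ih; rewrite inE /= /f => /predU1P[<-|/ih <-].
    by rewrite vi (pt_chart vi).
  by case: ifPn => // vj; rewrite (pt_chart vj).
rewrite negb_exists => /forallP h.
have -> : vec v = 0 by apply/rowP => j; rewrite !mxE; apply/eqP; have := h j; rewrite negbK.
by elim: (enum _) => // j s ih; rewrite /= /f (negbTE (h j)).
Qed.

Lemma chart_insert i c z : chart i (insert_coord i (tcons (c, z))) = scalet c^-1 z.
Proof.
apply: eq_from_tnth => j; rewrite !tnth_mktuple tnth_scalet liftK unlift_none.
by rewrite tnthS mulrC !(tnth_nth 0).
Qed.

Lemma insert_coord_ae i (P : V -> Prop) : measurable [set v | P v] ->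
  (\forall v \ae lamV, P v) <->
  (\forall c \ae lamC R, \forall z \ae power_measure (lamC R) 3,
     P (insert_coord i (tcons (c, z)))).
Proof.
move=> mP.
have mi : measurable_fun setT (insert_coord i).
  apply/measurable_fun_tnthP => k.
  rewrite (_ : _ \o _ = @tnth _ _ ^~
     (if unlift i k is Some j then lift ord0 j else ord0)).
    exact: measurable_tnth.
  by apply/funext => t /=; rewrite tnth_mktuple; case: unlift.
have mPi : measurable [set t | P (insert_coord i t)] by exact: measurable_comp_set mi mP.
rewrite (ae_additive_surj (phi := insert_coord i) mi _ _ mP).
- exact: (ae_consP (lamC R) mPi).
- move=> x y; apply: eq_from_tnth => k; rewrite tnth_addt !tnth_mktuple.
  by case: unlift => [j|]; rewrite ?tnth_mktuple ?tnth_addt.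
- move=> y; exists (tcons (tnth y i, [tuple tnth y (lift i j) | j < 3])).
  apply: eq_from_tnth => k; rewrite tnth_mktuple.
  case: unliftP => [j ->|->]; rewrite ?tnthS ?tnth_mktuple//.
Qed.

(** In the coordinates (c, z) with c the i-th one, the point is z/c in the i-th chart, and for fixed
    nonzero c scaling preserves null sets. Hence null sets of each chart correspond to null cones in
    V. *)
Lemma smooth_class_ae (mu : probability X R) (Q : X -> Prop) : smooth_class mu ->
  measurable [set x | Q x] ->
  (\forall x \ae mu, Q x) <-> (\forall v \ae lamV, Q (pt (vec v))).
Proof.
move=> smu mQ.
have mQi i : measurable [set s | Q (affine_pt i s)].
  exact: (measurable_comp_set (@measurable_affine_pt R i) mQ).
have mQt i : measurable [set t : 3.-tuple C | Q (affine_pt i (toR t))].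
  exact: (measurable_comp_set (@measurable_toR R 3) (mQi i)).
have mQv : measurable [set v | Q (pt (vec v))].
  exact: (measurable_comp_set measurable_pt mQ).
have -> : (\forall x \ae mu, Q x) <->
    (forall i, \forall t \ae power_measure (lamC R) 3, Q (affine_pt i (@toR R 3 t))).
  apply: (iff_trans (ae_measurableP mu mQ)).
  apply: (iff_trans (smu _ (measurableC mQ))).
  have m6 i := ae_measurableP (power_measure (leb R) 6) (mQi i).
  split=> h i; first exact: (@ae_toR R 3 _ (mQi i)).1 ((m6 i).2 (h i)).
  exact: (m6 i).1 ((@ae_toR R 3 _ (mQi i)).2 (h i)).
have key i (c : C) (z : 3.-tuple C) : c != 0 ->
    pt (vec (insert_coord i (tcons (c, z)))) = affine_pt i (toR (scalet c^-1 z)).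
  by move=> c0; rewrite (@pt_chart i) ?chart_insert// tnth_mktuple unlift_none.
(* A single chart is enough in this direction, as almost every vector has a nonzero first
   coordinate. *)
split=> [h|/insert_coord_ae h i].
  apply/(insert_coord_ae ord0 mQv); apply: filterS (ae_neq0 R) => c c0.
  have ci0 : c^-1 != 0 by rewrite invr_eq0.
  by apply: filterS ((ae_scalet ci0 (mQt ord0)).1 (h ord0)) => z; rewrite key.
have [c [hc c0]] := ae_ex (lebesgueC_gt0 R) (filterI (h i mQv) (ae_neq0 R)).
have ci0 : c^-1 != 0 by rewrite invr_eq0.
apply/(ae_scalet ci0 (mQt i)).
by apply: filterS hc => z; rewrite key.
Qed.

Lemma power_smooth_class_ae (mu : probability X R) n (Q : n.-tuple X -> Prop) :
  smooth_class mu -> measurable [set x | Q x] ->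
  (\forall x \ae power_measure mu n, Q x) <->
  (\forall v \ae power_measure lamV n, Q (tmap (pt \o vec) v)).
Proof.
move=> smu mQ; apply: ae_power_map => //; first exact: measurable_pt.
by move=> P mP; exact: smooth_class_ae.
Qed.

End ProjectivePoint.

(** * Symplectic linear algebra *)

Section Darboux.
Variables (F : fieldType) (w : {biscalar 'rV[F]_4}).
Hypothesis walt : forall u, w u u = 0.
Hypothesis wnd : forall u, (forall v, w u v = 0) -> u = 0.

Lemma wN u v : w v u = - w u v.
Proof.
have := walt (u + v); rewrite linearDl !linearDr !walt add0r addr0 => /eqP.
by rewrite addr_eq0 => /eqP ->; rewrite opprK.
Qed.

Definition gramW : 'M[F]_4 := \matrix_(i, j) w (delta_mx 0 i) (delta_mx 0 j).

Lemma gramWE m n (Y : 'M[F]_(m, 4)) (Z : 'M[F]_(n, 4)) i j :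
  (Y *m gramW *m Z^T) i j = w (row i Y) (row j Z).
Proof.
rewrite mxE; under eq_bigr => k _ do rewrite !mxE big_distrl /=.
rewrite (row_sum_delta (row i Y)) linear_sumlz.
rewrite exchange_big/=; apply: eq_bigr => k _.
rewrite linearZl_LR /= (row_sum_delta (row j Z)) linear_sumr big_distrr/=.
by apply: eq_bigr => l _; rewrite linearZr_LR /= !mxE; ring.
Qed.

Lemma w_mulmx H u v : H *m gramW *m H^T = gramW -> w (u *m H) (v *m H) = w u v.
Proof.
move=> hH; have e (x y : 'rV[F]_4) : w x y = (x *m gramW *m y^T) 0 0.
  by rewrite gramWE !row_id.
rewrite !e trmx_mul -!mulmxA [X in _ *m X](_ : _ = gramW *m v^T)//.
by rewrite -[in RHS]hH -!mulmxA.
Qed.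

Lemma gramW_unit : gramW \in unitmx.
Proof.
rewrite -row_free_unit -kermx_eq0; apply/eqP/row_matrixP => i.
rewrite row0; apply: wnd => v.
have -> : w (row i (kermx gramW)) v = (row i (kermx gramW) *m gramW *m v^T) 0 0.
  by rewrite gramWE !row_id.
by rewrite -row_mul mulmx_ker row0 mul0mx mxE.
Qed.

Lemma symplectic_unit H : H *m gramW *m H^T = gramW -> H \in unitmx.
Proof.
move=> hH; have := gramW_unit; rewrite -{1}hH unitmxE !det_mulmx !unitrM.
by rewrite -!unitmxE => /andP[/andP[]].
Qed.

Lemma symplectic_inv H : H *m gramW *m H^T = gramW ->
  invmx H *m gramW *m (invmx H)^T = gramW.
Proof.
move=> hH; have uH := symplectic_unit hH.
by rewrite -{1}hH -!mulmxA -trmx_mul mulVmx// trmx1 mulmx1 mulKmx.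
Qed.

(** The Gram matrix of a Darboux basis in the order e1, f1, e2, f2. *)
Definition stdJ : 'M[F]_4 := \matrix_(i, j)
  nth 0 (nth [::] [:: [:: 0; 1; 0; 0]; [:: -1; 0; 0; 0];
                      [:: 0; 0; 0; 1]; [:: 0; 0; -1; 0]] i) j.

Ltac ord4 := do [case=> -[|[|[|[|]]]] // ?].

Lemma stdJJ : stdJ *m stdJ = - 1%:M.
Proof.
by apply/matrixP; ord4; ord4; rewrite !mxE !big_ord_recl big_ord0 !mxE /=; ring.
Qed.

Lemma stdJT : stdJ^T = - stdJ.
Proof. by apply/matrixP; ord4; ord4; rewrite !mxE /=; ring. Qed.

(** The projection of x to the orthogonal complement of u and v, multiplied by w(u,v) to avoid a
    division. *)
Definition reduce u v x := w u v *: x + w v x *: u - w u x *: v.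

Lemma reduce_orthl u v x : w u (reduce u v x) = 0.
Proof.
rewrite /reduce linearBr linearDr !linearZr_LR /= walt; ring.
Qed.

Lemma reduce_orthr u v x : w v (reduce u v x) = 0.
Proof.
rewrite /reduce linearBr linearDr !linearZr_LR /= walt (wN u v); ring.
Qed.

Lemma reduce_orth u v z x : w z u = 0 -> w z v = 0 ->
  w z (reduce u v x) = w u v * w z x.
Proof.
move=> zu zv.
by rewrite /reduce linearBr linearDr !linearZr_LR /= zu zv; ring.
Qed.

(* symplectic Gram-Schmidt on the rows of [Q] *)
Definition darboux (Q : 'M[F]_4) : 'M[F]_4 :=
  let q k := row (inord k) Q in
  let e := reduce (q 0) (q 1) (q 2) in
  let f := reduce (q 0) (q 1) (q 3) in
  \matrix_(i, j) (nth (q 0) [:: q 0; (w (q 0) (q 1))^-1 *: q 1; e;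
    (w e f)^-1 *: f] i) 0 j.

Definition darboux_good (Q : 'M[F]_4) : bool :=
  let q k := row (inord k) Q in
  (w (q 0) (q 1) != 0) &&
  (w (reduce (q 0) (q 1) (q 2)) (reduce (q 0) (q 1) (q 3)) != 0).

Lemma darboux_gram Q : darboux_good Q -> darboux Q *m gramW *m (darboux Q)^T = stdJ.
Proof.
rewrite /darboux_good; set q := fun k : nat => row (inord k) Q.
set e := reduce (q 0) (q 1) (q 2); set f := reduce (q 0) (q 1) (q 3).
move=> /andP[q01 ef].
have rowD i : row i (darboux Q) = nth (q 0) [:: q 0; (w (q 0) (q 1))^-1 *: q 1; e;
    (w e f)^-1 *: f] i.
  by apply/rowP => j; rewrite !mxE.
have e0 : w (q 0) e = 0 := reduce_orthl _ _ _.
have e1 : w (q 1) e = 0 := reduce_orthr _ _ _.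
have f0 : w (q 0) f = 0 := reduce_orthl _ _ _.
have f1 : w (q 1) f = 0 := reduce_orthr _ _ _.
have e0' : w e (q 0) = 0 by rewrite wN e0 oppr0.
have e1' : w e (q 1) = 0 by rewrite wN e1 oppr0.
have f0' : w f (q 0) = 0 by rewrite wN f0 oppr0.
have f1' : w f (q 1) = 0 by rewrite wN f1 oppr0.
apply/matrixP => i j; rewrite gramWE !rowD mxE.
move: i j; ord4; ord4 => /=; rewrite ?linearZl_LR ?linearZr_LR /= ?walt ?e0 ?e1 ?f0 ?f1
  ?e0' ?e1' ?f0' ?f1' ?(wN (q 0) (q 1)) ?(wN e f) ?mulr0 ?mulrN ?mulVf//.
Qed.

Lemma row_mulmx_reduce H u v x : H *m gramW *m H^T = gramW ->
  reduce (u *m H) (v *m H) (x *m H) = reduce u v x *m H.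
Proof.
by move=> hH; rewrite /reduce !w_mulmx// mulmxBl mulmxDl !scalemxAl.
Qed.

(** Gram-Schmidt uses nothing but pairings and linear combinations, so it commutes with symplectic
    maps. *)
Lemma darboux_mulmx H Q : H *m gramW *m H^T = gramW ->
  darboux (Q *m H) = darboux Q *m H.
Proof.
move=> hH; apply/row_matrixP => i; rewrite row_mul.
have rowD (Z : 'M[F]_4) k : row k (darboux Z) = nth (row (inord 0) Z)
  [:: row (inord 0) Z; (w (row (inord 0) Z) (row (inord 1) Z))^-1 *: row (inord 1) Z;
   reduce (row (inord 0) Z) (row (inord 1) Z) (row (inord 2) Z);
   (w (reduce (row (inord 0) Z) (row (inord 1) Z) (row (inord 2) Z))
     (reduce (row (inord 0) Z) (row (inord 1) Z) (row (inord 3) Z)))^-1 *: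
   reduce (row (inord 0) Z) (row (inord 1) Z) (row (inord 3) Z)] k.
  by apply/rowP => j; rewrite !mxE.
rewrite !rowD !row_mul !row_mulmx_reduce// !w_mulmx//.
by move: i; ord4 => /=; rewrite -?scalemxAl.
Qed.

(** For good [Q] the product of the first three factors is the inverse of [darboux Q], because its
    Gram matrix is J and J^2 = -1. So this matrix takes the Darboux basis of [Q] to [D0]; written
    without [invmx], it is visibly measurable in [Q]. *)
Definition frame_to (D0 Q : 'M[F]_4) : 'M[F]_4 := gramW *m (darboux Q)^T *m (- stdJ) *m D0.

Lemma frame_to_symplectic D0 Q : D0 *m gramW *m D0^T = stdJ -> darboux_good Q ->
  frame_to D0 Q *m gramW *m (frame_to D0 Q)^T = gramW.
Proof.
move=> hD0 /darboux_gram hQ; rewrite /frame_to; set D := darboux Q in hQ *.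
have invD : (gramW *m D^T *m - stdJ) *m D = 1%:M.
  by apply: mulmx1C; rewrite !mulmxA hQ mulmxN stdJJ opprK.
have gT : gramW^T = - gramW by apply/matrixP => i j; rewrite !mxE wN.
set A := gramW *m D^T *m - stdJ in invD *.
have -> : (A *m D0)^T = - (D0^T *m stdJ *m D *m gramW).
  by rewrite /A !trmx_mul trmxK linearN/= stdJT opprK gT !mulmxN !mulmxA.
rewrite mulmxN !mulmxA -(mulmxA A D0) -(mulmxA A _ D0^T) hD0 -(mulmxA A stdJ) stdJJ.
by rewrite mulmxN mulmx1 !mulNmx opprK invD mul1mx.
Qed.

(** Equivariance in the parameter [Q]. The inverse-free formula makes it hold for degenerate [Q] as
    well. *)
Lemma frame_to_mulmx D0 H Q : H *m gramW *m H^T = gramW ->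
  H *m frame_to D0 (Q *m H) = frame_to D0 Q.
Proof.
by move=> hH; rewrite /frame_to darboux_mulmx// trmx_mul !mulmxA hH.
Qed.

(* four rows of Gram matrix [w01 = a, w02 = b, w03 = 1, w12 = c^2, w13 = w23 = c],
   when [D0] is a Darboux basis *)
Definition cross_ratio_frame (D0 : 'M[F]_4) (a b c : F) : 'M[F]_4 :=
  (\matrix_(i, j) nth 0 (nth [::] [:: [:: 1; 0; 0; 0]; [:: c; a; c; 0];
     [:: c; b; 0; c - b + a]; [:: 0; 1; 0; 0]] i) j) *m D0.

Lemma cross_ratio_frame_gram D0 a b c : D0 *m gramW *m D0^T = stdJ ->
  cross_ratio_frame D0 a b c *m gramW *m (cross_ratio_frame D0 a b c)^T =
  \matrix_(i, j) nth 0 (nth [::] [:: [:: 0; a; b; 1]; [:: - a; 0; c * c; c];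
     [:: - b; - (c * c); 0; c]; [:: - 1; - c; - c; 0]] i) j.
Proof.
move=> hD; rewrite /cross_ratio_frame; set T := \matrix_(_, _) _.
rewrite trmx_mul -!mulmxA (mulmxA D0) (mulmxA (D0 *m _)) hD mulmxA.
apply/matrixP; ord4; ord4; rewrite !mxE !big_ord_recl !big_ord0 !mxE /=;
  rewrite !big_ord_recl !big_ord0 !mxE /=; ring.
Qed.

(** Scaling the ratio only rescales the two middle vectors, so the four points of P(V) stay the
    same. *)
Lemma cross_ratio_frameZ D0 a b c k i : k != 0 ->
  exists2 l, l != 0 & row i (cross_ratio_frame D0 (k * a) (k * b) (k * c)) =
    l *: row i (cross_ratio_frame D0 a b c).
Proof.
move=> k0; exists (nth 0 [:: 1; k; k; 1] i).
  by move: i; ord4 => /=; rewrite ?oner_eq0.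
rewrite /cross_ratio_frame !row_mul scalemxAl; congr (_ *m _); apply/rowP => j.
rewrite !mxE; move: i j; ord4; ord4 => /=; ring.
Qed.

Definition gij (Y : 'M[F]_4) (i j : nat) : F := w (row (inord i) Y) (row (inord j) Y).

(** The vectors can be rescaled to have the Gram matrix of the normal form, and two bases with the
    same Gram matrix differ by a symplectic matrix. Thus the cross ratio is a complete invariant of
    generic quadruples of points. *)
Lemma similar_cross_ratio_frame D0 Y m : D0 *m gramW *m D0^T = stdJ ->
  Y \in unitmx -> (forall i j, (i < j < 4)%N -> gij Y i j != 0) ->
  m ^+ 2 = gij Y 1 2 / (gij Y 1 3 * gij Y 2 3) ->
  exists H, H *m gramW *m H^T = gramW /\ forall i, exists2 l, l != 0 &
    row i (cross_ratio_frame D0 (gij Y 0 1 * gij Y 2 3) (gij Y 0 2 * gij Y 1 3)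
      (gij Y 0 3 * gij Y 1 2)) = l *: row i (Y *m H).
Proof.
move=> hD uY nz hm.
have [n01 n02 n03] : [/\ gij Y 0 1 != 0, gij Y 0 2 != 0 & gij Y 0 3 != 0].
  by split; exact: nz.
have [n12 n13 n23] : [/\ gij Y 1 2 != 0, gij Y 1 3 != 0 & gij Y 2 3 != 0].
  by split; exact: nz.
have m0 : m != 0.
  apply/eqP => m0; move: hm; rewrite m0 expr0n /= => /esym/eqP.
  by rewrite mulf_eq0 invr_eq0 mulf_eq0 (negbTE n12) (negbTE n13) (negbTE n23).
set c := gij Y 0 3 * gij Y 1 2; set Z := cross_ratio_frame _ _ _ _.
have c0 : c != 0 by rewrite mulf_neq0.
(* The scalings solve l0 l3 w03 = 1 and l1 l3 w13 = l2 l3 w23 = c with l3 = m; the requirement l1 l2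
   w12 = c^2 then forces the value of m^2. The pairings 01 and 02 come out right by themselves. *)
pose l : 'rV[F]_4 := \row_i nth 0 [:: (m * gij Y 0 3)^-1; c / (m * gij Y 1 3);
  c / (m * gij Y 2 3); m] i.
have l0 i : l 0 i != 0.
  rewrite mxE; move: i; ord4 => //=; rewrite ?invr_eq0 ?mulf_neq0 ?invr_eq0 ?mulf_neq0//.
have gram : (diag_mx l *m Y) *m gramW *m (diag_mx l *m Y)^T = Z *m gramW *m Z^T.
  rewrite cross_ratio_frame_gram//; apply/matrixP => i j.
  have rowl k : row k (diag_mx l *m Y) = l 0 k *: row k Y.
    by rewrite mul_diag_mx; apply/rowP => j'; rewrite !mxE.
  rewrite gramWE !rowl linearZl_LR linearZr_LR /=.
  have gE k k' : w (row k Y) (row k' Y) = gij Y k k' by rewrite /gij !inord_val.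
  have gN k k' : gij Y k k' = - gij Y k' k by rewrite /gij wN.
  have g0 k : gij Y k k = 0 by rewrite /gij walt.
  rewrite gE !mxE.
  have hm' : gij Y 1 2 = m ^+ 2 * (gij Y 1 3 * gij Y 2 3).
    by rewrite hm mulfVK// mulf_neq0.
  move: i j; ord4; ord4 => /=; rewrite ?g0 ?(gN 1 0)%N ?(gN 2 0)%N ?(gN 3 0)%N
    ?(gN 2 1)%N ?(gN 3 1)%N ?(gN 3 2)%N ?mulr0// /c ?hm'; field; rewrite ?m0 ?n03 ?n13 ?n23//.
have uL : diag_mx l *m Y \in unitmx.
  rewrite unitmx_mul uY andbT unitmxE det_diag unitfE.
  by apply/prodf_neq0 => i _; exact: l0.
pose H := invmx (diag_mx l *m Y) *m Z.
have YH : diag_mx l *m (Y *m H) = Z by rewrite /H mulmxA mulKVmx.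
exists H; split.
  rewrite /H; move: (diag_mx l *m Y) gram uL => Y' gram uL.
  have -> : invmx Y' *m Z *m gramW *m (invmx Y' *m Z)^T =
      invmx Y' *m (Z *m gramW *m Z^T) *m (invmx Y')^T by rewrite trmx_mul !mulmxA.
  by rewrite -gram !mulmxA mulVmx// mul1mx -mulmxA -trmx_mul mulVmx// trmx1 mulmx1.
move=> i; exists (l 0 i) => //; rewrite -YH mul_diag_mx.
by apply/rowP => j; rewrite !mxE.
Qed.

(** The Darboux rows are combinations of the rows of [Q], and they are independent because J is
    invertible. *)
Lemma darboux_good_unit Q : darboux_good Q -> Q \in unitmx.
Proof.
move=> gQ; have hD := darboux_gram gQ.
have uD : darboux Q \in unitmx.
  have : stdJ \in unitmx.
    have : stdJ *m - stdJ = 1%:M by rewrite mulmxN stdJJ opprK.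
    by move/mulmx1_unit => [].
  by rewrite -hD !unitmx_mul -andbA => /andP[].
have rQ k : (row k Q <= Q)%MS by exact: row_sub.
have DQ : (darboux Q <= Q)%MS.
  have redQ k : (reduce (row (inord 0) Q) (row (inord 1) Q) (row k Q) <= Q)%MS.
    by rewrite /reduce !(addmx_sub, scalemx_sub, eqmx_opp)//.
  apply/row_subP => i; rewrite (_ : row i _ = nth (row (inord 0) Q)
    [:: row (inord 0) Q; (w (row (inord 0) Q) (row (inord 1) Q))^-1 *: row (inord 1) Q;
     reduce (row (inord 0) Q) (row (inord 1) Q) (row (inord 2) Q);
     (w (reduce (row (inord 0) Q) (row (inord 1) Q) (row (inord 2) Q))
       (reduce (row (inord 0) Q) (row (inord 1) Q) (row (inord 3) Q)))^-1 *:
     reduce (row (inord 0) Q) (row (inord 1) Q) (row (inord 3) Q)] i).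
    by move: i; ord4 => /=; rewrite ?scalemx_sub ?redQ ?rQ.
  by apply/rowP => j; rewrite !mxE.
rewrite -row_full_unit /row_full eqn_leq rank_leq_col /=.
by rewrite -{1}(mxrank_unit uD) mxrankS.
Qed.

(** Such a z detects that [reduce u v x] is nonzero: by [reduce_orth] its pairing with z is w(u,v)
    w(z,x). *)
Lemma orthogonal_pair (u v : 'rV[F]_4) : exists z, [/\ z != 0, w z u = 0 & w z v = 0].
Proof.
pose A : 'M[F]_(4, 1 + 1) := gramW *m (col_mx u v)^T.
have : kermx A != 0.
  rewrite -mxrank_eq0 mxrank_ker subn_eq0 -ltnNge.
  by apply: leq_ltn_trans (rank_leq_col A) _.
move/rowV0Pn => [z /sub_kermxP zA z0]; exists z; split => //.
  have := congr1 (fun M : 'rV_(1 + 1) => M 0 (lshift 1 0)) zA.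
  by rewrite /A mulmxA gramWE row_id rowKu row_id mxE.
have := congr1 (fun M : 'rV_(1 + 1) => M 0 (rshift 1 0)) zA.
by rewrite /A mulmxA gramWE row_id rowKd row_id mxE.
Qed.

End Darboux.

(** * Measurability of symplectic constructions *)

Section MeasurableMatrix.
Variable R : realType.
Local Notation C := R[i].
Local Notation V := (4.-tuple R[i]).
Context d (T : measurableType d).

Definition measurable_mx m n (M : T -> 'M[C]_(m, n)) : Prop :=
  forall i j, measurable_fun setT (fun t => M t i j).

Lemma measurable_mx_cst m n (A : 'M[C]_(m, n)) : measurable_mx (fun=> A).
Proof. by move=> i j; exact: measurable_cst. Qed.

Lemma measurable_mx_row m n (M : T -> 'M[C]_(m, n)) k :
  measurable_mx M -> measurable_mx (fun t => row k (M t)).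
Proof.
move=> mM i j; rewrite (_ : (fun _ => _) = fun t => M t k j)//.
by apply/funext => t; rewrite mxE.
Qed.

Lemma measurable_mx_tr m n (M : T -> 'M[C]_(m, n)) :
  measurable_mx M -> measurable_mx (fun t => (M t)^T).
Proof.
move=> mM i j; rewrite (_ : (fun _ => _) = fun t => M t j i)//.
by apply/funext => t; rewrite mxE.
Qed.

Lemma measurable_mx_mul m n p (M : T -> 'M[C]_(m, n)) (N : T -> 'M[C]_(n, p)) :
  measurable_mx M -> measurable_mx N -> measurable_mx (fun t => M t *m N t).
Proof.
move=> mM mN i j; rewrite (_ : (fun _ => _) = fun t => \sum_k M t i k * N t k j).
  by apply: measurable_complex_sum => k; exact: measurable_complexM.
by apply/funext => t; rewrite mxE.
Qed.

Lemma measurable_mx_add m n (M N : T -> 'M[C]_(m, n)) :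
  measurable_mx M -> measurable_mx N -> measurable_mx (fun t => M t + N t).
Proof.
move=> mM mN i j; rewrite (_ : (fun _ => _) = fun t => M t i j + N t i j).
  exact: measurable_complexD.
by apply/funext => t; rewrite mxE.
Qed.

Lemma measurable_mx_scale m n (f : T -> C) (M : T -> 'M[C]_(m, n)) :
  measurable_fun setT f -> measurable_mx M -> measurable_mx (fun t => f t *: M t).
Proof.
move=> mf mM i j; rewrite (_ : (fun _ => _) = fun t => f t * M t i j).
  exact: measurable_complexM.
by apply/funext => t; rewrite mxE.
Qed.

Lemma measurable_mx_opp m n (M : T -> 'M[C]_(m, n)) :
  measurable_mx M -> measurable_mx (fun t => - M t).
Proof.
move=> mM; rewrite (_ : (fun _ => _) = fun t => -1 *: M t).
  by apply: measurable_mx_scale => //; exact: measurable_cst.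
by apply/funext => t; rewrite scaleN1r.
Qed.

Variable w : {biscalar 'rV[C]_4}.

Lemma measurable_form (M N : T -> 'rV[C]_4) : measurable_mx M -> measurable_mx N ->
  measurable_fun setT (fun t => w (M t) (N t)).
Proof.
move=> mM mN.
rewrite (_ : (fun _ => _) = fun t => (M t *m gramW w *m (N t)^T) 0 0).
  apply: measurable_mx_mul; last exact: measurable_mx_tr.
  by apply: measurable_mx_mul => //; exact: measurable_mx_cst.
by apply/funext => t; rewrite gramWE !row_id.
Qed.

Lemma measurable_reduce (M N P : T -> 'rV[C]_4) : measurable_mx M ->
  measurable_mx N -> measurable_mx P ->
  measurable_mx (fun t => reduce w (M t) (N t) (P t)).
Proof.
move=> mM mN mP; rewrite /reduce.
apply: measurable_mx_add; last apply: measurable_mx_opp.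
  by apply: measurable_mx_add; apply: measurable_mx_scale => //; exact: measurable_form.
by apply: measurable_mx_scale => //; exact: measurable_form.
Qed.

Lemma measurable_darboux (Q : T -> 'M[C]_4) : measurable_mx Q ->
  measurable_mx (fun t => darboux w (Q t)).
Proof.
move=> mQ i j; pose q k t := row (inord k) (Q t).
have mq k : measurable_mx (q k) by exact: measurable_mx_row.
have mr k : measurable_mx (fun t => reduce w (q 0 t) (q 1 t) (q k t)).
  exact: measurable_reduce.
have mV (M N P : T -> 'rV[C]_4) : measurable_mx M -> measurable_mx N ->
    measurable_mx P -> measurable_mx (fun t => (w (M t) (N t))^-1 *: P t).
  move=> mM mN mP; apply: measurable_mx_scale => //.
  by apply: measurable_complexV; exact: measurable_form.
rewrite (_ : (fun _ => _) = fun t => (nth (q 0 t) [:: q 0 t;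
  (w (q 0 t) (q 1 t))^-1 *: q 1 t; reduce w (q 0 t) (q 1 t) (q 2 t);
  (w (reduce w (q 0 t) (q 1 t) (q 2 t)) (reduce w (q 0 t) (q 1 t) (q 3 t)))^-1 *:
   reduce w (q 0 t) (q 1 t) (q 3 t)] i) 0 j).
  case: i => -[|[|[|[|]]]] //= _; first exact: mq; last exact: mV.
    exact: mV.
  exact: mr.
by apply/funext => t; rewrite mxE.
Qed.

End MeasurableMatrix.

Lemma lt4_ind (P : nat -> nat -> Prop) : P 0%N 1%N -> P 0%N 2%N ->
  P 0%N 3%N -> P 1%N 2%N -> P 1%N 3%N -> P 2%N 3%N -> forall i j, (i < j < 4)%N -> P i j.
Proof.
move=> h01 h02 h03 h12 h13 h23 i j /andP[+ j4].
by case: j j4 => [|[|[|[|j]]]]// _; case: i => [|[|[|i]]]; rewrite ?ltnS ?ltn0.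
Qed.

Section TupleMatrix.
Variable R : realType.
Local Notation C := R[i].
Local Notation V := (4.-tuple R[i]).
Local Notation lamV := (power_measure (lamC R) 4).
Variables (w : {biscalar vecC4 R}).

Definition mx4 (y : 4.-tuple V) : 'M[C]_4 := \matrix_(i, j) tnth (tnth y i) j.
Definition rows4 (M : 'M[C]_4) : 4.-tuple V := [tuple unvec (row i M) | i < 4].

Lemma mx4K : cancel mx4 rows4.
Proof.
move=> y; apply: eq_from_tnth => i; apply: eq_from_tnth => j.
by rewrite !tnth_mktuple !mxE.
Qed.

Lemma row_mx4 y i : row i (mx4 y) = vec (tnth y i).
Proof. by apply/rowP => j; rewrite !mxE. Qed.

Lemma measurable_mx4 d (T : measurableType d) (f : T -> 4.-tuple V) :
  measurable_fun setT f -> measurable_mx (fun t => mx4 (f t)).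
Proof.
move=> mf i j; rewrite (_ : (fun _ => _) =
  (@tnth _ _ ^~ j) \o (@tnth _ _ ^~ i) \o f).
  apply: measurableT_comp mf; apply: measurableT_comp; exact: measurable_tnth.
by apply/funext => t; rewrite mxE.
Qed.

Lemma measurable_rows4 d (T : measurableType d) (M : T -> 'M[C]_4) :
  measurable_mx M -> measurable_fun setT (fun t => rows4 (M t)).
Proof.
move=> mM; apply/measurable_fun_tnthP => i; apply/measurable_fun_tnthP => j.
rewrite (_ : _ \o _ = fun t => M t i j)//.
by apply/funext => t /=; rewrite !tnth_mktuple mxE.
Qed.

Lemma measurable_vec d (T : measurableType d) (f : T -> V) :
  measurable_fun setT f -> measurable_mx (fun t => vec (f t)).
Proof.
move=> mf i j; rewrite (_ : (fun _ => _) = (@tnth _ _ ^~ j) \o f).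
  by apply: measurableT_comp mf; exact: measurable_tnth.
by apply/funext => t; rewrite mxE.
Qed.

Lemma lamV_gt0 : (0 < lamV setT)%E.
Proof. exact/power_measure_gt0/lebesgueC_gt0. Qed.

Hypothesis walt : forall u, w u u = 0.
Hypothesis wnd : forall u, (forall v, w u v = 0) -> u = 0.

(** Pairing with u is an additive surjection onto the complex numbers, where nonzero is generic. *)
Lemma ae_form_neq0 u : u != 0 -> \forall v \ae lamV, w u (vec v) != 0.
Proof.
move=> u0; pose phi (v : V) : 1.-tuple C := tcons (w u (vec v), [tuple]).
have mphi : measurable_fun setT phi.
  apply: measurable_cons; last exact: measurable_cst.
  by apply: measurable_form; [exact: measurable_mx_cst|exact: measurable_vec].
have mP : measurable [set y : 1.-tuple C | thead y != 0].
  by apply: measurable_complex_neq0; exact: (measurable_tnth ord0).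
apply: (ae_additive_surj mphi _ _ mP).1.
- move=> x y; rewrite /phi vecD linearDr addt_tcons.
  by rewrite [addt _ _]tuple0.
- move=> y; have /existsNP[v /eqP uv] : ~ forall v, w u v = 0.
    by move=> h; move: u0; rewrite (wnd h) eqxx.
  exists (unvec ((thead y / w u v) *: v)).
  rewrite /phi unvecK linearZr_LR /= mulfVK//; apply: eq_from_tnth => k.
  by rewrite (ord1 k).
- apply/(ae_consP (lamC R) mP).
  by apply: filterS (ae_neq0 R) => z z0; apply: aeW => t; rewrite theadE.
Qed.

Definition generic (y : 4.-tuple V) : Prop :=
  (forall i j, (i < j < 4)%N -> gij w (mx4 y) i j != 0) /\ darboux_good w (mx4 y).

Lemma measurable_gij d (T : measurableType d) (M : T -> 'M[C]_4) i j :
  measurable_mx M -> measurable_fun setT (fun t => gij w (M t) i j).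
Proof. by move=> mM; apply: measurable_form; exact: measurable_mx_row. Qed.

Lemma measurable_generic : measurable [set y | generic y].
Proof.
have mm : measurable_mx (fun y : 4.-tuple V => mx4 y) by exact: measurable_mx4.
have mg i j : measurable [set y | gij w (mx4 y) i j != 0].
  by apply: measurable_complex_neq0; exact: measurable_gij.
have -> : [set y | generic y] =
  [set y | gij w (mx4 y) 0 1 != 0] `&` [set y | gij w (mx4 y) 0 2 != 0] `&`
  [set y | gij w (mx4 y) 0 3 != 0] `&` [set y | gij w (mx4 y) 1 2 != 0] `&`
  [set y | gij w (mx4 y) 1 3 != 0] `&` [set y | gij w (mx4 y) 2 3 != 0] `&`
  [set y | w (reduce w (row (inord 0) (mx4 y)) (row (inord 1) (mx4 y)) (row (inord 2) (mx4 y)))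
     (reduce w (row (inord 0) (mx4 y)) (row (inord 1) (mx4 y)) (row (inord 3) (mx4 y))) != 0].
  apply/seteqP; split=> y /=.
    by move=> [h /andP[_ ?]]; do !split => //; exact: h.
  move=> [[[[[[h01 h02] h03] h12] h13] h23] h]; split; last exact/andP.
  exact: lt4_ind.
apply: measurableI; last first.
  apply: measurable_complex_neq0.
  by apply: measurable_form; apply: measurable_reduce; exact: measurable_mx_row.
by do 5 (apply: measurableI; last exact: mg); exact: mg.
Qed.

Lemma mx4_row v0 v1 v2 v3 (k : nat) : (k < 4)%N ->
  row (inord k) (mx4 (tcons (v0, tcons (v1, tcons (v2, tcons (v3, [tuple])))))) =
  vec (nth v0 [:: v0; v1; v2; v3] k).
Proof.
by move=> k4; rewrite row_mx4; congr vec; rewrite (tnth_nth v0) inordK.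
Qed.

Lemma ae_tuple4P d (T : measurableType d) (m : {sigma_finite_measure set T -> \bar R})
    (P : 4.-tuple T -> Prop) : measurable [set y | P y] ->
  (\forall y \ae power_measure m 4, P y) <->
  (\forall v0 \ae m, \forall v1 \ae m, \forall v2 \ae m, \forall v3 \ae m,
    P (tcons (v0, tcons (v1, tcons (v2, tcons (v3, [tuple])))))).
Proof.
move=> mP.
have mt n x : measurable_fun setT (fun t : n.-tuple T => @tcons _ T n (x, t)).
  by apply: measurable_cons; [exact: measurable_cst|exact: measurable_id].
have m1 x0 : measurable [set t | P (@tcons _ T 3 (x0, t))].
  exact: measurable_comp_set (mt 3 x0) mP.
have m2 x0 x1 : measurable [set t | P (@tcons _ T 3 (x0, @tcons _ T 2 (x1, t)))].
  exact: measurable_comp_set (mt 2 x1) (m1 x0).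
have m3 x0 x1 x2 : measurable
    [set t | P (@tcons _ T 3 (x0, @tcons _ T 2 (x1, @tcons _ T 1 (x2, t))))].
  exact: measurable_comp_set (mt 1 x2) (m2 x0 x1).
rewrite (ae_consP m mP).
split; apply: filterS => x0 h0.
  move: h0 => /(ae_consP m (m1 x0)); apply: filterS => x1.
  move=> /(ae_consP m (m2 x0 x1)); apply: filterS => x2.
  move=> /(ae_consP m (m3 x0 x1 x2)); apply: filterS => x3.
  exact: ae_power0E.
apply/(ae_consP m (m1 x0)); apply: filterS h0 => x1 h1.
apply/(ae_consP m (m2 x0 x1)); apply: filterS h1 => x2 h2.
apply/(ae_consP m (m3 x0 x1 x2)); apply: filterS h2 => x3 h3.
exact: ae_power0P.
Qed.

(** The vectors are drawn one after another: each condition on the next one amounts to a nonzero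
    pairing with a nonzero vector built from the previous ones. *)
Lemma ae_generic : \forall y \ae power_measure lamV 4, generic y.
Proof.
apply/ae_tuple4P; first exact: measurable_generic.
have h0 : \forall v \ae lamV, vec v != 0.
  have [u u0] : exists u : vecC4 R, u != 0.
    exists (delta_mx 0 0); apply/eqP => /matrixP/(_ 0 0)/eqP.
    by rewrite !mxE !eqxx oner_eq0.
  apply: filterS (ae_form_neq0 u0) => v; apply: contra_neq => ->.
  exact: linear0r.
apply: filterS (h0) => v0 v0_neq0.
have a0 := ae_form_neq0 v0_neq0.
apply: filterS2 (h0) (a0) => v1 v1_neq0 w01.
(* z serves to see that the third Gram-Schmidt vector is nonzero; that vector is in turn orthogonal
   to v0 and v1, so its pairing with the reduction of v3 is w01 times its pairing with v3. *)
have [z [z0 zv0 zv1]] := orthogonal_pair w (vec v0) (vec v1).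
have a1 := ae_form_neq0 v1_neq0.
have az := ae_form_neq0 z0.
apply: filterS3 (a0) (a1) (az) => v2 w02 w12 zv2.
have v2_neq0 : vec v2 != 0 by apply: contra_neq w02 => ->; exact: linear0r.
have e0 : reduce w (vec v0) (vec v1) (vec v2) != 0.
  have : w z (reduce w (vec v0) (vec v1) (vec v2)) != 0.
    by rewrite reduce_orth// mulf_neq0.
  by apply: contra_neq => ->; exact: linear0r.
have ae := ae_form_neq0 e0; have a2 := ae_form_neq0 v2_neq0.
apply: filterS2 (filterI a0 a1) (filterI a2 ae) => v3 [w03 w13] [w23 we].
split; last first.
  rewrite /darboux_good !mx4_row//= w01 /=.
  rewrite reduce_orth// ?mulf_neq0//; rewrite wN// ?reduce_orthl ?reduce_orthr// oppr0//.
by apply: lt4_ind; rewrite /gij !mx4_row.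
Qed.

End TupleMatrix.

(** * Invariant functions of four points *)

Lemma measurable_eq_set d (T : measurableType d) (R : realType)
    (f g : T -> measurableTypeR R) : measurable_fun setT f -> measurable_fun setT g ->
  measurable [set x | f x = g x].
Proof.
move=> mf mg; have mfg : measurable_fun setT (fun x => f x - g x : measurableTypeR R).
  exact: measurable_funB.
rewrite (_ : [set x | _] = (fun x => f x - g x) @^-1` [set 0]).
  by rewrite -[X in measurable X]setTI; exact: mfg.
by apply/seteqP; split=> x /= => [->|/eqP]; rewrite ?subrr// subr_eq0 => /eqP.
Qed.

Section SymplecticInvariant.
Variable R : realType.
Local Notation C := R[i].
Local Notation V := (4.-tuple R[i]).
Local Notation X := (projSpace R).
Local Notation Rm := (measurableTypeR R).
Local Notation lamV := (power_measure (lamC R) 4).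
Variables (w : {biscalar vecC4 R}).
Hypothesis walt : forall u, w u u = 0.
Hypothesis wnd : forall u, (forall v, w u v = 0) -> u = 0.

Lemma mkSp_mx H : H *m gramW w *m H^T = gramW w ->
  exists g : Sp w, forall u, g u = u *m H.
Proof.
move=> hH; pose f : 'End(vecC4 R) := linfun (mulmxr H).
have fE u : f u = u *m H by rewrite lfunE.
have f1 : lker f == 0%VS.
  apply/eqP/vspaceP => u; rewrite memv_ker memv0 fE.
  apply/eqP/eqP => [uH|->]; last by rewrite mul0mx.
  by rewrite -[u](mulmxK (symplectic_unit wnd hH)) uH mul0mx.
have f2 u v : w (f u) (f v) = w u v by rewrite !fE w_mulmx.
by exists (MkSp f1 f2).
Qed.

Variable a : 4.-tuple X -> R.

Definition alphaM (M : 'M[C]_4) : R := a (tmap (@pt R \o @vec R) (rows4 M)).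

Lemma vec_rows4 (M : 'M[C]_4) i : vec (tnth (rows4 M) i) = row i M.
Proof. by rewrite tnth_mktuple unvecK. Qed.

Lemma rows4K (M : 'M[C]_4) : mx4 (rows4 M) = M.
Proof. by apply/row_matrixP => k; rewrite row_mx4 vec_rows4. Qed.

Lemma tnth_pt_rows4 (M : 'M[C]_4) i :
  tnth (tmap (@pt R \o @vec R) (rows4 M)) i = pt (row i M).
Proof. by rewrite tnth_map -[LHS]/(pt (vec (tnth (rows4 M) i))) vec_rows4. Qed.

Lemma alphaM_mx4 y : alphaM (mx4 y) = a (tmap (@pt R \o @vec R) y).
Proof. by rewrite /alphaM mx4K. Qed.

Lemma alphaM_row M N : (forall i, exists2 l, l != 0 & row i M = l *: row i N) ->
  alphaM M = alphaM N.
Proof.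
move=> h; congr a; apply: eq_from_tnth => i; rewrite !tnth_pt_rows4.
by have [l l0 ->] := h i; rewrite ptZ.
Qed.

Lemma measurable_alphaM d (T : measurableType d) (M : T -> 'M[C]_4) :
  measurable_fun setT (a : _ -> Rm) -> measurable_mx M ->
  measurable_fun setT (fun t => alphaM (M t) : Rm).
Proof.
move=> ma mM; apply: (measurableT_comp ma).
apply: (measurableT_comp (measurable_map_tuple (@measurable_pt R))).
exact: measurable_rows4.
Qed.

Lemma generic_row_neq0 y i : generic w y -> vec (tnth y i) != 0.
Proof.
move=> [_ /(darboux_good_unit walt) uy]; rewrite -row_mx4 rowE; apply/eqP => h.
have := mulmxK uy (delta_mx 0 i : 'rV_4); rewrite h mul0mx => /matrixP/(_ 0 i)/eqP.
by rewrite !mxE !eqxx eq_sym oner_eq0.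
Qed.

Variable mu : probability X R.
Hypothesis smu : smooth_class mu.

Lemma ae_lift n (P : n.-tuple X -> Prop) : (\forall x \ae power_measure mu n, P x) ->
  (\forall y \ae power_measure lamV n, P (tmap (@pt R \o @vec R) y)).
Proof.
move=> [N [mN N0 PN]].
have mNC : measurable [set x | ~ N x] by exact: measurableC.
have : \forall x \ae power_measure mu n, ~ N x.
  by exists N; split => // x /=; exact: contrapT.
move/(power_smooth_class_ae smu mNC); apply: filterS => y Ny.
by apply: contrapT => /PN.
Qed.

Hypothesis ma : measurable_fun setT (a : _ -> Rm).
Hypothesis ainv : Defs.invariant mu (@Sp_act R w) a.

Lemma ae_alphaM_mulmx H : H *m gramW w *m H^T = gramW w ->
  \forall y \ae power_measure lamV 4, alphaM (mx4 y *m H) = alphaM (mx4 y).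
Proof.
move=> hH; have [g gE] := mkSp_mx hH.
have := ae_lift (ainv g); apply: filterS2 (ae_generic walt wnd) => y gy /(_ I) e.
rewrite alphaM_mx4 -e; congr a; apply: eq_from_tnth => i.
rewrite tnth_pt_rows4 row_mul row_mx4 -gE !tnth_map /= Sp_act_pt//.
exact: generic_row_neq0.
Qed.

(** [q] serves as a measurable parameter for elements of the group: it gives the symplectic matrix
    taking the Darboux basis of [q] to [D0]. *)
Let invF (D0 : 'M[C]_4) (q y : 4.-tuple V) :=
  alphaM (mx4 y *m frame_to w D0 (mx4 q)) = alphaM (mx4 y).

Lemma measurable_frame_to d (T : measurableType d) D0 (Q : T -> 'M[C]_4) :
  measurable_mx Q -> measurable_mx (fun t => frame_to w D0 (Q t)).
Proof.
move=> mQ; apply: measurable_mx_mul; last exact: measurable_mx_cst.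
apply: measurable_mx_mul; last exact: measurable_mx_cst.
apply: measurable_mx_mul; first exact: measurable_mx_cst.
by apply: measurable_mx_tr; exact: measurable_darboux.
Qed.

Let measurable_invF D0 : measurable [set p : 4.-tuple V * 4.-tuple V | invF D0 p.1 p.2].
Proof.
apply: measurable_eq_set; apply: measurable_alphaM => //.
  apply: measurable_mx_mul; first exact: measurable_mx4.
  by apply: measurable_frame_to; exact: measurable_mx4.
exact: measurable_mx4.
Qed.

Lemma ae_mulmx H (P : 4.-tuple V -> Prop) : H \in unitmx -> measurable [set y | P y] ->
  (\forall y \ae power_measure lamV 4, P y) ->
  (\forall y \ae power_measure lamV 4, P (rows4 (mx4 y *m H))).
Proof.
move=> uH mP; pose phi (v : V) : V := unvec (vec v *m H).
have mphi : measurable_fun setT phi.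
  apply/measurable_fun_tnthP => j.
  rewrite (_ : _ \o _ = fun v => (vec v *m H) 0 j); last first.
    by apply/funext => v /=; rewrite tnth_mktuple.
  apply: measurable_mx_mul; last exact: measurable_mx_cst.
  by apply: measurable_vec; exact: measurable_id.
have phiS Q : measurable [set y | Q y] ->
    (\forall y \ae lamV, Q y) <-> (\forall x \ae lamV, Q (phi x)).
  move=> mQ; apply: ae_additive_surj => //.
    move=> x y; apply: (can_inj (@vecK R)).
    by rewrite vecD !unvecK vecD mulmxDl.
  move=> y; exists (unvec (vec y *m invmx H)).
  by rewrite /phi unvecK mulmxKV// vecK.
move/(ae_power_map mphi phiS mP); apply: filterS => y.
rewrite (_ : tmap _ _ = rows4 (mx4 y *m H))//.
apply: eq_from_tnth => i; rewrite tnth_map /phi tnth_mktuple.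
by rewrite row_mul row_mx4.
Qed.

(** For each group element invariance holds off a null set depending on it, and [a] cannot be
    evaluated on the normal forms [S y], which lie in a null set. Let K_q be the symplectic matrix
    attached to a random [q]. Fubini gives a(y K_q) = a(y) for almost all y and q, and for fixed y
    equivariance turns this into a(S(y) K_q) = a(y) for almost every q. A second use of Fubini fixes
    one [q] for almost all y, and [F] is [a] on normal forms moved by K_q. *)
Lemma cross_ratio_factor : exists F : C -> C -> C -> R,
  [/\ measurable_fun setT (fun p : C * C * C => F p.1.1 p.1.2 p.2 : Rm),
    (forall k a b c, k != 0 -> F (k * a) (k * b) (k * c) = F a b c) &
    \forall y \ae power_measure lamV 4, alphaM (mx4 y) =
      F (gij w (mx4 y) 0 1 * gij w (mx4 y) 2 3) (gij w (mx4 y) 0 2 * gij w (mx4 y) 1 3)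
        (gij w (mx4 y) 0 3 * gij w (mx4 y) 1 2)].
Proof.
have gt0 : (0 < power_measure lamV 4 setT)%E by apply: power_measure_gt0; exact: lamV_gt0.
have [q0 [_ gq0]] := ae_ex gt0 (ae_generic walt wnd).
pose D0 := darboux w (mx4 q0).
have hD0 : D0 *m gramW w *m D0^T = stdJ _ by exact: darboux_gram.
have h1 : \forall q \ae power_measure lamV 4, \forall y \ae power_measure lamV 4, invF D0 q y.
  apply: filterS (ae_generic walt wnd) => q [_ gq].
  by apply: ae_alphaM_mulmx; exact: frame_to_symplectic.
have h2 := ae_swap (@measurable_invF D0) h1.
pose S (y : 4.-tuple V) := cross_ratio_frame D0
  (gij w (mx4 y) 0 1 * gij w (mx4 y) 2 3) (gij w (mx4 y) 0 2 * gij w (mx4 y) 1 3)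
        (gij w (mx4 y) 0 3 * gij w (mx4 y) 1 2).
have mframe d (T : measurableType d) (f g h : T -> C) : measurable_fun setT f ->
    measurable_fun setT g -> measurable_fun setT h ->
    measurable_mx (fun t => cross_ratio_frame D0 (f t) (g t) (h t)).
  move=> mf mg mh; apply: measurable_mx_mul; last exact: measurable_mx_cst.
  move=> i j; rewrite (_ : (fun _ => _) = nth (cst 0) (nth [::] [::
    [:: cst 1; cst 0; cst 0; cst 0]; [:: h; f; h; cst 0];
    [:: h; g; cst 0; fun t => h t - g t + f t]; [:: cst 0; cst 1; cst 0; cst 0]] i) j).
    case: i j => -[|[|[|[|]]]] // ? [] [|[|[|[|]]]] // ? /=;
      try by [exact: measurable_cst|exact: mf|exact: mg|exact: mh].
    by apply: measurable_complexD => //; exact: measurable_complexB.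
  apply/funext => t; rewrite mxE.
  by case: i j => -[|[|[|[|]]]] // ? [] [|[|[|[|]]]].
have mS d (T : measurableType d) (f : T -> 4.-tuple V) : measurable_fun setT f ->
    measurable_mx (fun t => S (f t)).
  move=> mf; have mm := measurable_mx4 mf.
  by apply: mframe; apply: measurable_complexM; exact: measurable_gij.
have h3 : \forall y \ae power_measure lamV 4, \forall q \ae power_measure lamV 4,
    alphaM (S y *m frame_to w D0 (mx4 q)) = alphaM (mx4 y).
  apply: filterS2 (ae_generic walt wnd) (h2) => y [gy1 gy2] hy.
  have uy := darboux_good_unit walt gy2.
  have hm := sqr_sqrtc (gij w (mx4 y) 1 2 / (gij w (mx4 y) 1 3 * gij w (mx4 y) 2 3)).
  have [H [hH hrow]] := similar_cross_ratio_frame walt hD0 uy gy1 hm.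
  have hHi := symplectic_inv wnd hH.
  have uHi := symplectic_unit wnd hHi.
  have mP : measurable [set q | invF D0 q y].
    apply: (measurable_comp_set (f := fun q => (q, y)) _ (@measurable_invF D0)).
    exact/measurable_fun_pair.
  move: hy => /(ae_mulmx uHi mP); apply: filterS => q; rewrite /invF => <-.
  apply: alphaM_row => i; have [l l0 hl] := hrow i; exists l; first exact: l0.
  (* Replacing q by q H^-1 turns K_q into H K_q, so y is first brought to its normal form by H. *)
  have fq : frame_to w D0 (mx4 (rows4 (mx4 q *m invmx H))) = H *m frame_to w D0 (mx4 q).
    have := frame_to_mulmx D0 (mx4 q) hHi; rewrite rows4K => <-.
    by rewrite (mulKVmx (symplectic_unit wnd hH)).
  rewrite fq; move: (frame_to w D0 (mx4 q)) (hl : row i (S y) = _) => K {}hl.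
  move: (S y) hl => Z hl; move: (mx4 y) hl => Y hl.
  by rewrite mulmxA !(row_mul i _ K) hl -scalemxAl.
have mE : measurable [set p : 4.-tuple V * 4.-tuple V |
    alphaM (S p.1 *m frame_to w D0 (mx4 p.2)) = alphaM (mx4 p.1)].
  apply: measurable_eq_set; apply: measurable_alphaM => //.
    apply: measurable_mx_mul; first exact: mS.
    by apply: measurable_frame_to; exact: measurable_mx4.
  exact: measurable_mx4.
(* One [q] that is good for almost every y. *)
have [q hq] := ae_ex gt0 (ae_swap (P := fun y q =>
   alphaM (S y *m frame_to w D0 (mx4 q)) = alphaM (mx4 y)) mE h3).
exists (fun x y z => alphaM (cross_ratio_frame D0 x y z *m frame_to w D0 (mx4 q))); split.
- apply: measurable_alphaM => //; apply: measurable_mx_mul; last exact: measurable_mx_cst.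
  apply: mframe; last exact: measurable_snd.
    exact: (measurableT_comp (f := fst) measurable_fst measurable_fst).
  exact: (measurableT_comp (f := snd) measurable_snd measurable_fst).
- move=> k x y z k0; apply: alphaM_row => i.
  case: (cross_ratio_frameZ D0 x y z i k0) => l l0.
  move: (cross_ratio_frame D0 x y z) (cross_ratio_frame D0 (k * x) (k * y) (k * z)).
  move: (frame_to w D0 (mx4 q)) => K Z Z' hl; exists l; first exact: l0.
  by rewrite !(row_mul i _ K) hl -scalemxAl.
- by apply: filterS hq => y ->.
Qed.

End SymplecticInvariant.

(** * The five-term relation *)

Section IteratedAE.
Context d (T : measurableType d) (R : realType).
Variable m : {sigma_finite_measure set T -> \bar R}.

Lemma ae_tuple3W (P : 3.-tuple T -> Prop) :
  (\forall y \ae power_measure m 3, P y) ->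
  (\forall v0 \ae m, \forall v1 \ae m, \forall v2 \ae m,
    P (tcons (v0, tcons (v1, tcons (v2, [tuple]))))).
Proof.
move/ae_consW; apply: filterS => x0 /ae_consW; apply: filterS => x1 /ae_consW.
by apply: filterS => x2 /ae_power0E.
Qed.

Lemma ae_tuple4W (P : 4.-tuple T -> Prop) :
  (\forall y \ae power_measure m 4, P y) ->
  (\forall v0 \ae m, \forall v1 \ae m, \forall v2 \ae m, \forall v3 \ae m,
    P (tcons (v0, tcons (v1, tcons (v2, tcons (v3, [tuple])))))).
Proof.
move/ae_consW; apply: filterS => x0 h.
exact: (ae_tuple3W (P := fun y => P (tcons (x0, y)))).
Qed.

Lemma ae_tuple5W (P : 5.-tuple T -> Prop) :
  (\forall y \ae power_measure m 5, P y) ->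
  (\forall v0 \ae m, \forall v1 \ae m, \forall v2 \ae m, \forall v3 \ae m,
   \forall v4 \ae m,
    P (tcons (v0, tcons (v1, tcons (v2, tcons (v3, tcons (v4, [tuple]))))))).
Proof.
move/ae_consW; apply: filterS => x0 h.
exact: (ae_tuple4W (P := fun y => P (tcons (x0, y)))).
Qed.

End IteratedAE.

Section FiveTerm.
Variable R : realType.
Local Notation C := R[i].
Local Notation V := (4.-tuple R[i]).
Local Notation X := (projSpace R).
Local Notation Rm := (measurableTypeR R).
Local Notation lamV := (power_measure (lamC R) 4).

(* the alternating sum of [F] over the cross ratios of the faces of a 5-point
   configuration with pairings [w01, ..., r = w34] *)
Definition five_term (F : C -> C -> C -> R) (w01 w02 w12 s0 s1 s2 t0 t1 t2 r : C) : R :=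
  F (w12 * r) (s1 * t2) (t1 * s2) - F (w02 * r) (s0 * t2) (t0 * s2)
  + F (w01 * r) (s0 * t1) (t0 * s1) - F (w01 * t2) (w02 * t1) (t0 * w12)
  + F (w01 * s2) (w02 * s1) (s0 * w12).

Variable F : C -> C -> C -> R.
Hypothesis mF : measurable_fun setT (fun p : C * C * C => F p.1.1 p.1.2 p.2 : Rm).
Hypothesis FZ : forall k a b c, k != 0 -> F (k * a) (k * b) (k * c) = F a b c.

Lemma measurable_F3 d (T : measurableType d) (f g h : T -> C) :
  measurable_fun setT f -> measurable_fun setT g -> measurable_fun setT h ->
  measurable_fun setT (fun x => F (f x) (g x) (h x) : Rm).
Proof.
move=> mf mg mh; apply: (measurableT_comp mF (g := fun x => (f x, g x, h x))).
by do !apply/measurable_fun_pair => //.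
Qed.

Lemma measurable_five_term d (T : measurableType d)
    (w01 w02 w12 s0 s1 s2 t0 t1 t2 r : T -> C) :
  measurable_fun setT w01 -> measurable_fun setT w02 -> measurable_fun setT w12 ->
  measurable_fun setT s0 -> measurable_fun setT s1 -> measurable_fun setT s2 ->
  measurable_fun setT t0 -> measurable_fun setT t1 -> measurable_fun setT t2 ->
  measurable_fun setT r ->
  measurable_fun setT (fun x => five_term F (w01 x) (w02 x) (w12 x) (s0 x) (s1 x) (s2 x)
    (t0 x) (t1 x) (t2 x) (r x) : Rm).
Proof.
move=> *; rewrite /five_term.
apply: measurable_funD; last by apply: measurable_F3; exact: measurable_complexM.
apply: measurable_funB; last by apply: measurable_F3; exact: measurable_complexM.
apply: measurable_funD; last by apply: measurable_F3; exact: measurable_complexM.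
by apply: measurable_funB; apply: measurable_F3; exact: measurable_complexM.
Qed.

Lemma measurable_norm_le d (T : measurableType d) (f : T -> Rm) (M : R) :
  measurable_fun setT f -> measurable [set x | `|f x| <= M].
Proof.
move=> mf; rewrite (_ : [set x | _] = f @^-1` `[- M, M]).
  by rewrite -[X in measurable X]setTI; apply: mf => //; exact: measurable_itv.
by apply/seteqP; split=> x /=; rewrite in_itv/= ler_norml.
Qed.

(** Other representatives of the first three points multiply the three arguments of each term by a
    common factor. *)
Lemma five_termZ l0 l1 l2 w01 w02 w12 s0 s1 s2 t0 t1 t2 r :
  l0 != 0 -> l1 != 0 -> l2 != 0 ->
  five_term F (l0 * l1 * w01) (l0 * l2 * w02) (l1 * l2 * w12) (l0 * s0) (l1 * s1)
    (l2 * s2) (l0 * t0) (l1 * t1) (l2 * t2) r =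
  five_term F w01 w02 w12 s0 s1 s2 t0 t1 t2 r.
Proof.
move=> n0 n1 n2; rewrite /five_term.
rewrite -(FZ (w12 * r) (s1 * t2) (t1 * s2) (k := l1 * l2)) ?mulf_neq0//.
rewrite -(FZ (w02 * r) (s0 * t2) (t0 * s2) (k := l0 * l2)) ?mulf_neq0//.
rewrite -(FZ (w01 * r) (s0 * t1) (t0 * s1) (k := l0 * l1)) ?mulf_neq0//.
rewrite -(FZ (w01 * t2) (w02 * t1) (t0 * w12) (k := l0 * l1 * l2)) ?mulf_neq0//.
rewrite -(FZ (w01 * s2) (w02 * s1) (s0 * w12) (k := l0 * l1 * l2)) ?mulf_neq0//.
by congr (F _ _ _ - F _ _ _ + F _ _ _ - F _ _ _ + F _ _ _); ring.
Qed.

Lemma ae_diag n (l : 'I_n -> C) (P : n.-tuple C -> Prop) : (forall i, l i != 0) ->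
  measurable [set t | P t] -> (\forall t \ae power_measure (lamC R) n, P t) ->
  \forall t \ae power_measure (lamC R) n, P [tuple l i * tnth t i | i < n].
Proof.
move=> l0 mP.
apply: (ae_additive_surj (phi := fun t => [tuple l i * tnth t i | i < n]) _ _ _ mP).1.
- apply/measurable_fun_tnthP => i; rewrite (_ : _ \o _ = fun t => l i * tnth t i).
    by apply: measurable_complexM => //; exact: measurable_tnth.
  by apply/funext => t; rewrite /= tnth_mktuple.
- by move=> x y; apply: eq_from_tnth => i; rewrite !(tnth_addt, tnth_mktuple) mulrDr.
- move=> y; exists [tuple (l i)^-1 * tnth y i | i < n]; apply: eq_from_tnth => i.
  by rewrite !tnth_mktuple mulrA divff// mul1r.
Qed.

Variable (w : {biscalar vecC4 R}).
Hypothesis walt : forall u, w u u = 0.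
Hypothesis wnd : forall u, (forall v, w u v = 0) -> u = 0.

(** The pairings of a random vector with k members of a basis are k independent generic numbers: the
    pairing map is additive and onto. *)
Lemma ae_pairing k (f : 'I_k -> 'I_4) (Y : 'M[C]_4) (P : k.-tuple C -> Prop) :
  injective f -> Y \in unitmx -> measurable [set t | P t] ->
  (\forall t \ae power_measure (lamC R) k, P t) <->
  (\forall v \ae lamV, P [tuple w (row (f i) Y) (vec v) | i < k]).
Proof.
move=> finj uY mP.
apply: (ae_additive_surj (phi := fun v => [tuple w (row (f i) Y) (vec v) | i < k])) mP.
- apply/measurable_fun_tnthP => i; rewrite (_ : _ \o _ = fun v => w (row (f i) Y) (vec v)).
    apply: measurable_form; first exact: measurable_mx_cst.
    by apply: measurable_vec; exact: measurable_id.
  by apply/funext => t; rewrite /= tnth_mktuple.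
- move=> x y; apply: eq_from_tnth => i; rewrite tnth_addt !tnth_mktuple vecD.
  by rewrite linearDr.
(* Prescribed pairings at the chosen members of the basis, zero with the others. *)
- move=> y; pose z : 'rV[C]_4 :=
    \row_j (if [pick i | f i == j] is Some i then tnth y i else 0).
  have uYW : Y *m gramW w \in unitmx by rewrite unitmx_mul uY gramW_unit.
  exists (unvec (invmx (Y *m gramW w) *m z^T)^T); apply: eq_from_tnth => i.
  rewrite tnth_mktuple unvecK -[X in w _ X](row_id 0) -gramWE trmxK mulKVmx//.
  rewrite !mxE; case: pickP => [i' /eqP/finj -> //|/(_ i)].
  by rewrite eqxx.
Qed.

Variable M : R.

(** Three fixed generic vectors have particular pairings u01, u02, u12. Rescaling representatives
    takes these to any nonzero values, so the relation holds for all w01, w02, w12 and only the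
    other seven pairings are generic. This is the form that the cone requires. *)
Lemma five_term_ae :
  (\forall v0 \ae lamV, \forall v1 \ae lamV, \forall v2 \ae lamV, \forall v3 \ae lamV,
    \forall v4 \ae lamV,
   `|five_term F (w (vec v0) (vec v1)) (w (vec v0) (vec v2)) (w (vec v1) (vec v2))
      (w (vec v0) (vec v3)) (w (vec v1) (vec v3)) (w (vec v2) (vec v3))
      (w (vec v0) (vec v4)) (w (vec v1) (vec v4)) (w (vec v2) (vec v4))
      (w (vec v3) (vec v4))| <= M) ->
  forall w01 w02 w12, w01 != 0 -> w02 != 0 -> w12 != 0 ->
  \forall s0 \ae lamC R, \forall s1 \ae lamC R, \forall s2 \ae lamC R,
  \forall t0 \ae lamC R, \forall t1 \ae lamC R, \forall t2 \ae lamC R,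
  \forall r \ae lamC R, `|five_term F w01 w02 w12 s0 s1 s2 t0 t1 t2 r| <= M.
Proof.
move=> h.
have hg := ae_tuple4W (ae_generic walt wnd).
have [v0 [{}h {}hg]] := ae_ex (lamV_gt0 R) (filterI h hg).
have [v1 [{}h {}hg]] := ae_ex (lamV_gt0 R) (filterI h hg).
have [v2 [{}h {}hg]] := ae_ex (lamV_gt0 R) (filterI h hg).
pose Y v3 := mx4 (tcons (v0, tcons (v1, tcons (v2, tcons (v3, [tuple])))) : 4.-tuple V).
pose u01 := w (vec v0) (vec v1); pose u02 := w (vec v0) (vec v2).
pose u12 := w (vec v1) (vec v2).
have [v3' gv3'] := ae_ex (lamV_gt0 R) hg.
have uY v3 : generic w (tcons (v0, tcons (v1, tcons (v2, tcons (v3, [tuple]))))) ->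
   Y v3 \in unitmx.
  by move=> [_ /(darboux_good_unit walt)].
have [n01 n02 n12] : [/\ u01 != 0, u02 != 0 & u12 != 0].
  have [gg _] := gv3'.
  have := gg 0%N 1%N erefl; have := gg 0%N 2%N erefl; have := gg 1%N 2%N erefl.
  by rewrite /gij !mx4_row.
pose Q a b c (p : 3.-tuple C * 4.-tuple C) := `|five_term F a b c
  (tnth p.1 0) (tnth p.1 1) (tnth p.1 2%:R) (tnth p.2 0) (tnth p.2 1) (tnth p.2 2%:R)
  (tnth p.2 3%:R)| <= M.
have m1 i : measurable_fun setT (fun p : 3.-tuple C * 4.-tuple C => tnth p.1 i).
  by apply: (measurableT_comp (f := @tnth _ _ ^~ i)) => //; exact: measurable_tnth.
have m2 i : measurable_fun setT (fun p : 3.-tuple C * 4.-tuple C => tnth p.2 i).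
  by apply: (measurableT_comp (f := @tnth _ _ ^~ i)) => //; exact: measurable_tnth.
have mQ a b c : measurable [set p | Q a b c p].
  apply: measurable_norm_le; apply: measurable_five_term; try exact: measurable_cst.
  - exact: m1.
  - exact: m1.
  - exact: m1.
  - exact: m2.
  - exact: m2.
  - exact: m2.
  - exact: m2.
have h1 : \forall s \ae power_measure (lamC R) 3,
    \forall t \ae power_measure (lamC R) 4, Q u01 u02 u12 (s, t).
  (* [v3'] only completes v0, v1, v2 to a basis; the pairings of a random v3 use the first three
     rows. Then v0, ..., v3 is itself a basis, which makes the four pairings of v4 generic. *)
  have wi : injective (widen_ord (isT : (3 <= 4)%N)).
    by move=> i j /(congr1 val) /= ij; exact: val_inj.
  apply/(ae_pairing (f := widen_ord (isT : (3 <= 4)%N)) wi (uY _ gv3')).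
    exact: (measurable_ae (power_measure (lamC R) 4) (mQ u01 u02 u12)).
  apply: filterS2 h hg => v3 hv3 /uY uY3.
  apply/(ae_pairing (f := id) _ uY3) => //.
    apply: (measurable_comp_set (f := fun t => (_, t)) _ (mQ u01 u02 u12)).
    exact/measurable_fun_pair.
  apply: filterS hv3 => v4; rewrite /Q /=.
  rewrite !tnth_mktuple !row_mx4.
  exact.
move=> w01 w02 w12 m01 m02 m12.
(* The equations l_i l_j w_ij = u_ij determine l0^2, and then l1 and l2. *)
have := sqr_sqrtc (u01 / w01 * (u02 / w02) / (u12 / w12)).
set l0 := sqrtc _ => l0E.
have l0_neq0 : l0 != 0.
  have : l0 ^+ 2 != 0 by rewrite l0E !mulf_neq0 ?invr_eq0// mulf_neq0 ?invr_eq0.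
  by rewrite expf_eq0.
pose l1 := u01 / w01 / l0; pose l2 := u02 / w02 / l0.
have l1_neq0 : l1 != 0 by rewrite !mulf_neq0 ?invr_eq0.
have l2_neq0 : l2 != 0 by rewrite !mulf_neq0 ?invr_eq0.
have e01 : l0 * l1 * w01 = u01 by rewrite /l1; field; rewrite l0_neq0.
have e02 : l0 * l2 * w02 = u02 by rewrite /l2; field; rewrite l0_neq0.
have e12 : l1 * l2 * w12 = u12.
  have -> : l1 * l2 = u01 / w01 * (u02 / w02) / l0 ^+ 2.
    by rewrite /l1 /l2; field; rewrite ?l0_neq0 ?m01 ?m02.
  by rewrite l0E; field; rewrite ?m12 ?n12 ?n01 ?n02 ?m01 ?m02.
have h2 : \forall s \ae power_measure (lamC R) 3,
    \forall t \ae power_measure (lamC R) 4, Q w01 w02 w12 (s, t).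
  have ln3 (i : 'I_3) : nth 1 [:: l0; l1; l2] i != 0 by case: i => -[|[|[|]]].
  have ln4 (i : 'I_4) : nth 1 [:: l0; l1; l2; 1] i != 0.
    by case: i => -[|[|[|[|]]]] //=; rewrite oner_eq0.
  have mh := measurable_ae (power_measure (lamC R) 4) (mQ u01 u02 u12).
  move: h1 => /(ae_diag ln3 mh); apply: filterS => s h1.
  have mQs s' : measurable [set t | Q u01 u02 u12 (s', t)].
    apply: (measurable_comp_set (f := fun t => (s', t)) _ (mQ u01 u02 u12)).
    exact/measurable_fun_pair.
  move: h1 => /(ae_diag ln4 (mQs _)); apply: filterS => t.
  rewrite /Q /= !tnth_mktuple /=.
  rewrite mul1r => h1.
  by rewrite -(five_termZ w01 w02 w12 _ _ _ _ _ _ _ l0_neq0 l1_neq0 l2_neq0) e01 e02 e12.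
move: h2 => /ae_tuple3W; apply: filterS => s0; apply: filterS => s1.
apply: filterS => s2 /ae_tuple4W; apply: filterS => t0; apply: filterS => t1.
by apply: filterS => t2; apply: filterS => r.
Qed.

End FiveTerm.

(** * The cone construction *)

Section ConeCochain.
Variable R : realType.
Local Notation C := R[i].
Local Notation lam := (lamC R).

Lemma ae_mulW l (P : C -> Prop) : l != 0 ->
  (\forall z \ae lam, P z) -> \forall z \ae lam, P (l * z).
Proof.
move=> l0 [N [mN N0 PN]].
have mNC : measurable [set x | ~ N x] by exact: measurableC.
have mNC1 : measurable [set x : 1.-tuple C | ~ N (thead x)].
  by apply: (measurable_comp_set _ mNC); exact: (measurable_tnth ord0).
have mNC2 : measurable [set x : 1.-tuple C | ~ N (thead (scalet l x))].
  exact: (measurable_comp_set (@measurable_scalet R 1 l) mNC1).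
have h : \forall x \ae lam, ~ N x.
  by exists N; split => // x /=; exact: contrapT.
have {}h : \forall t \ae power_measure lam 1, ~ N (thead t).
  apply/(ae_consP lam mNC1); apply: filterS h => x Nx.
  by apply: ae_power0P; rewrite theadE.
have {}h := (ae_scalet l0 mNC1).1 h.
have := (ae_consP lam mNC2).1 h; apply: filterS => x /ae_power0E.
by rewrite /thead tnth_scalet => Nx; apply: contrapT => /PN.
Qed.

Variable F : C -> C -> C -> R.
Hypothesis FZ : forall k a b c, k != 0 -> F (k * a) (k * b) (k * c) = F a b c.

Definition cell (wij wik wjk si sj sk : C) : R := F (wij * sk) (wik * sj) (si * wjk).

(* alternating sum over the faces containing the new point of the cone over a
   4-point configuration, [s_i] being the pairings with the new point *)
Definition cone (w01 w02 w03 w12 w13 w23 s0 s1 s2 s3 : C) : R :=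
  cell w12 w13 w23 s1 s2 s3 - cell w02 w03 w23 s0 s2 s3 + cell w01 w03 w13 s0 s1 s3
  - cell w01 w02 w12 s0 s1 s2.

Lemma cone_scale l0 l1 l2 l3 w01 w02 w03 w12 w13 w23 s0 s1 s2 s3 :
  l0 != 0 -> l1 != 0 -> l2 != 0 -> l3 != 0 ->
  cone (l0 * l1 * w01) (l0 * l2 * w02) (l0 * l3 * w03) (l1 * l2 * w12) (l1 * l3 * w13)
    (l2 * l3 * w23) (l0 * s0) (l1 * s1) (l2 * s2) (l3 * s3) =
  cone w01 w02 w03 w12 w13 w23 s0 s1 s2 s3.
Proof.
have cellZ k0 k1 k2 x01 x02 x12 z0 z1 z2 : k0 != 0 -> k1 != 0 -> k2 != 0 ->
   cell (k0 * k1 * x01) (k0 * k2 * x02) (k1 * k2 * x12) (k0 * z0) (k1 * z1) (k2 * z2) =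
   cell x01 x02 x12 z0 z1 z2.
  move=> n0 n1 n2; rewrite /cell -(FZ (x01 * z2) (x02 * z1) (z0 * x12)
    (k := k0 * k1 * k2)) ?mulf_neq0//.
  by congr F; ring.
by move=> n0 n1 n2 n3; rewrite /cone !cellZ.
Qed.

Variable M : R.
Hypothesis five_ae : forall w01 w02 w12, w01 != 0 -> w02 != 0 -> w12 != 0 ->
  \forall s0 \ae lam, \forall s1 \ae lam, \forall s2 \ae lam,
  \forall t0 \ae lam, \forall t1 \ae lam, \forall t2 \ae lam,
  \forall r \ae lam, `|five_term F w01 w02 w12 s0 s1 s2 t0 t1 t2 r| <= M.

Lemma ler_norm4 (x y z t u : R) : `|x| <= M -> `|y| <= M -> `|z| <= M -> `|t| <= M ->
  u = x - y + z - t -> `|u| <= 4 * M.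
Proof.
move=> + + + + ->; rewrite !ler_norml.
by do 4! case/andP => ? ?; apply/andP; split; lra.
Qed.

(** Two new points with pairings s and t: the five-term relations on each of the four triangles
    together with both points sum to the difference of the cones, as the terms involving r cancel in
    pairs. A common r exists because each relation holds for almost every r. *)
Lemma cone_stable w01 w02 w03 w12 w13 w23 :
  w01 != 0 -> w02 != 0 -> w03 != 0 -> w12 != 0 -> w13 != 0 -> w23 != 0 ->
  \forall s0 \ae lam, \forall s1 \ae lam, \forall s2 \ae lam, \forall s3 \ae lam,
  \forall t0 \ae lam, \forall t1 \ae lam, \forall t2 \ae lam, \forall t3 \ae lam,
  `|cone w01 w02 w03 w12 w13 w23 s0 s1 s2 s3 - cone w01 w02 w03 w12 w13 w23 t0 t1 t2 t3|
    <= 4 * M.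
Proof.
move=> n01 n02 n03 n12 n13 n23.
have h123 := five_ae n12 n13 n23; have h023 := five_ae n02 n03 n23.
have h013 := five_ae n01 n03 n13; have h012 := five_ae n01 n02 n12.
apply: filterS3 h012 h013 h023 => s0 h012 h013 h023.
apply: filterS3 h012 h013 h123 => s1 h012 h013 h123.
apply: filterS3 h012 h023 h123 => s2 h012 h023 h123.
apply: filterS3 h013 h023 h123 => s3 h013 h023 h123.
apply: filterS3 h012 h013 h023 => t0 h012 h013 h023.
apply: filterS3 h012 h013 h123 => t1 h012 h013 h123.
apply: filterS3 h012 h023 h123 => t2 h012 h023 h123.
apply: filterS3 h013 h023 h123 => t3 h013 h023 h123.
have [r [[r012 r013] [r023 r123]]] :=
  ae_ex (lebesgueC_gt0 R) (filterI (filterI h012 h013) (filterI h023 h123)).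
apply: (ler_norm4 r123 r023 r013 r012); rewrite /cone /cell /five_term; ring.
Qed.

(** The sign comes from the coboundary, where the face opposite to the new point has sign +: it is
    minus the cone that approximates [F]. *)
Definition cone_value x w01 w02 w03 w12 w13 w23 :=
  \forall s0 \ae lam, \forall s1 \ae lam, \forall s2 \ae lam, \forall s3 \ae lam,
  `|x + cone w01 w02 w03 w12 w13 w23 s0 s1 s2 s3| <= 4 * M.

(** Any one good quadruple s provides a value. The choice is made separately for each set of
    pairings, so measurability of [Phi] is not asserted; [cone_value] is the only access to it. *)
Lemma cone_value_ex : exists Phi : C -> C -> C -> C -> C -> C -> R,
  forall w01 w02 w03 w12 w13 w23,
  w01 != 0 -> w02 != 0 -> w03 != 0 -> w12 != 0 -> w13 != 0 -> w23 != 0 ->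
  cone_value (Phi w01 w02 w03 w12 w13 w23) w01 w02 w03 w12 w13 w23.
Proof.
have h (p : C * C * C * (C * C * C)) : exists x,
    p.1.1.1 != 0 -> p.1.1.2 != 0 -> p.1.2 != 0 ->
    p.2.1.1 != 0 -> p.2.1.2 != 0 -> p.2.2 != 0 ->
    cone_value x p.1.1.1 p.1.1.2 p.1.2 p.2.1.1 p.2.1.2 p.2.2.
  case: p => -[[w01 w02] w03] [[w12 w13] w23] /=.
  have [[]|] := pselect [/\ w01 != 0, w02 != 0, w03 != 0 & [/\ w12 != 0, w13 != 0 & w23 != 0]];
    last by move=> h; exists 0 => ? ? ? ? ? ?; exfalso; exact: h.
  move=> n01 n02 n03 [n12 n13 n23].
  have g := lebesgueC_gt0 R.
  have [s0 h0] := ae_ex g (cone_stable n01 n02 n03 n12 n13 n23).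
  have [s1 h1] := ae_ex g h0; have [s2 h2] := ae_ex g h1; have [s3 h3] := ae_ex g h2.
  exists (- cone w01 w02 w03 w12 w13 w23 s0 s1 s2 s3) => _ _ _ _ _ _.
  apply: filterS h3 => t0; apply: filterS => t1; apply: filterS => t2.
  by apply: filterS => t3; rewrite -normrN opprD opprK.
have [Phi PhiP] := choice h.
exists (fun w01 w02 w03 w12 w13 w23 => Phi (w01, w02, w03, (w12, w13, w23))).
by move=> w01 w02 w03 w12 w13 w23; exact: (PhiP (w01, w02, w03, (w12, w13, w23))).
Qed.

Variable Phi : C -> C -> C -> C -> C -> C -> R.
Hypothesis PhiP : forall w01 w02 w03 w12 w13 w23,
  w01 != 0 -> w02 != 0 -> w03 != 0 -> w12 != 0 -> w13 != 0 -> w23 != 0 ->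
  cone_value (Phi w01 w02 w03 w12 w13 w23) w01 w02 w03 w12 w13 w23.

(** The cone is exactly invariant when the new pairings are scaled too, so it suffices to find s
    with both s and (l_i s_i) good; each comparison costs 4M. *)
Lemma Phi_scale l0 l1 l2 l3 w01 w02 w03 w12 w13 w23 :
  l0 != 0 -> l1 != 0 -> l2 != 0 -> l3 != 0 ->
  w01 != 0 -> w02 != 0 -> w03 != 0 -> w12 != 0 -> w13 != 0 -> w23 != 0 ->
  `|Phi (l0 * l1 * w01) (l0 * l2 * w02) (l0 * l3 * w03) (l1 * l2 * w12) (l1 * l3 * w13)
    (l2 * l3 * w23) - Phi w01 w02 w03 w12 w13 w23| <= 8 * M.
Proof.
move=> n0 n1 n2 n3 n01 n02 n03 n12 n13 n23; have g := lebesgueC_gt0 R.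
have h := PhiP n01 n02 n03 n12 n13 n23.
have := @PhiP (l0 * l1 * w01) (l0 * l2 * w02) (l0 * l3 * w03) (l1 * l2 * w12)
  (l1 * l3 * w13) (l2 * l3 * w23).
rewrite !mulf_neq0// => /(_ isT isT isT isT isT isT) h'.
have [s0 [{}h {}h']] := ae_ex g (filterI h (ae_mulW n0 h')).
have [s1 [{}h {}h']] := ae_ex g (filterI h (ae_mulW n1 h')).
have [s2 [{}h {}h']] := ae_ex g (filterI h (ae_mulW n2 h')).
have [s3 []] := ae_ex g (filterI h (ae_mulW n3 h')).
rewrite cone_scale// !ler_norml.
by do 2! case/andP => ? ?; apply/andP; split; lra.
Qed.

(** With one new point good for all five faces, every cell occurs twice with opposite signs, so the
    cones cancel exactly and five errors of 4M remain. *)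
Lemma Phi_five w01 w02 w03 w04 w12 w13 w14 w23 w24 w34 :
  w01 != 0 -> w02 != 0 -> w03 != 0 -> w04 != 0 -> w12 != 0 -> w13 != 0 -> w14 != 0 ->
  w23 != 0 -> w24 != 0 -> w34 != 0 ->
  `|Phi w12 w13 w14 w23 w24 w34 - Phi w02 w03 w04 w23 w24 w34
    + Phi w01 w03 w04 w13 w14 w34 - Phi w01 w02 w04 w12 w14 w24
    + Phi w01 w02 w03 w12 w13 w23| <= 20 * M.
Proof.
move=> n01 n02 n03 n04 n12 n13 n14 n23 n24 n34; have g := lebesgueC_gt0 R.
have h0 := PhiP n12 n13 n14 n23 n24 n34; have h1 := PhiP n02 n03 n04 n23 n24 n34.
have h2 := PhiP n01 n03 n04 n13 n14 n34; have h3 := PhiP n01 n02 n04 n12 n14 n24.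
have h4 := PhiP n01 n02 n03 n12 n13 n23.
have [s0 [[{}h1 {}h2] [{}h3 {}h4]]] := ae_ex g (filterI (filterI h1 h2) (filterI h3 h4)).
have [s1 [[{}h0 {}h2] [{}h3 {}h4]]] := ae_ex g (filterI (filterI h0 h2) (filterI h3 h4)).
have [s2 [[{}h0 {}h1] [{}h3 {}h4]]] := ae_ex g (filterI (filterI h0 h1) (filterI h3 h4)).
have [s3 [[{}h0 {}h1] [{}h2 {}h4]]] := ae_ex g (filterI (filterI h0 h1) (filterI h2 h4)).
have [s4 [[{}h0 {}h1] [{}h2 {}h3]]] := ae_ex g (filterI (filterI h0 h1) (filterI h2 h3)).
move: h0 h1 h2 h3 h4; rewrite /cone !ler_norml.
by do 5! case/andP => ? ?; apply/andP; split; lra.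
Qed.

(** Representatives normalized so that the last vector has pairing 1 with the other three. *)
Definition gauge a b c : R := Phi a b 1 c 1 1.

Lemma Phi_gauge w01 w02 w03 w12 w13 w23 :
  w01 != 0 -> w02 != 0 -> w03 != 0 -> w12 != 0 -> w13 != 0 -> w23 != 0 ->
  `|gauge (w01 * w23) (w02 * w13) (w03 * w12) - Phi w01 w02 w03 w12 w13 w23| <= 8 * M.
Proof.
move=> n01 n02 n03 n12 n13 n23.
(* The scalings 1/(m w_i3) and m normalize the pairings with the last vector; this m^2 turns
   w01/(m^2 w03 w13) into w01 w23, and likewise for 02 and 12. *)
have := sqr_sqrtc (w03 * w13 * w23)^-1; set m := sqrtc _ => mE.
have m0 : m != 0.
  have : m ^+ 2 != 0 by rewrite mE invr_neq0// !mulf_neq0.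
  by rewrite expf_eq0.
have m2 : w03 * w13 * w23 = (m ^+ 2)^-1 by rewrite mE invrK.
have := @Phi_scale (m * w03)^-1 (m * w13)^-1 (m * w23)^-1 m w01 w02 w03 w12 w13 w23.
rewrite !invr_neq0 ?mulf_neq0// => /(_ isT isT isT m0 n01 n02 n03 n12 n13 n23).
rewrite /gauge; congr (`|Phi _ _ _ _ _ _ - _| <= _).
- have -> : w01 * w23 = (w03 * w13 * w23) / (w03 * w13) * w01.
    by field; rewrite n03 n13.
  by rewrite m2; field; rewrite ?m0 ?n03 ?n13.
- have -> : w02 * w13 = (w03 * w13 * w23) / (w03 * w23) * w02.
    by field; rewrite ?n03 ?n23.
  by rewrite m2; field; rewrite ?m0 ?n03 ?n23.
- by field; rewrite ?m0 ?n03.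
- have -> : w03 * w12 = (w03 * w13 * w23) / (w13 * w23) * w12.
    by field; rewrite ?n13 ?n23.
  by rewrite m2; field; rewrite ?m0 ?n13 ?n23.
- by field; rewrite ?m0 ?n13.
- by field; rewrite ?m0 ?n23.
Qed.

Lemma gauge_scale k a b c : k != 0 -> a != 0 -> b != 0 -> c != 0 ->
  `|gauge (k * a) (k * b) (k * c) - gauge a b c| <= 8 * M.
Proof.
move=> k0 a0 b0 c0; have := sqr_sqrtc k; set m := sqrtc _ => mE.
have m0 : m != 0 by have : m ^+ 2 != 0; [rewrite mE|rewrite expf_eq0].
have := @Phi_scale m m m m^-1 a b 1 c 1 1.
rewrite m0 invr_neq0// a0 b0 c0 oner_eq0 => /(_ isT isT isT isT isT isT isT isT isT isT).
by rewrite mulr1 divff// -expr2 mE.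
Qed.

(** The five-term relation with all pairings with the last point equal to 1: four faces are already
    in normalized form, and the fifth costs 8M besides the 20M. *)
Lemma gauge_five u01 u02 u03 u12 u13 u23 :
  u01 != 0 -> u02 != 0 -> u03 != 0 -> u12 != 0 -> u13 != 0 -> u23 != 0 ->
  `|gauge (u01 * u23) (u02 * u13) (u03 * u12) - gauge u01 u02 u12 + gauge u01 u03 u13
    - gauge u02 u03 u23 + gauge u12 u13 u23| <= 28 * M.
Proof.
move=> n01 n02 n03 n12 n13 n23; have o := oner_neq0 C.
have := Phi_gauge n01 n02 n03 n12 n13 n23.
have := Phi_five n01 n02 n03 o n12 n13 o n23 o o.
rewrite /gauge !ler_norml.
by do 2! case/andP => ? ?; apply/andP; split; lra.
Qed.

End ConeCochain.

(** * Measurable additive functions of a real variable *)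

Section MeasurableHom.
Variable R : realType.
Local Notation Rm := (measurableTypeR R).

(** The difference h(t) - t h(1) is additive and vanishes at 1/4, so it has period 1/4; being
    bounded on one period, it is bounded everywhere and hence zero. *)
Lemma additive_local_linear (h : R -> R) (K : R) : {morph h : a b / a + b} ->
  (forall t, 0 <= t <= 4^-1 -> `|h t| <= K) -> forall t, h t = t * h 1.
Proof.
move=> hD hK; pose k t := h t - t * h 1.
have kD : {morph k : a b / a + b} by move=> a b; rewrite /k hD; ring.
have k4 : k 4^-1 = 0.
  have := additive_natmul kD 4^-1 4; rewrite -[4^-1 *+ 4]mulr_natl divff// /k mul1r subrr.
  by lra.
have kK t : 0 <= t <= 4^-1 -> `|k t| <= K + `|h 1|.
  move=> /[dup] ht /hK hht; rewrite /k (le_trans (ler_normB _ _))// lerD// normrM.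
  rewrite ler_piMl//; case/andP: ht => t0 t1; rewrite ger0_norm//; lra.
have kN t : k (- t) = - k t.
  by have := kD t (- t); rewrite subrr; have := kD 0 0; rewrite addr0; lra.
have kall t : 0 <= t -> `|k t| <= K + `|h 1|.
  move=> t0; have := truncn_itv (x := t * 4).
  rewrite mulr_ge0// => /(_ isT); set n := Num.truncn _ => /andP[n1 n2].
  have -> : t = (t - n%:R * 4^-1) + 4^-1 *+ n by rewrite -[4^-1 *+ n]mulr_natl; ring.
  rewrite kD (additive_natmul kD) k4 mulr0 addr0; apply: kK.
  have {}n2 : t * 4 < n%:R + 1 by rewrite natr1.
  by apply/andP; split; lra.
have kz := additive_bounded_eq0 kD (M := K + `|h 1|).
move=> t; apply/eqP; rewrite -subr_eq0; apply/eqP/kz => x.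
have [|x0] := leP 0 x; first exact: kall.
by rewrite -normrN -kN kall// oppr_ge0 ltW.
Qed.

Definition unit_sublevel (g : Rm -> Rm) (N : set Rm) (n : nat) : set Rm :=
  [set t | [/\ 0 <= t <= 1, ~ N t & `|g t| <= n%:R]].

Lemma measurable_unit_sublevel g N n : measurable_fun setT g -> measurable N ->
  measurable (unit_sublevel g N n).
Proof.
move=> mg mN.
rewrite (_ : _ N n = ((`[0, 1]%classic : set Rm) `&` ~` N) `&` [set t | `|g t| <= n%:R]).
  apply: measurableI; last exact: measurable_norm_le.
  by apply: measurableI; [exact: measurable_itv|exact: measurableC].
by apply/seteqP; split=> t /=; rewrite /unit_sublevel in_itv/=;
  [move=> [? ? ?]|move=> [[? ?] ?]].
Qed.

(** Continuity from below allows any threshold less than 1. The value 5/8 is half the length of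
    [-1/4, 1], where the set and its translate by at most 1/4 both lie. *)
Lemma large_sublevel (g : Rm -> Rm) (N : set Rm) : measurable_fun setT g ->
  measurable N -> leb R N = 0%E ->
  exists n : nat, ((5 / 8)%:E < leb R (unit_sublevel g N n))%E.
Proof.
move=> mg mN N0; pose E := unit_sublevel g N.
have mI : measurable ((`[0%R, 1%R]%classic : set Rm) `&` ~` N).
  by apply: measurableI; [exact: measurable_itv|exact: measurableC].
have mE n : measurable (E n) by exact: measurable_unit_sublevel.
have ndE : nondecreasing_seq E.
  move=> m n mn; apply/subsetPset => t [? ? h]; split => //.
  by rewrite (le_trans h)// ler_nat.
have UE : \bigcup_n E n = (`[0%R, 1%R]%classic : set Rm) `&` ~` N.
  apply/seteqP; split=> t.
    by move=> [n _] [t01 Nt _]; split => //; rewrite /= in_itv.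
  rewrite /= in_itv => -[t01 Nt]; exists (Num.bound `|g t|) => //; split => //.
  by rewrite ltW// archi_boundP.
have cvE := nondecreasing_cvg_mu (mu := leb R) mE (bigcup_measurable (fun n _ => mE n)) ndE.
have l1 : leb R (`[0%R, 1%R]%classic : set Rm) = 1%E.
  by apply: (etrans (lebesgue_measure_itv `[0%R, 1%R])); rewrite /= lte_fin ltr01 sube0.
have leUE : (1 <= leb R (\bigcup_n E n))%E.
  rewrite UE -l1.
  apply: le_trans (_ : leb R (((`[0%R, 1%R]%classic : set Rm) `&` ~` N) `|` N) <= _)%E.
    apply: le_measure; rewrite ?inE; [exact: measurable_itv|exact: measurableU|].
    by move=> t tI; have [Nt|Nt] := pselect (N t); [right|left].
  have := measureU2 (leb R) mI mN.
  by rewrite [X in (_ + X)%E](N0 : leb R N = _) adde0.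
apply: contrapT => /forallNP h.
have : (leb R (\bigcup_n E n) <= (5 / 8)%:E)%E.
  rewrite -(cvg_lim _ cvE)//; apply: lime_le; first by apply/cvg_ex; eexists; exact: cvE.
  by apply: nearW => n; rewrite leNgt; apply/negP; exact: h.
move/(le_trans leUE); rewrite lee_fin; lra.
Qed.

(** Steinhaus' argument: a large set on which h is bounded meets its translates by small t, and h(t)
    = h(x + t) - h(x) for x in both. *)
Lemma near_measurable_additive_linear (h : R -> R) (g : Rm -> Rm) (K : R) :
  {morph h : a b / a + b} -> measurable_fun setT g ->
  (\forall t \ae leb R, `|h t - g t| <= K) -> forall t, h t = t * h 1.
Proof.
move=> hD mg [N [mN N0 hN]].
have hgN t : ~ N t -> `|h t - g t| <= K by move=> Nt; apply: contrapT => /hN.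
have [n hn] := large_sublevel mg mN N0.
apply: (additive_local_linear (K := 2 * (n%:R + K)) hD) => t /andP[t0 t4].
pose E := unit_sublevel g N n; pose E' : set Rm := rtranslate t @^-1` E.
have mE : measurable E by exact: measurable_unit_sublevel.
have mE' : measurable E'.
  by rewrite /E' -[X in measurable X]setTI; apply: measurable_rtranslate.
have hE s : E s -> `|h s| <= n%:R + K.
  move=> [_ /hgN]; rewrite !ler_norml.
  by do 2! case/andP => ? ?; apply/andP; split; lra.
have [[x [xE xE']]|EE'] := pselect (exists x, E x /\ E' x).
  have := hE _ xE; have := hE _ xE'; rewrite /rtranslate hD !ler_norml.
  by do 2! case/andP => ? ?; apply/andP; split; lra.
exfalso.
have disj : [disjoint E & E'].
  by apply/disj_setPS => x [xE xE']; apply: EE'; exists x.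
have : (leb R (E `|` E') <= (5 / 4)%:E)%E.
  have l1 : leb R (`[(- 4^-1)%R, 1%R]%classic : set Rm) = (5 / 4)%:E.
    apply: (etrans (lebesgue_measure_itv `[(- 4^-1)%R, 1%R])); rewrite /= lte_fin.
    rewrite ifT; last by lra.
    by rewrite -EFinB; congr EFin; lra.
  rewrite -l1; apply: le_measure; rewrite ?inE; [exact: measurableU|exact: measurable_itv|].
  move=> x [[/andP[? ?] _ _]|[/andP[]]]; rewrite /= in_itv /rtranslate /=; first lra.
  by move=> ? ? _ _; apply/andP; split; lra.
rewrite measureU//; last exact/disj_set2P.
rewrite [X in (_ + X)%E](lebesgue_measure_translate t mE : leb R E' = _).
apply/negP; rewrite -ltNge.
have -> : (5 / 4)%:E = ((5 / 8)%:E + (5 / 8)%:E :> \bar R)%E.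
  by rewrite -EFinD; congr EFin; lra.
by apply: lteD.
Qed.

(** The exceptional set of s depends on t, and Fubini cannot exchange the quantifiers directly
    because h is not known to be measurable. The set [D] compares two values of g instead; it is
    measurable and yields one s' for almost all t, at distance K + 2K. *)
Lemma near_measurable_family_linear d (T : measurableType d)
    (m : {sigma_finite_measure set T -> \bar R}) (h : R -> R) (g : Rm * T -> Rm) (K : R) :
  (0 < m setT)%E -> {morph h : a b / a + b} -> measurable_fun setT g ->
  (forall t, \forall s \ae m, `|h t - g (t, s)| <= K) -> forall t, h t = t * h 1.
Proof.
move=> m0 hD mg hg.
have mD : measurable [set p : (Rm * T) * T | `|g p.1 - g (p.1.1, p.2)| <= 2 * K].
  apply: measurable_norm_le; apply: measurable_funB.
    exact: (measurableT_comp mg measurable_fst).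
  apply: (measurableT_comp mg (g := fun p : (Rm * T) * T => (p.1.1, p.2))).
  apply/measurable_fun_pair => //.
  exact: (measurableT_comp (f := fst) measurable_fst measurable_fst).
pose D (x : Rm * T) := \forall s \ae m, `|g x - g (x.1, s)| <= 2 * K.
have mDD : measurable [set p | D (p.1, p.2)].
  rewrite (_ : [set p | _] = [set p | D p]); first exact: (measurable_ae m mD).
  by apply/seteqP; split=> -[].
have h1 : \forall t \ae leb R, \forall s' \ae m, D (t, s').
  apply: aeW => t; apply: filterS (hg t) => s' hs'; apply: filterS (hg t) => s.
  move: hs'; rewrite !ler_norml.
  by do 2! case/andP => ? ?; apply/andP; split; lra.
have [s' hs'] := ae_ex m0 (ae_swap (P := fun t s' => D (t, s')) mDD h1).
apply: (near_measurable_additive_linear (g := fun t => g (t, s')) (K := 3 * K) hD).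
  by apply: (measurableT_comp mg (g := fun t => (t, s'))); exact/measurable_fun_pair.
apply: (@filterS _ _ (ae_filter_ringOfSetsType (leb R)) _ _ _ hs') => t hD'.
have [s []] := ae_ex m0 (filterI (hg t) hD').
rewrite !ler_norml.
by do 2! case/andP => ? ?; apply/andP; split; lra.
Qed.

End MeasurableHom.

(** * Boundedness of the cone *)

Section ComplexExponential.
Variable R : realType.
Local Notation C := R[i].
Local Notation Rm := (measurableTypeR R).

(** The complex exponential as a homomorphism from the additive group R^2; its inverse images are
    the logarithmic coordinates. *)
Definition expC (a : R * R) : C := Complex (expR a.1 * cos a.2) (expR a.1 * sin a.2).

Lemma expCD a b : expC (a + b) = expC a * expC b.
Proof.
rewrite /expC /= expRD cosD sinD; apply/eqP; rewrite eq_complex /=.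
by apply/andP; split; apply/eqP; ring.
Qed.

Lemma expC0 : expC 0 = 1.
Proof. by rewrite /expC /= expR0 cos0 sin0 mulr1 mulr0. Qed.

Lemma expC_neq0 a : expC a != 0.
Proof.
have : expC a * expC (- a) != 0 by rewrite -expCD subrr expC0 oner_neq0.
by apply: contra_neq => ->; rewrite mul0r.
Qed.

Lemma expC_surj z : z != 0 -> exists a, expC a = z.
Proof.
case: z => x y z0; pose r := Num.sqrt (x ^+ 2 + y ^+ 2).
have xy_ge0 : 0 <= x ^+ 2 + y ^+ 2 by rewrite addr_ge0// sqr_ge0.
have r2 : r ^+ 2 = x ^+ 2 + y ^+ 2 by rewrite sqr_sqrtr.
have r0 : 0 < r.
  rewrite sqrtr_gt0 lt_def xy_ge0 andbT; apply: contra z0.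
  by rewrite paddr_eq0 ?sqr_ge0// !sqrf_eq0 => /andP[/eqP -> /eqP ->].
have rn0 : r != 0 by rewrite gt_eqF.
pose u := x / r; have u2 : 1 - u ^+ 2 = (y / r) ^+ 2.
  rewrite /u !expr_div_n r2; field; rewrite -r2 expf_neq0//.
have u1 : -1 <= u <= 1.
  have : 0 <= 1 - u ^+ 2 by rewrite u2 sqr_ge0.
  by move=> ?; apply/andP; split; nra.
have sa : sin (acos u) = `|y| / r.
  by rewrite sin_acos// u2 sqrtr_sqr normrM normfV (ger0_norm (ltW r0)).
pose th := if 0 <= y then acos u else - acos u.
exists (ln r, th); rewrite /expC /= lnK ?posrE//.
have -> : cos th = u by rewrite /th; case: ifP; rewrite ?cosN acosK.
have -> : sin th = y / r.
  rewrite /th; case: ifPn => [y0|]; first by rewrite sa ger0_norm.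
  by rewrite -ltNge => y0; rewrite sinN sa ltr0_norm// mulNr opprK.
by rewrite /u; congr Complex; field.
Qed.

Lemma measurable_expC_l : measurable_fun setT (fun t : Rm => expC (t, 0)).
Proof.
apply: measurable_complex; apply: measurable_funM => //=; exact: measurable_expR.
Qed.

Lemma measurable_expC_r : measurable_fun setT (fun t : Rm => expC (0, t)).
Proof.
apply: measurable_complex; apply: measurable_funM => //=.
  by apply: continuous_measurable_fun; exact: continuous_cos.
by apply: continuous_measurable_fun; exact: continuous_sin.
Qed.

Lemma expC_period (n : nat) : expC (0, pi *+ 2 *+ n) = 1.
Proof.
have e1 : expC (0, pi *+ 2) = 1 by rewrite /expC /= expR0 cos2pi sin2pi !mul1r.
elim: n => [|n ih]; first by rewrite mulr0n expC0.
have -> : (0, pi *+ 2 *+ n.+1) = (0, pi *+ 2) + (0, pi *+ 2 *+ n) :> R * R.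
  by rewrite mulrS; congr pair; rewrite /= addr0.
by rewrite expCD e1 ih mulr1.
Qed.

End ComplexExponential.

Section ConeBounded.
Variable R : realType.
Local Notation C := R[i].
Local Notation Rm := (measurableTypeR R).
Local Notation lam := (lamC R).
Variable F : C -> C -> C -> R.
Hypothesis mF : measurable_fun setT (fun p : C * C * C => F p.1.1 p.1.2 p.2 : Rm).
Hypothesis FZ : forall k a b c, k != 0 -> F (k * a) (k * b) (k * c) = F a b c.

Lemma measurable_cone d (T : measurableType d)
    (w01 w02 w03 w12 w13 w23 s0 s1 s2 s3 : T -> C) :
  measurable_fun setT w01 -> measurable_fun setT w02 -> measurable_fun setT w03 ->
  measurable_fun setT w12 -> measurable_fun setT w13 -> measurable_fun setT w23 ->
  measurable_fun setT s0 -> measurable_fun setT s1 -> measurable_fun setT s2 ->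
  measurable_fun setT s3 ->
  measurable_fun setT (fun x => cone F (w01 x) (w02 x) (w03 x) (w12 x) (w13 x) (w23 x)
    (s0 x) (s1 x) (s2 x) (s3 x) : Rm).
Proof.
move=> *; rewrite /cone /cell.
apply: measurable_funB; last by apply: measurable_F3 => //; exact: measurable_complexM.
apply: measurable_funD; last by apply: measurable_F3 => //; exact: measurable_complexM.
by apply: measurable_funB; apply: measurable_F3 => //; exact: measurable_complexM.
Qed.

Variable M : R.
Hypothesis five_ae : forall w01 w02 w12, w01 != 0 -> w02 != 0 -> w12 != 0 ->
  \forall s0 \ae lam, \forall s1 \ae lam, \forall s2 \ae lam,
  \forall t0 \ae lam, \forall t1 \ae lam, \forall t2 \ae lam,
  \forall r \ae lam, `|five_term F w01 w02 w12 s0 s1 s2 t0 t1 t2 r| <= M.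

Lemma cone_tuple_ae w01 w02 w03 w12 w13 w23 x K :
  (\forall s0 \ae lam, \forall s1 \ae lam, \forall s2 \ae lam, \forall s3 \ae lam,
   `|x + cone F w01 w02 w03 w12 w13 w23 s0 s1 s2 s3| <= K) ->
  \forall s \ae power_measure lam 4, `|x + cone F w01 w02 w03 w12 w13 w23
    (tnth s 0) (tnth s 1) (tnth s 2%:R) (tnth s 3%:R)| <= K.
Proof.
move=> h; apply/(ae_tuple4P lam) => //.
apply: measurable_norm_le; apply: measurable_funD; first exact: measurable_cst.
by apply: measurable_cone; try exact: measurable_cst; exact: measurable_tnth.
Qed.

Lemma cone_bounded : exists K, forall w01 w02 w03 w12 w13 w23,
  w01 != 0 -> w02 != 0 -> w03 != 0 -> w12 != 0 -> w13 != 0 -> w23 != 0 ->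
  \forall s0 \ae lam, \forall s1 \ae lam, \forall s2 \ae lam, \forall s3 \ae lam,
  `|cone F w01 w02 w03 w12 w13 w23 s0 s1 s2 s3| <= K.
Proof.
have [Phi PhiP] := cone_value_ex five_ae.
pose f := gauge Phi; pose e := @expC R; have e_neq0 a : e a != 0 := expC_neq0 a.
(* Nonnegativity serves to weaken the 8M of [gauge_scale] to the common constant 28M. *)
have M0 : 0 <= M.
  have o := oner_neq0 C; have g := lebesgueC_gt0 R.
  have := five_ae o o o; do 7 (move/(ae_ex g) => [?]); exact: le_trans.
pose G (a b c : R * R) := f (e a) (e b) (e c).
have GE u01 u02 u03 u12 u13 u23 :
    `|G (u01 + u23) (u02 + u13) (u03 + u12) - G u01 u02 u12 + G u01 u03 u13
      - G u02 u03 u23 + G u12 u13 u23| <= 28 * M.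
  by rewrite /G /e !expCD; apply: (gauge_five FZ PhiP); exact: expC_neq0.
have GI t a b c : `|G (a + t) (b + t) (c + t) - G a b c| <= 28 * M.
  have := gauge_scale FZ PhiP (e_neq0 t) (e_neq0 a) (e_neq0 b) (e_neq0 c).
  rewrite /G /e !expCD -/e !(mulrC _ (e t)); move/le_trans; apply; lra.
have [B [K [Badd Banti BG2 BG3]]] := near_cross_ratio_cocycle GE GI.
have BaddR c : {morph B c : a b / a + b}.
  by move=> a b; rewrite Banti Badd opprD -!Banti.
(* [B (gam t) b] is within K of [G (gam t) b 0], a value of [Phi], and this is within 4M of [g] for
   almost every new point; [g] is jointly measurable in t and the new point. *)
have near (gam : R -> R * R) b : {morph gam : x y / x + y} ->
    measurable_fun setT (fun t : Rm => e (gam t)) ->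
    forall t, B (gam t) b = t * B (gam 1) b.
  move=> gD mgam.
  have g4 : (0 < power_measure lam 4 setT)%E by exact/power_measure_gt0/lebesgueC_gt0.
  have mt i : measurable_fun setT (fun p : Rm * 4.-tuple C => tnth p.2 i).
    by apply: (measurableT_comp (f := @tnth _ _ ^~ i)) => //; exact: measurable_tnth.
  pose g (p : Rm * 4.-tuple C) : Rm := - cone F (e (gam p.1)) (e b) 1 1 1 1
    (tnth p.2 0) (tnth p.2 1) (tnth p.2 2%:R) (tnth p.2 3%:R).
  apply: (near_measurable_family_linear (h := fun t => B (gam t) b) (g := g)
    (K := K + 4 * M) g4).
  - by move=> x y; rewrite gD Badd.
  - apply: measurableT_comp => //; apply: measurable_cone; try exact: measurable_cst.
    + exact: (measurableT_comp mgam measurable_fst).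
    + exact: mt.
    + exact: mt.
    + exact: mt.
    + exact: mt.
  - move=> t; have o := oner_neq0 C.
    have := cone_tuple_ae (PhiP _ _ _ _ _ _ (e_neq0 (gam t)) (e_neq0 b) o o o o).
    apply: filterS => s; have := BG2 (gam t) b; rewrite /G /f /gauge /e expC0 -/e /g /=.
    rewrite !ler_norml.
    by do 2! case/andP => ? ?; apply/andP; split; lra.
have Bl b t : B (t, 0) b = t * B (1, 0) b.
  apply: (near (fun t => (t, 0)) b _ (@measurable_expC_l R)) => x y.
  by congr pair; rewrite /= addr0.
have Br b t : B (0, t) b = t * B (0, 1) b.
  apply: (near (fun t => (0, t)) b _ (@measurable_expC_r R)) => x y.
  by congr pair; rewrite /= addr0.
(* Linearity in the argument contradicts the period 2 pi of [G], up to a bounded error, unless the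
   slope is zero. *)
have Br0 b : B (0, 1) b = 0.
  have bd (n : nat) : n%:R * `|B (0, pi *+ 2) b| <= K + `|G 0 b 0|.
    have := BG2 (0, pi *+ 2 *+ n) b.
    have -> : G (0, pi *+ 2 *+ n) b 0 = G 0 b 0 by rewrite /G /e expC_period expC0.
    have -> : B (0, pi *+ 2 *+ n) b = n%:R * B (0, pi *+ 2) b.
      by rewrite Br [in RHS]Br -[pi *+ 2 *+ n]mulr_natl; ring.
    move=> h; rewrite -[leLHS]ger0_norm ?mulr_ge0// normrM normr_id -normrM.
    move: h (ler_norm (G 0 b 0)) (ler_norm (- G 0 b 0)); rewrite normrN !ler_norml.
    by case/andP => ? ? ? ?; apply/andP; split; lra.
  have p0 : B (0, pi *+ 2) b = 0.
    apply: (@eq0_halving _ _ (K + `|G 0 b 0|)) => n.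
    rewrite ler_pdivlMr ?exprn_gt0// mulrC -natrX; exact: bd.
  move: p0; rewrite Br => /eqP; rewrite mulf_eq0 => /orP[|/eqP//].
  by rewrite mulrn_eq0 /= gt_eqF// pi_gt0.
have B0 a b : B a b = 0.
  have split (x : R * R) : x = (x.1, 0) + (0, x.2).
    by case: x => x y; congr pair; rewrite /= ?addr0 ?add0r.
  rewrite [a]split Badd (Br _ a.2) Br0 mulr0 addr0 Bl Banti [b]split Badd.
  rewrite (Br _ b.2) Br0 mulr0 addr0 Bl.
  have : B (1, 0) (1, 0) = 0 by have := Banti (1, 0) (1, 0); lra.
  by move=> ->; rewrite mulr0 oppr0 mulr0.
have fK a b c : a != 0 -> b != 0 -> c != 0 -> `|f a b c| <= K.
  move=> /expC_surj[a' <-] /expC_surj[b' <-] /expC_surj[c' <-].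
  by have := BG3 a' b' c'; rewrite !B0 subrr addr0 subr0.
(* K bounds [gauge], 8M compares it with [Phi], and 4M compares [Phi] with minus the cone. *)
exists (K + 12 * M) => w01 w02 w03 w12 w13 w23 n01 n02 n03 n12 n13 n23.
have := Phi_gauge FZ PhiP n01 n02 n03 n12 n13 n23.
have := fK _ _ _ (mulf_neq0 n01 n23) (mulf_neq0 n02 n13) (mulf_neq0 n03 n12).
rewrite -/f => h1 h2.
have := PhiP _ _ _ _ _ _ n01 n02 n03 n12 n13 n23.
apply: filterS => s0; apply: filterS => s1; apply: filterS => s2; apply: filterS => s3.
move: h1 h2; rewrite !ler_norml.
by do 3! case/andP => ? ?; apply/andP; split; lra.
Qed.

End ConeBounded.

(** * The comparison map *)

Section Linfinity.
Context d (T : measurableType d) (R : realType).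
Variable m : {measure set T -> \bar R}.
Hypothesis m0 : (0 < m setT)%E.

Lemma Lfun_oo_bounded (f : T -> R) : f \in Lfun m +oo%E ->
  exists M, \forall x \ae m, `|f x| <= M.
Proof.
move=> /andP[_]; rewrite inE /= /finite_norm unlock /Lnorm m0 => foo.
exact: ess_supr_bounded foo.
Qed.

Lemma bounded_Lfun_oo (f : T -> R) M : f \in mfun ->
  (\forall x \ae m, `|f x| <= M) -> f \in Lfun m +oo%E.
Proof.
move=> mf fM; apply/andP; split => //.
rewrite inE /= /finite_norm unlock /Lnorm m0.
apply: le_lt_trans (ltry M); apply/ess_supP.
by apply: filterS fM => x; rewrite /= lee_fin.
Qed.

End Linfinity.

Section Codiff5.
Context d (X : measurableType d) (R : realType).

Lemma codiff4E (a : 4.-tuple X -> R) x0 x1 x2 x3 x4 :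
  codiff a (tcons (x0, tcons (x1, tcons (x2, tcons (x3, tcons (x4, [tuple])))))) =
  a (tcons (x1, tcons (x2, tcons (x3, tcons (x4, [tuple])))))
  - a (tcons (x0, tcons (x2, tcons (x3, tcons (x4, [tuple])))))
  + a (tcons (x0, tcons (x1, tcons (x3, tcons (x4, [tuple])))))
  - a (tcons (x0, tcons (x1, tcons (x2, tcons (x4, [tuple])))))
  + a (tcons (x0, tcons (x1, tcons (x2, tcons (x3, [tuple]))))).
Proof.
pose s := [:: x0; x1; x2; x3; x4].
have fE (i : 'I_5) :
    face i (tcons (x0, tcons (x1, tcons (x2, tcons (x3, tcons (x4, [tuple])))))) =
    tcons (nth x0 s (bump i 0), tcons (nth x0 s (bump i 1), tcons (nth x0 s (bump i 2),
      tcons (nth x0 s (bump i 3), [tuple])))).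
  apply: eq_from_tnth => j; rewrite !tnth_mktuple !(tnth_nth x0).
  by case: j => -[|[|[|[|]]]].
rewrite /codiff !big_ord_recl big_ord0 !fE /bump /= addr0 !expr1 ?expr0; ring.
Qed.

End Codiff5.

Section BoundedCodiff.
Variable R : realType.
Local Notation C := R[i].
Local Notation V := (4.-tuple R[i]).
Local Notation X := (projSpace R).
Local Notation Rm := (measurableTypeR R).
Local Notation lamV := (power_measure (lamC R) 4).
Variables (w : {biscalar vecC4 R}) (mu : probability X R).
Hypothesis walt : forall u, w u u = 0.
Hypothesis wnd : forall u, (forall v, w u v = 0) -> u = 0.
Hypothesis smu : smooth_class mu.

(** At five generic points the hypothesis is used twice: read through [F] alone it is the five-term
    relation that bounds the cone, and read as [a] plus the cone it then bounds [a]. *)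
Lemma bounded_of_bounded_codiff (a : 4.-tuple X -> R) (M : R) :
  measurable_fun setT (a : _ -> Rm) -> Defs.invariant mu (@Sp_act R w) a ->
  (\forall x \ae power_measure mu 5, `|codiff a x| <= M) ->
  exists K, \forall x \ae power_measure mu 4, `|a x| <= K.
Proof.
move=> ma ainv hM.
have [F [mF FZ hF]] := cross_ratio_factor walt wnd smu ma ainv.
pose om v v' := w (vec v) (vec v').
pose A v0 v1 v2 v3 := a (tmap (@pt R \o @vec R)
  (tcons (v0, tcons (v1, tcons (v2, tcons (v3, [tuple])))))).
pose E v0 v1 v2 v3 := A v0 v1 v2 v3 =
  F (om v0 v1 * om v2 v3) (om v0 v2 * om v1 v3) (om v0 v3 * om v1 v2).
have H4 : \forall v0 \ae lamV, \forall v1 \ae lamV, \forall v2 \ae lamV,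
    \forall v3 \ae lamV, E v0 v1 v2 v3.
  move: hF => /ae_tuple4W; apply: filterS => v0; apply: filterS => v1.
  apply: filterS => v2; apply: filterS => v3; rewrite /E /A -alphaM_mx4 => ->.
  by rewrite /gij !mx4_row.
have H5 : \forall v0 \ae lamV, \forall v1 \ae lamV, \forall v2 \ae lamV,
    \forall v3 \ae lamV, \forall v4 \ae lamV,
    `|A v1 v2 v3 v4 - A v0 v2 v3 v4 + A v0 v1 v3 v4 - A v0 v1 v2 v4 + A v0 v1 v2 v3| <= M.
  move: (ae_lift smu hM) => /ae_tuple5W; apply: filterS => v0; apply: filterS => v1.
  apply: filterS => v2; apply: filterS => v3; apply: filterS => v4.
  have t0 (t : 0.-tuple V) : tmap (@pt R \o @vec R) t = [tuple] by exact: tuple0.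
  by rewrite /A !map_tcons !t0 codiff4E.
have H : \forall v0 \ae lamV, \forall v1 \ae lamV, \forall v2 \ae lamV,
    \forall v3 \ae lamV, \forall v4 \ae lamV,
    `|five_term F (om v0 v1) (om v0 v2) (om v1 v2) (om v0 v3) (om v1 v3) (om v2 v3)
      (om v0 v4) (om v1 v4) (om v2 v4) (om v3 v4)| <= M /\
    `|A v0 v1 v2 v3 + cone F (om v0 v1) (om v0 v2) (om v0 v3) (om v1 v2) (om v1 v3)
      (om v2 v3) (om v0 v4) (om v1 v4) (om v2 v4) (om v3 v4)| <= M.
  (* The points are drawn in turn. The indices of a hypothesis g list the points already inserted
     into [E], and all five faces are complete once v4 is drawn. *)
  apply: filterS2 (H5) (H4) => v0 h5 g0.
  apply: filterS3 h5 (g0) (H4) => v1 h5 g01 g1.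
  apply: filterS3 h5 (filterI g01 g0) g1 => v2 h5 [g012 g02] g12.
  apply: filterS3 h5 (filterI g012 g01) (filterI g02 g12) => v3 h5 [e0123 g013] [g023 g123].
  apply: filterS3 h5 (filterI g012 g013) (filterI g023 g123).
  move=> v4 h5 [e0124 e0134] [e0234 e1234].
  split; last first.
    move: h5; rewrite e1234 e0234 e0134 e0124 /cone /cell; congr (`| _ | <= _); ring.
  by move: h5; rewrite e1234 e0234 e0134 e0124 e0123.
have [|K hK] := cone_bounded mF FZ (M := M).
  apply: (five_term_ae mF FZ walt wnd).
  apply: filterS H => v0; apply: filterS => v1; apply: filterS => v2; apply: filterS => v3.
  by apply: filterS => v4 [].
exists (K + M).
have mabs : measurable [set x | `|a x| <= K + M] by exact: measurable_norm_le.
apply/(power_smooth_class_ae smu mabs); apply/(ae_tuple4P lamV).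
  exact: measurable_comp_set (measurable_map_tuple (@measurable_pt R)) mabs.
apply: filterS2 H (ae_tuple4W (ae_generic walt wnd)) => v0; apply: filterS2 => v1.
apply: filterS2 => v2; apply: filterS2 => v3 h [gnz /(darboux_good_unit walt) uY].
have nz i j : (i < j < 4)%N -> w (vec (nth v0 [:: v0; v1; v2; v3] i))
    (vec (nth v0 [:: v0; v1; v2; v3] j)) != 0.
  move=> ij; have := gnz i j ij; rewrite /gij !mx4_row//.
    by case/andP: ij.
  by case/andP: ij => ij; exact: ltn_trans.
have := hK _ _ _ _ _ _ (nz 0%N 1%N isT) (nz 0%N 2%N isT) (nz 0%N 3%N isT) (nz 1%N 2%N isT)
  (nz 1%N 3%N isT) (nz 2%N 3%N isT).
move=> hs.
have {}hs : \forall s0 \ae lamC R, \forall s1 \ae lamC R, \forall s2 \ae lamC R,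
    \forall s3 \ae lamC R, `|0 + cone F (om v0 v1) (om v0 v2) (om v0 v3) (om v1 v2)
      (om v1 v3) (om v2 v3) s0 s1 s2 s3| <= K.
  apply: filterS hs => s0; apply: filterS => s1; apply: filterS => s2.
  by apply: filterS => s3; rewrite add0r.
have {}hs := cone_tuple_ae mF hs.
have idi : injective (id : 'I_4 -> 'I_4) by [].
have mc : measurable [set s : 4.-tuple C |
  `|0 + cone F (om v0 v1) (om v0 v2) (om v0 v3) (om v1 v2) (om v1 v3)
   (om v2 v3) (tnth s 0) (tnth s 1) (tnth s 2%:R) (tnth s 3%:R)| <= K].
  apply: measurable_norm_le; apply: measurable_funD; first exact: measurable_cst.
  by apply: (measurable_cone mF); try exact: measurable_cst; exact: measurable_tnth.
(* As v0, ..., v3 form a basis, the bound for almost all pairings becomes one for almost every v4,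
   and one v4 satisfies both estimates. *)
have {}hs := (ae_pairing wnd idi uY mc).1 hs.
have [v4 [[_ h1]]] := ae_ex (lamV_gt0 R) (filterI h hs).
rewrite !tnth_mktuple !row_mx4 add0r -/(A v0 v1 v2 v3).
move: h1; rewrite /om.
set c := cone _ _ _ _ _ _ _ _ _ _ _ => h1 h2.
have {}h2 : `|c| <= K by exact: h2.
move: c (A v0 v1 v2 v3) h1 h2; clear => c x; rewrite !ler_norml.
by do 2! case/andP => ? ?; apply/andP; split; lra.
Qed.

End BoundedCodiff.

Theorem corollary3p11 (R : realType) (w : {biscalar 'rV[R[i]]_4})
    (mu : probability (projSpace R) R) :
  alternating_form w -> nondegenerate_form w -> smooth_class mu ->
  injective (comparison mu (@Sp_act R w) 4).
Proof.
move=> walt wnd smu x y.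
rewrite -[x]reprK -[y]reprK !comparison_pi => /eqP.
rewrite -[_ == _]Quotient.idealrBE -cocycle_inclB => /asboolP[a [ma ainv] ca].
apply/eqP; rewrite -[_ == _]Quotient.idealrBE; apply/asboolP.
move: (repr x - repr y) ca => c /= ca.
have mu0 n : (0 < power_measure mu n setT)%E.
  by apply: power_measure_gt0; rewrite [X in (_ < X)%E]probability_setT.
have /asboolP[[/(Lfun_oo_bounded (mu0 _))[M cM] _] _] := cocycleP c.
(* [c] is the difference of two bounded cocycles and equals [da] almost everywhere, so the
   measurable primitive [a] is itself bounded. *)
have [|K aK] := @bounded_of_bounded_codiff _ _ _ walt wnd smu a M (set_mem ma) ainv.
  by apply: filterS2 ca cM => z /(_ I) <-.
by exists a => //; split => //; exact: (bounded_Lfun_oo (mu0 4%N) ma aK).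
Qed.
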